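(* Let $\Bbbk$ be a field of characteristic zero. For all $n\in\mathbb N\cup\{\infty\}$ and $t\in\Bbbk$ there is a surjective map of locally unital $\Bbbk$-algebras $$\psi=\psi_{n,t}:\dot{\mathcal U}_{\Bbbk}(n,t)\twoheadrightarrow\mathbb S_{\Bbbk}(n,t).$$
   Context: A map of locally unital algebras here means an algebra homomorphism sending each distinguished idempotent to a distinguished idempotent or to $0$. The algebra $\dot{\mathcal U}_{\Bbbk}(n,t)$. $\mathbb N=\{1,2,\dots\}$, $[1,n]=\{1,\dots,n\}$ ($[1,\infty]=\mathbb N$), and $[1,n-1]=\mathbb N$ if $n=\infty$. $X(n)_t$ is the set of finitely supported $\lambda=\sum_{i\in[1,n]}\lambda_i\varepsilon_i$ with $\lambda_1\in t-\mathbb Z$ and $\lambda_i\in\mathbb Z$ for $i\ge2$ ($\lambda_1$ viewed in $\Bbbk$); $\alpha_i=\varepsilon_i-\varepsilon_{i+1}$. $\dot{\mathcal U}_{\Bbbk}(n,t)$ is the locally unital associative $\Bbbk$-algebra with generators $e_i^\lambda,f_i^\lambda$ ($\lambda\in X(n)_t$, $i\in[1,n-1]$) and $1_\lambda$ ($\lambda\in X(n)_t$), with relations for all $\lambda,\mu,i,j$: (U0) $1_\lambda1_\mu=\delta_{\lambda,\mu}1_\lambda$; (U1) $e_i^\lambda1_\mu=\delta_{\lambda,\mu}e_i^\lambda$, $1_\mu e_i^\lambda=\delta_{\lambda+\alpha_i,\mu}e_i^\lambda$; (U2) $f_i^\lambda1_\mu=\delta_{\lambda+\alpha_i,\mu}f_i^\lambda$,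 $1_\mu f_i^\lambda=\delta_{\lambda,\mu}f_i^\lambda$; (U3) if $|i-j|=1$, $e_i^{\lambda+\alpha_j+\alpha_i}e_i^{\lambda+\alpha_j}e_j^\lambda-2e_i^{\lambda+\alpha_i+\alpha_j}e_j^{\lambda+\alpha_i}e_i^\lambda+e_j^{\lambda+2\alpha_i}e_i^{\lambda+\alpha_i}e_i^\lambda=0$; (U4) if $|i-j|=1$, $f_i^\lambda f_i^{\lambda+\alpha_i}f_j^{\lambda+2\alpha_i}-2f_i^\lambda f_j^{\lambda+\alpha_i}f_i^{\lambda+\alpha_i+\alpha_j}+f_j^\lambda f_i^{\lambda+\alpha_j}f_i^{\lambda+\alpha_i+\alpha_j}=0$; (U5) if $|i-j|\ne1$, $e_i^{\lambda+\alpha_j}e_j^\lambda=e_j^{\lambda+\alpha_i}e_i^\lambda$; (U6) if $|i-j|\ne1$, $f_i^\lambda f_j^{\lambda+\alpha_i}=f_j^\lambda f_i^{\lambda+\alpha_j}$; (U7) $e_i^{\lambda-\alpha_j}f_j^{\lambda-\alpha_j}-f_j^{\lambda+\alpha_i-\alpha_j}e_i^\lambda=\delta_{i,j}(\lambda_i-\lambda_{i+1})1_\lambda$. Distinguished idempotents: the $1_\lambda$. Combinatorics. $\Lambda(n)_t$ is the set of sequences $\beta=(\beta_i)_{i\in[1,n]}$ with $\beta_1\in t-\mathbb Z$, $\beta_i\in\mathbb Z_{\ge 0}$ for $i\ge 2$ (all but finitely many equal to $0$), and $\sum_i\beta_i=t$; it is regarded as a subset of $X(n)_t$ via $\beta\mapsto\sum_i\beta_i\varepsilon_i$.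 The category $\operatorname{Perm}$. $\mathfrak S_\infty$ is the group of all bijections of $\Omega=\mathbb N$, with the topology in which the pointwise stabilizers of finite subsets of $\Omega$ form a base of open neighborhoods of the identity. An action of an open subgroup $U$ on a set is smooth if all point stabilizers are open. A finitary $\widehat{\mathfrak S}_\infty$-set is a set with a smooth action of some open subgroup $U\subseteq\mathfrak S_\infty$ having finitely many orbits (one may shrink $U$); a finitary $\mathfrak S_\infty$-set is a smooth $\mathfrak S_\infty$-set with finitely many orbits. Let $\mathfrak S(p)$ be the pointwise stabilizer of $\{1,\dots,p\}$. For a finitary $\widehat{\mathfrak S}_\infty$-set $X$ there is a unique polynomial $p_X\in\mathbb Q[T]$ with $p_X(p)=|X^{\mathfrak S(p)}|$ for all sufficiently large integers $p$; set $\mu_t(X)=p_X(t)$. If $f:X\to\Bbbk$ is constant on the orbits of such an open subgroup, put $\int_X f(x)\,dx=\sum_c c\,\mu_t(f^{-1}(c))$, the sum being over the finitely many values $c$ of $f$. The category $\operatorname{Perm}(\mathfrak S_\infty;\mu_t)$ has as objects the finitary $\mathfrak S_\infty$-sets; $\operatorname{Hom}(X,Y)$ is the space of functions $Y\times X\to\Bbbk$ constant on the diagonal $\mathfrak S_\infty$-orbits; composition is $(g\circ f)(z,x)=\int_Y g(z,y)f(y,x)\,dy$. The algebra $\mathbb S_{\Bbbk}(n,t)$. For $\beta\in\Lambda(n)_t$ and $k\ge2$ let $\{\beta\}_k=[1+\sum_{i=2}^{k-1}\beta_i,\ \sum_{i=2}^{k}\beta_i]\subset\Omega$ and $\{\beta\}_1=\Omega\setminus\bigcup_{k\ge2}\{\beta\}_k$.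 $\mathfrak S_\beta\le\mathfrak S_\infty$ is the subgroup preserving each $\{\beta\}_k$, and $\mathcal X^\beta=\mathfrak S_\infty/\mathfrak S_\beta$. $\mathbb S_{\Bbbk}(n,t)=\bigoplus_{\beta,\delta\in\Lambda(n)_t}\operatorname{Hom}_{\operatorname{Perm}(\mathfrak S_\infty;\mu_t)}(\mathcal X^\beta,\mathcal X^\delta)$, with product given by composition (zero if not composable). Its distinguished idempotents are the identity morphisms $1_\beta$ of $\mathcal X^\beta$, $\beta\in\Lambda(n)_t$. *)

(* Defs.v *)
From HB Require Import structures.
From mathcomp Require Export all_boot all_order all_algebra.
From mathcomp Require Export boolp classical_sets functions cardinality fsbigop.
From mathcomp Require Export generic_quotient topology.
Set Implicit Arguments.
Unset Strict Implicit.
Unset Printing Implicit Defensive.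
Import Order.TTheory GRing.Theory.
Local Open Scope classical_set_scope.
Local Open Scope quotient_scope.
Local Open Scope card_scope.
Local Open Scope ring_scope.

(* Locally unital algebras: the data are recorded in [lu_algebra], the axioms
   in [locally_unital]; a map of locally unital algebras is required to have
   source and target satisfying the axioms. *)
Record lu_algebra (k : fieldType) := LUAlgebra {
  lu_sort :> lmodType k;
  lu_mul : lu_sort -> lu_sort -> lu_sort;
  lu_idx : Type;
  lu_one : lu_idx -> lu_sort
}.

(* As the idempotents are orthogonal, the last clause is equivalent to
   A being the direct sum of the subspaces 1_i A 1_j. *)
Definition locally_unital (k : fieldType) (A : lu_algebra k) : Prop :=
  [/\ forall x : A, linear (lu_mul x),
      forall y : A, linear ((@lu_mul k A)^~ y),
      associative (@lu_mul k A),
      forall i j : lu_idx A, lu_mul (lu_one i) (lu_one j) =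
        if `[< i = j >] then lu_one i else 0
    & forall x : A, exists s : seq (lu_idx A * A * lu_idx A),
        x = \sum_(w <- s) lu_mul (lu_mul (lu_one w.1.1) w.1.2) (lu_one w.2)].

Definition lu_map (k : fieldType) (A B : lu_algebra k) (f : A -> B) : Prop :=
  [/\ locally_unital A, locally_unital B,
      linear f,
      forall x y : A, f (lu_mul x y) = lu_mul (f x) (f y)
    & forall i : lu_idx A,
        f (lu_one i) = 0 \/ exists j : lu_idx B, f (lu_one i) = lu_one j].

(* n : option nat stands for an element of {1, 2, ...} or, when n = None, for
   infinity; indices i in [1, n] are natural numbers counted from 1. *)
Definition in_range (n : option nat) (i : nat) : bool :=
  (0 < i)%N && (if n is Some m then (i <= m)%N else true).

Definition root_idx (n : option nat) : Type :=
  {i : nat | (0 < i)%N && (if n is Some m then (i < m)%N else true)}.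

Lemma root_idx_range n (i : root_idx n) :
  in_range n (sval i) && in_range n (sval i).+1.
Proof.
case: i => i /=; rewrite /in_range; case: n => [m|] /andP[-> h] //=.
by rewrite h ltnW.
Qed.

Section Weights.
Variables (k : fieldType) (n : option nat) (t : k).

(* The set X(n)_t, with all coordinates viewed in k. *)
Definition is_weight (l : nat -> k) : Prop :=
  [/\ finite_set [set i | l i != 0],
      forall i, ~~ in_range n i -> l i = 0,
      exists z : int, l 1%N = t - z%:~R
    & forall i, (2 <= i)%N -> exists z : int, l i = z%:~R].

Record weight := Weight { weight_val :> nat -> k; weightP : is_weight weight_val }.

Definition alpha (i : nat) : nat -> int :=
  fun j => (j == i)%:R - (j == i.+1)%:R.

Lemma shift_subproof (l : weight) (i : root_idx n) (z : int) :
  is_weight (fun j => l j + (z * alpha (sval i) j)%:~R).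
Proof.
have [fl rl [z1 l1] zl] := weightP l.
have /andP[r1 r2] := root_idx_range i.
split.
- have f2 : finite_set [set sval i; (sval i).+1] by exact: finite_set2.
  apply: sub_finite_set (_ : finite_set ([set j | l j != 0] `|` [set sval i; (sval i).+1])).
    move=> j /=; have [->|l0] := eqVneq (l j) 0; last by left.
    rewrite add0r /alpha.
    have [->|] := eqVneq j (sval i); first by right; left.
    have [->|] := eqVneq j (sval i).+1; first by right; right.
    by rewrite subrr mulr0 eqxx.
  by rewrite finite_setU.
- move=> j nj; rewrite rl // add0r /alpha.
  have [e|_] := eqVneq j (sval i); first by rewrite e r1 in nj.
  have [e|_] := eqVneq j (sval i).+1; first by rewrite e r2 in nj.
  by rewrite subrr mulr0.
- exists (z1 - z * alpha (sval i) 1).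
  by rewrite l1 intrB opprB addrA addrAC.
- move=> j hj; have [w ->] := zl _ hj.
  by exists (w + z * alpha (sval i) j); rewrite intrD.
Qed.

Definition shift (l : weight) (i : root_idx n) (z : int) : weight :=
  Weight (shift_subproof l i z).

End Weights.

Notation "l +^ i" := (shift l i 1) (at level 50, left associativity).
Notation "l -^ i" := (shift l i (-1)) (at level 50, left associativity).

(* The locally unital algebra with generators e_i^lambda, f_i^lambda, 1_lambda:
   terms in the generators modulo the congruence generated by the axioms of
   (not necessarily unital) associative k-algebras and by the relations. *)
Section Udot.
Variables (k : fieldType) (n : option nat) (t : k).
Local Notation X := (weight n t).
Local Notation I := (root_idx n).

Inductive term : Type :=
| tE of I & X
| tF of I & X
| tOne of X
| tZero
| tAdd of term & term
| tScale of k & term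
| tMul of term & term.

Local Notation e := tE.
Local Notation f := tF.
Local Notation one := tOne.
Local Notation "0" := tZero.
Local Notation "x + y" := (tAdd x y).
Local Notation "a *: x" := (tScale a x).
Local Notation "x * y" := (tMul x y).
Local Notation delta P := ((`[< P >] : bool)%:R : k).

Definition adjacent (i j : I) : Prop :=
  (sval i).+1 = sval j \/ (sval j).+1 = sval i.

(* In [tF i l], l is the target: it is the generator of weight -alpha_i from l + alpha_i to l. *)
Inductive Udot_rel : term -> term -> Prop :=
| U0 l m : Udot_rel (one l * one m) (delta (l = m) *: one l)
| U1r i l m : Udot_rel (e i l * one m) (delta (l = m) *: e i l)
| U1l i l m : Udot_rel (one m * e i l) (delta (l +^ i = m) *: e i l)
| U2r i l m : Udot_rel (f i l * one m) (delta (l +^ i = m) *: f i l)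
| U2l i l m : Udot_rel (one m * f i l) (delta (l = m) *: f i l)
| U3 i j l : adjacent i j -> Udot_rel
    (e i (l +^ j +^ i) * e i (l +^ j) * e j l
      + (- 2%:R) *: (e i (l +^ i +^ j) * e j (l +^ i) * e i l)
      + e j (l +^ i +^ i) * e i (l +^ i) * e i l) 0
| U4 i j l : adjacent i j -> Udot_rel
    (f i l * f i (l +^ i) * f j (l +^ i +^ i)
      + (- 2%:R) *: (f i l * f j (l +^ i) * f i (l +^ i +^ j))
      + f j l * f i (l +^ j) * f i (l +^ i +^ j)) 0
| U5 i j l : ~ adjacent i j ->
    Udot_rel (e i (l +^ j) * e j l) (e j (l +^ i) * e i l)
| U6 i j l : ~ adjacent i j ->
    Udot_rel (f i l * f j (l +^ i)) (f j l * f i (l +^ j))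
| U7 i j l : Udot_rel
    (e i (l -^ j) * f j (l -^ j) + (- 1%R) *: (f j (l +^ i -^ j) * e i l))
    ((delta (i = j) * (l (sval i) - l (sval i).+1))%R *: one l).

Inductive term_eq : term -> term -> Prop :=
| teq_rel x y : Udot_rel x y -> term_eq x y
| teq_refl x : term_eq x x
| teq_sym x y : term_eq x y -> term_eq y x
| teq_trans x y z : term_eq x y -> term_eq y z -> term_eq x z
| teq_add x x' y y' : term_eq x x' -> term_eq y y' -> term_eq (x + y) (x' + y')
| teq_scale a x x' : term_eq x x' -> term_eq (a *: x) (a *: x')
| teq_mul x x' y y' : term_eq x x' -> term_eq y y' -> term_eq (x * y) (x' * y')
| teq_addA x y z : term_eq (x + (y + z)) (x + y + z)
| teq_addC x y : term_eq (x + y) (y + x)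
| teq_add0 x : term_eq (0 + x) x
| teq_addN x : term_eq ((- 1%R) *: x + x) 0
| teq_scaleA a b x : term_eq (a *: (b *: x)) ((a * b)%R *: x)
| teq_scale1 x : term_eq (1%R *: x) x
| teq_scaleDr a x y : term_eq (a *: (x + y)) (a *: x + a *: y)
| teq_scaleDl a b x : term_eq ((a + b)%R *: x) (a *: x + b *: x)
| teq_mulA x y z : term_eq (x * (y * z)) (x * y * z)
| teq_mulDl x y z : term_eq ((x + y) * z) (x * z + y * z)
| teq_mulDr x y z : term_eq (x * (y + z)) (x * y + x * z)
| teq_scaleAl a x y : term_eq ((a *: x) * y) (a *: (x * y))
| teq_scaleAr a x y : term_eq (x * (a *: y)) (a *: (x * y)).

HB.instance Definition _ := gen_eqMixin term.
HB.instance Definition _ := gen_choiceMixin term.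

Definition term_eqb (x y : term) : bool := `[< term_eq x y >].

Lemma term_eqb_equiv : equiv_class_of term_eqb.
Proof.
split=> [x|x y|y x z]; first exact/asboolP/teq_refl.
  by apply/asboolP/asboolP; exact: teq_sym.
by move=> /asboolP h /asboolP h'; apply/asboolP; exact: teq_trans h h'.
Qed.

Canonical term_eqb_equiv_rel := EquivRelPack term_eqb_equiv.

Definition Udot_sort : Type := {eq_quot term_eqb}.
HB.instance Definition _ := Choice.on Udot_sort.

Definition Udot_pi (x : term) : Udot_sort := \pi_({eq_quot term_eqb}) x.
Definition Udot_repr (x : Udot_sort) : term := repr (x : {eq_quot term_eqb}).

Lemma Udot_reprK x : Udot_pi (Udot_repr x) = x.
Proof. exact: reprK. Qed.

Lemma Udot_piP x y : Udot_pi x = Udot_pi y <-> term_eq x y.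
Proof.
split=> [h|h].
  by apply/asboolP; move/eqmodP: h.
by apply/eqmodP; apply/asboolP.
Qed.

Definition Udot_add (x y : Udot_sort) := Udot_pi (Udot_repr x + Udot_repr y).
Definition Udot_scale a (x : Udot_sort) := Udot_pi (a *: Udot_repr x).
Definition Udot_mul (x y : Udot_sort) := Udot_pi (Udot_repr x * Udot_repr y).

Lemma Udot_repr_pi x : term_eq (Udot_repr (Udot_pi x)) x.
Proof. by apply/Udot_piP; rewrite Udot_reprK. Qed.

Lemma Udot_pi_add x y : Udot_add (Udot_pi x) (Udot_pi y) = Udot_pi (x + y).
Proof. by apply/Udot_piP; apply: teq_add; exact: Udot_repr_pi. Qed.

Lemma Udot_pi_scale a x : Udot_scale a (Udot_pi x) = Udot_pi (a *: x).
Proof. by apply/Udot_piP; apply: teq_scale; exact: Udot_repr_pi. Qed.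

Lemma Udot_pi_mul x y : Udot_mul (Udot_pi x) (Udot_pi y) = Udot_pi (x * y).
Proof. by apply/Udot_piP; apply: teq_mul; exact: Udot_repr_pi. Qed.

Lemma Udot_ind (P : Udot_sort -> Prop) : (forall x, P (Udot_pi x)) -> forall x, P x.
Proof. by move=> h x; rewrite -(Udot_reprK x). Qed.

Lemma Udot_addA : associative Udot_add.
Proof.
elim/Udot_ind=> x; elim/Udot_ind=> y; elim/Udot_ind=> z.
by rewrite !Udot_pi_add; apply/Udot_piP/teq_addA.
Qed.

Lemma Udot_addC : commutative Udot_add.
Proof.
elim/Udot_ind=> x; elim/Udot_ind=> y.
by rewrite !Udot_pi_add; apply/Udot_piP/teq_addC.
Qed.

Lemma Udot_add0 : left_id (Udot_pi 0) Udot_add.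
Proof. by elim/Udot_ind=> x; rewrite !Udot_pi_add; apply/Udot_piP/teq_add0. Qed.

Lemma Udot_addN : left_inverse (Udot_pi 0) (Udot_scale (- 1%R)) Udot_add.
Proof.
elim/Udot_ind=> x; rewrite Udot_pi_scale Udot_pi_add.
exact/Udot_piP/teq_addN.
Qed.

HB.instance Definition _ :=
  GRing.isZmodule.Build Udot_sort Udot_addA Udot_addC Udot_add0 Udot_addN.

Lemma Udot_scaleA a b x : Udot_scale a (Udot_scale b x) = Udot_scale (a * b)%R x.
Proof.
by elim/Udot_ind: x => x; rewrite !Udot_pi_scale; apply/Udot_piP/teq_scaleA.
Qed.

Lemma Udot_scale1 : left_id 1%R Udot_scale.
Proof. by elim/Udot_ind=> x; rewrite !Udot_pi_scale; apply/Udot_piP/teq_scale1. Qed.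

Lemma Udot_scaleDr : right_distributive Udot_scale (@GRing.add Udot_sort).
Proof.
move=> a; elim/Udot_ind=> x; elim/Udot_ind=> y.
rewrite /GRing.add /= !(Udot_pi_add, Udot_pi_scale).
exact/Udot_piP/teq_scaleDr.
Qed.

Lemma Udot_scaleDl x : {morph Udot_scale^~ x : a b / (a + b)%R}.
Proof.
elim/Udot_ind: x => x a b.
rewrite /GRing.add /= !(Udot_pi_add, Udot_pi_scale).
exact/Udot_piP/teq_scaleDl.
Qed.

HB.instance Definition _ :=
  GRing.Zmodule_isLmodule.Build k Udot_sort
    Udot_scaleA Udot_scale1 Udot_scaleDr Udot_scaleDl.

Definition Udot : lu_algebra k :=
  @LUAlgebra k Udot_sort Udot_mul X (fun l => Udot_pi (one l)).

End Udot.

(* The set Omega = {1, 2, ...} is encoded by nat, with x : nat standing for the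
   element x + 1 of Omega.  The infinite symmetric group is the group of all
   bijections of Omega. *)
Record Sinf := SInf {
  sfun :> nat -> nat;
  sinv : nat -> nat;
  sfunK : cancel sfun sinv;
  sinvK : cancel sinv sfun
}.

Lemma Sinf_eq (s u : Sinf) : (forall x, s x = u x) -> s = u.
Proof.
case: s u => [f g fg gf] [f' g' fg' gf'] /= e.
have ef : f = f' by apply/funext.
rewrite -{}ef in fg' gf' *.
have eg : g = g' by apply/funext=> x; rewrite -{1}(gf' x) fg.
rewrite -{}eg in fg' gf' *.
by congr SInf; exact: Prop_irrelevance.
Qed.

HB.instance Definition _ := gen_eqMixin Sinf.
HB.instance Definition _ := gen_choiceMixin Sinf.

Definition Sinf_one : Sinf := @SInf id id (fun=> erefl) (fun=> erefl).
Definition Sinf_inv (s : Sinf) : Sinf := SInf (@sinvK s) (@sfunK s).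
Definition Sinf_mul (s u : Sinf) : Sinf :=
  SInf (can_comp (@sfunK s) (@sfunK u)) (can_comp (@sinvK u) (@sinvK s)).

Lemma Sinf_mulA : associative Sinf_mul.
Proof. by move=> s u v; exact: Sinf_eq. Qed.
Lemma Sinf_mul1 : left_id Sinf_one Sinf_mul.
Proof. by move=> s; exact: Sinf_eq. Qed.
Lemma Sinf_1mul : right_id Sinf_one Sinf_mul.
Proof. by move=> s; exact: Sinf_eq. Qed.
Lemma Sinf_mulV : left_inverse Sinf_one Sinf_inv Sinf_mul.
Proof. by move=> s; apply: Sinf_eq => x /=; rewrite sfunK. Qed.
Lemma Sinf_mulVr : right_inverse Sinf_one Sinf_inv Sinf_mul.
Proof. by move=> s; apply: Sinf_eq => x /=; rewrite sinvK. Qed.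

HB.instance Definition _ := isGroup.Build Sinf
  Sinf_mulA Sinf_mul1 Sinf_1mul Sinf_mulV Sinf_mulVr.

Lemma SinfM (s u : Sinf) x : (s * u)%g x = s (u x).
Proof. by []. Qed.

Lemma Sinf1 x : (1%g : Sinf) x = x.
Proof. by []. Qed.

Lemma SinfKV (s : Sinf) : cancel s (s^-1)%g.
Proof. exact: sfunK. Qed.

Lemma SinfVK (s : Sinf) : cancel (s^-1)%g s.
Proof. exact: sinvK. Qed.

Definition pstab (F : set nat) : set Sinf := [set s | forall x, F x -> s x = x].

Definition Sinf_open : set (set Sinf) :=
  [set U | forall s, U s -> exists2 F : set nat,
     finite_set F & [set (s * u)%g | u in pstab F] `<=` U].

Lemma Sinf_openT : Sinf_open setT.
Proof. by move=> s _; exists set0. Qed.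

Lemma Sinf_openI : setI_closed Sinf_open.
Proof.
move=> U V oU oV s [Us Vs].
have [F fF FU] := oU _ Us; have [G fG GV] := oV _ Vs.
exists (F `|` G); first by rewrite finite_setU.
move=> _ [u hu <-]; split.
  by apply: FU; exists u => // x hx; apply: hu; left.
by apply: GV; exists u => // x hx; apply: hu; right.
Qed.

Lemma Sinf_open_bigU (J : Type) (U : J -> set Sinf) :
  (forall i, Sinf_open (U i)) -> Sinf_open (\bigcup_i U i).
Proof.
move=> oU s [i _ Us]; have [F fF FU] := oU i _ Us.
by exists F => // v /FU Uv; exists i.
Qed.

HB.instance Definition _ :=
  isOpenTopological.Build Sinf Sinf_openT Sinf_openI Sinf_open_bigU.

Lemma Sinf_openE : open = Sinf_open :> set (set Sinf).
Proof. by []. Qed.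

Record perm_set := PermSet {
  pset :> Type;
  act : Sinf -> pset -> pset;
  act1 : forall x, act 1%g x = x;
  actM : forall s u x, act (s * u)%g x = act s (act u x);
  act_smooth : forall x, open [set s | act s x = x];
  act_finitary : finite_set (range (fun x => [set act s x | s in setT]))
}.

Lemma actK (Y : perm_set) (s : Sinf) : cancel (@act Y s) (act (s^-1)%g).
Proof. by move=> y; rewrite -actM mulVg act1. Qed.

Lemma actVK (Y : perm_set) (s : Sinf) : cancel (act (s^-1)%g) (@act Y s).
Proof. by move=> y; rewrite -actM mulgV act1. Qed.

(* A subset A of Y stable under an open subgroup U is a smooth U-set with
   finitely many orbits.  The group S(p) is [pstab `I_p]; for p large it is
   contained in U, and then the set of its fixed points in A is
   [fixed_points A p]. *)
Section Measure.
Variable Y : perm_set.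

Definition fixed_points (A : set Y) (p : nat) : set Y :=
  [set y | A y /\ forall s, pstab `I_p s -> act s y = y].

Definition is_counting_poly (A : set Y) (P : {poly rat}) : Prop :=
  exists N : nat, forall p : nat, (N <= p)%N ->
    exists m : nat, fixed_points A p #= `I_m /\ P.[p%:R] = m%:R.

Definition counting_poly (A : set Y) : {poly rat} :=
  xget 0 [set P | is_counting_poly A P].

Definition mu (k : fieldType) (t : k) (A : set Y) : k :=
  (map_poly ratr (counting_poly A)).[t].

Definition integral (k : fieldType) (t : k) (h : Y -> k) : k :=
  \sum_(c \in range h) c * mu t (h @^-1` [set c]).

End Measure.

Section Invariance.

Definition transp (a b x : nat) : nat :=
  if x == a then b else if x == b then a else x.

Lemma transpK a b : involutive (transp a b).
Proof.
move=> x; rewrite /transp.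
have [->|xa] := eqVneq x a.
  by rewrite eqxx; have [->|] := eqVneq b a.
have [->|xb] := eqVneq x b; first by rewrite eqxx.
by rewrite (negPf xa) (negPf xb).
Qed.

Lemma finitary_approx (s : Sinf) (q : nat) : exists2 u : Sinf,
  (forall x, (x < q)%N -> u x = s x) &
  exists N, forall x, (N <= x)%N -> u x = x.
Proof.
elim: q => [|q [u us [N uN]]]; first by exists 1%g => //; exists 0%N.
pose T := SInf (@transpK (u q) (s q)) (@transpK (u q) (s q)).
exists (T * u)%g.
  move=> x; rewrite ltnS leq_eqVlt SinfM /= /transp => /orP[/eqP ->|xq].
    by rewrite eqxx.
  have nxq : x <> q by move=> e; rewrite e ltnn in xq.
  case: eqP => [/(can_inj (@sfunK u))//|_].
  case: eqP => [|_]; last exact: us.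
  by rewrite us // => /(can_inj (@sfunK s)).
exists (maxn N (maxn (u q) (s q)).+1) => x.
rewrite !geq_max => /andP[Nx]; rewrite gtn_max => /andP[ux sx].
by rewrite SinfM uN //= /transp !gtn_eqF.
Qed.

Variable Y : perm_set.

Lemma is_counting_poly_act (s : Sinf) (q : nat) (A : set Y) P :
  (forall u y, pstab `I_q u -> A (act u y) <-> A y) ->
  is_counting_poly A P -> is_counting_poly [set y | A (act (s^-1)%g y)] P.
Proof.
move=> Aq [N hN].
have [u us [M uM]] := finitary_approx s q.
have uV p x : (M <= p)%N -> (p <= x)%N -> u x = x.
  by move=> Mp px; apply: uM; exact: leq_trans px.
have uVV x : (M <= x)%N -> (u^-1)%g x = x.
  by move=> Mx; rewrite -{1}(uM _ Mx) SinfKV.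
have ult p x : (M <= p)%N -> (x < p)%N -> (u x < p)%N.
  move=> Mp xp; rewrite ltnNge; apply/negP => h.
  have := uVV _ (leq_trans Mp h); rewrite SinfKV => e.
  by move: h; rewrite -e leqNgt xp.
have uVlt p x : (M <= p)%N -> (x < p)%N -> ((u^-1)%g x < p)%N.
  move=> Mp xp; rewrite ltnNge; apply/negP => h.
  have := uM _ (leq_trans Mp h); rewrite SinfVK => e.
  by move: h; rewrite -e leqNgt xp.
have AE y : A (act (s^-1)%g y) <-> A (act (u^-1)%g y).
  rewrite -(Aq (u^-1 * s)%g (act (s^-1)%g y)).
    by rewrite -actM -mulgA mulgV mulg1.
  by move=> x xq; rewrite SinfM -(us x xq) SinfKV.
exists (maxn N M) => p; rewrite geq_max => /andP[Np Mp].
have [m [Am Pm]] := hN p Np; exists m; split=> //.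
apply: card_eq_trans Am.
suff -> : fixed_points [set y | A (act (s^-1)%g y)] p =
          [set act u y | y in fixed_points A p].
  by apply: inj_card_eq => x y _ _ /(can_inj (@actK Y u)).
apply/seteqP; split=> [y [/AE Ay fy]|_ [y [Ay fy] <-]].
  exists (act (u^-1)%g y); last exact: actVK.
  split=> // v hv; rewrite -{2}(fy (u * v * u^-1)%g).
    by rewrite -!actM !mulgA mulVg mul1g.
  by move=> x xp; rewrite !SinfM hv ?SinfVK //; exact: uVlt.
split=> [|v hv]; first by apply/AE; rewrite actK.
rewrite -{2}(fy (u^-1 * v * u)%g).
  by rewrite -!actM !mulgA mulgV mul1g.
by move=> x xp; rewrite !SinfM hv ?SinfKV //; exact: ult.
Qed.

Lemma mu_act (k : fieldType) (t : k) (s : Sinf) (q : nat) (A : set Y) :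
  (forall u y, pstab `I_q u -> A (act u y) <-> A y) ->
  mu t [set y | A (act (s^-1)%g y)] = mu t A.
Proof.
move=> Aq; rewrite /mu /counting_poly; congr ((map_poly _ (xget _ _)).[_]).
apply/seteqP; split=> P /=; last exact: is_counting_poly_act Aq.
have [r qr] : exists r, forall x, (x < q)%N -> (s x < r)%N.
  elim: q {Aq} => [|q [r hr]]; first by exists 0%N.
  exists (maxn r (s q).+1) => x; rewrite ltnS leq_eqVlt leq_max.
  by case/orP => [/eqP ->|/hr ->]; rewrite ?leqnn ?orbT.
move=> /(@is_counting_poly_act (s^-1)%g r) h.
have -> : A = [set y | [set y | A (act (s^-1)%g y)] (act ((s^-1)^-1)%g y)].
  by apply/seteqP; split=> y /=; rewrite invgK actK.
apply: h => u y /= hu; rewrite -(Aq (s^-1 * u * s)%g (act (s^-1)%g y)).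
  by rewrite -!actM -!mulgA mulgV mulg1.
by move=> x xq; rewrite !SinfM hu ?SinfKV //; exact: qr.
Qed.

Lemma integral_act (k : fieldType) (t : k) (s : Sinf) (q : nat) (h : Y -> k) :
  (forall u y, pstab `I_q u -> h (act u y) = h y) ->
  integral t (h \o act (s^-1)%g) = integral t h.
Proof.
move=> hq; rewrite /integral.
have -> : range (h \o act (s^-1)%g) = range h.
  apply/seteqP; split=> _ [y _ <-]; first by exists (act (s^-1)%g y).
  by exists (act s y) => //=; rewrite actK.
apply: eq_fsbigr => c _; congr (_ * _).
by apply: (@mu_act k t s q (h @^-1` [set c])) => u y /hq /= ->.
Qed.

Lemma smooth_bound (y : Y) :
  exists q, forall u, pstab `I_q u -> act u y = y.
Proof.
have /(_ 1%g (act1 y)) [F fF hF] := @act_smooth Y y.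
have [q Fq] : exists q, F `<=` `I_q.
  have [r ->] := (finite_seqP F).1 fF.
  exists (\max_(i <- r) i).+1 => i /= ir; rewrite ltnS.
  exact: (@leq_bigmax_seq _ _ predT (fun i => i)).
exists q => u hu; apply: hF; exists u; last by rewrite mul1g.
by move=> x /Fq; exact: hu.
Qed.

End Invariance.

(* Hom X Y is the space of morphisms X -> Y of Perm(Sinf; mu_t): functions on
   Y * X invariant under the diagonal action. *)
Section Perm.
Variable k : fieldType.

Definition diag_inv (X Y : perm_set) : {pred (Y * X -> k^o)} :=
  fun f => `[< forall s y x, f (act s y, act s x) = f (y, x) >].
Arguments diag_inv : clear implicits.

Record Hom (X Y : perm_set) := MkHom {
  hom_val :> Y * X -> k^o;
  hom_inv : hom_val \in diag_inv X Y
}.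

HB.instance Definition _ (X Y : perm_set) := [isSub for @hom_val X Y].
HB.instance Definition _ (X Y : perm_set) := [Choice of Hom X Y by <:].

Lemma diag_inv_submod X Y : submod_closed (diag_inv X Y).
Proof.
split=> [|a f g /asboolP hf /asboolP hg]; apply/asboolP => s y x //.
by rewrite /= !fctE hf hg.
Qed.

HB.instance Definition _ (X Y : perm_set) :=
  GRing.isSubmodClosed.Build k (Y * X -> k^o) (diag_inv X Y)
    (diag_inv_submod X Y).
HB.instance Definition _ (X Y : perm_set) := [SubChoice_isSubLmodule of Hom X Y by <:].

Lemma id_subproof (X : perm_set) :
  (fun p => (`[< p.1 = p.2 >] : bool)%:R) \in diag_inv X X.
Proof.
apply/asboolP => s y x /=; congr (nat_of_bool _)%:R.
by apply/asbool_equiv_eq; split=> [/(can_inj (@actK X s))|->].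
Qed.

Definition perm_id (X : perm_set) : Hom X X := MkHom (id_subproof X).

Lemma comp_subproof (t : k) X Y Z (g : Hom Y Z) (f : Hom X Y) :
  (fun p => integral t (fun y => g (p.1, y) * f (y, p.2)) : k^o)
    \in diag_inv X Z.
Proof.
apply/asboolP => s z x /=.
have [q1 h1] := smooth_bound z; have [q2 h2] := smooth_bound x.
have gI := asboolP _ (hom_inv g); have fI := asboolP _ (hom_inv f).
rewrite -[RHS](@integral_act Y k t s (maxn q1 q2)).
  congr (integral t _); apply/funext => y /=.
  by rewrite -(gI s z) -(fI s _ x) actVK.
move=> u y hu.
have uz : act u z = z.
  by apply: h1 => i /= hi; apply: hu; rewrite /= leq_max hi.
have ux : act u x = x.
  by apply: h2 => i /= hi; apply: hu; rewrite /= leq_max hi orbT.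
by rewrite -{1}uz -{1}ux gI fI.
Qed.

Definition perm_comp (t : k) X Y Z (g : Hom Y Z) (f : Hom X Y) : Hom X Z :=
  MkHom (comp_subproof t g f).

Lemma integral0 (t : k) (Y : perm_set) : integral t (fun _ : Y => 0) = 0.
Proof. by rewrite /integral fsbig1 // => _ [y _ <-]; rewrite mul0r. Qed.

Lemma perm_comp0 t X Y Z (g : Hom Y Z) : perm_comp t g (0 : Hom X Y) = 0.
Proof.
apply: val_inj; apply/funext => p /=.
rewrite -[RHS](@integral0 t Y); congr (integral t _).
by apply/funext => y; rewrite /= mulr0.
Qed.

Lemma perm_0comp t X Y Z (f : Hom X Y) : perm_comp t (0 : Hom Y Z) f = 0.
Proof.
apply: val_inj; apply/funext => p /=.
rewrite -[RHS](@integral0 t Y); congr (integral t _).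
by apply/funext => y; rewrite /= mul0r.
Qed.

End Perm.

Section DirectSum.
Variables (k : fieldType) (I : choiceType) (M : I -> lmodType k).

Record dsum := DSum {
  dval :> forall i, M i;
  dsum_fin : finite_set [set i | dval i != 0]
}.

Lemma dsum_eq (x y : dsum) : (forall i, x i = y i) -> x = y.
Proof.
case: x y => [x fx] [y fy] /= e.
have exy : x = y by apply: functional_extensionality_dep.
by rewrite -{}exy in fy *; congr DSum; exact: Prop_irrelevance.
Qed.

HB.instance Definition _ := gen_eqMixin dsum.
HB.instance Definition _ := gen_choiceMixin dsum.

Lemma dsum0_subproof : finite_set [set i | (0 : M i) != 0].
Proof.
rewrite (_ : [set i | _] = set0); first exact: finite_set0.
by apply/seteqP; split=> i //=; rewrite eqxx.
Qed.
Definition dsum0 := DSum dsum0_subproof.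

Lemma dsumN_subproof (x : dsum) : finite_set [set i | - x i != 0].
Proof. by apply: sub_finite_set (dsum_fin x) => i /=; rewrite oppr_eq0. Qed.
Definition dsumN x := DSum (dsumN_subproof x).

Lemma dsumZ_subproof (a : k) (x : dsum) : finite_set [set i | a *: x i != 0].
Proof.
by apply: sub_finite_set (dsum_fin x) => i /=; apply: contraNneq => ->; rewrite scaler0.
Qed.
Definition dsumZ a x := DSum (dsumZ_subproof a x).

Lemma dsumD_subproof (x y : dsum) : finite_set [set i | x i + y i != 0].
Proof.
apply: sub_finite_set (_ : finite_set ([set i | x i != 0] `|` [set i | y i != 0])).
  move=> i /=; have [->|] := eqVneq (x i) 0; last by left.
  by rewrite add0r; right.
by rewrite finite_setU; split; exact: dsum_fin.
Qed.
Definition dsumD x y := DSum (dsumD_subproof x y).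

Lemma dsumA : associative dsumD.
Proof. by move=> x y z; apply: dsum_eq => i; rewrite /= addrA. Qed.
Lemma dsumC : commutative dsumD.
Proof. by move=> x y; apply: dsum_eq => i; rewrite /= addrC. Qed.
Lemma dsum0D : left_id dsum0 dsumD.
Proof. by move=> x; apply: dsum_eq => i; rewrite /= add0r. Qed.
Lemma dsumND : left_inverse dsum0 dsumN dsumD.
Proof. by move=> x; apply: dsum_eq => i; rewrite /= addNr. Qed.
HB.instance Definition _ := GRing.isZmodule.Build dsum dsumA dsumC dsum0D dsumND.

Lemma dsumZA a b x : dsumZ a (dsumZ b x) = dsumZ (a * b) x.
Proof. by apply: dsum_eq => i; rewrite /= scalerA. Qed.
Lemma dsum1Z : left_id 1 dsumZ.
Proof. by move=> x; apply: dsum_eq => i; rewrite /= scale1r. Qed.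
Lemma dsumZDr : right_distributive dsumZ +%R.
Proof. by move=> a x y; apply: dsum_eq => i; rewrite /= scalerDr. Qed.
Lemma dsumZDl x : {morph dsumZ^~ x : a b / a + b}.
Proof. by move=> a b; apply: dsum_eq => i; rewrite /= scalerDl. Qed.
HB.instance Definition _ :=
  GRing.Zmodule_isLmodule.Build k dsum dsumZA dsum1Z dsumZDr dsumZDl.

Definition inj_val (i : I) (m : M i) (j : I) : M j :=
  if i =P j is ReflectT e then ecast j (M j) e m else 0.

Lemma inj_subproof (i : I) (m : M i) : finite_set [set j | inj_val m j != 0].
Proof.
apply: sub_finite_set (finite_set1 i) => j /=; rewrite /inj_val.
by case: eqP => [e _|_]; [exact: esym | rewrite eqxx].
Qed.
Definition dsum_inj (i : I) (m : M i) : dsum := DSum (inj_subproof m).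

End DirectSum.

Section Schur.
Variables (k : fieldType) (n : option nat) (t : k).

(* An element beta of Lambda(n)_t: beta_1 is [comp1], an element of k, and
   beta_i for i >= 2 is the natural number [parts i]. *)
Record composition := Composition {
  comp1 : k;
  parts : nat -> nat;
  parts_fin : finite_set [set i | parts i != 0%N];
  parts_range : forall i, ~~ ((2 <= i)%N && in_range n i) -> parts i = 0%N;
  comp1_int : exists z : int, comp1 = t - z%:~R;
  comp_sum : comp1 + \sum_(i \in [set: nat]) ((parts i)%:R : k) = t
}.

HB.instance Definition _ := gen_eqMixin composition.
HB.instance Definition _ := gen_choiceMixin composition.

Definition cut (b : composition) (j : nat) : nat := \sum_(2 <= i < j) parts b i.

Definition block (b : composition) (j : nat) : set nat :=
  if j == 1%N
  then ~` \bigcup_(i in [set i | 2 <= i]%N) [set x | cut b i <= x < cut b i.+1]%N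
  else [set x | cut b j <= x < cut b j.+1]%N.

Definition young (b : composition) : set Sinf :=
  [set s | forall j, in_range n j -> s @` block b j = block b j].

Definition lcoset (s : Sinf) (A : set Sinf) : set Sinf := [set (s * u)%g | u in A].

Definition young_coset (b : composition) : Type :=
  {A : set Sinf | exists s, A = lcoset s (young b)}.

Lemma lcosetM s u A : lcoset (s * u)%g A = lcoset s (lcoset u A).
Proof.
apply/seteqP; split=> [_ [v Av <-]|_ [_ [v Av <-] <-]].
  by exists (u * v)%g; [exists v | rewrite mulgA].
by exists v => //; rewrite mulgA.
Qed.

Lemma lcoset1 A : lcoset 1%g A = A.
Proof.
by apply/seteqP; split=> [_ [v Av <-]|v Av]; [|exists v]; rewrite ?mul1g.
Qed.

Lemma youngM b s u : young b s -> young b u -> young b (s * u)%g.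
Proof.
move=> hs hu j hj; rewrite -[RHS]hs // -[in RHS]hu //.
by rewrite -image_comp.
Qed.

Lemma youngV b s : young b s -> young b (s^-1)%g.
Proof.
move=> hs j hj; rewrite -[in LHS]hs // image_comp; apply/seteqP.
split=> [_ [x Bx <-]|x Bx]; first by move: Bx; rewrite -{1}(SinfKV s x).
by exists x => //; exact: SinfKV.
Qed.

Lemma lcoset_young b s : young b s -> lcoset s (young b) = young b.
Proof.
move=> hs; apply/seteqP; split=> [_ [v hv <-]|v hv]; first exact: youngM.
by exists (s^-1 * v)%g; [exact: youngM (youngV hs) hv | rewrite mulgA mulgV mul1g].
Qed.

Lemma young_open b : exists2 F, finite_set F & pstab F `<=` young b.
Proof.
pose F := \bigcup_(i in [set i | 2 <= i]%N) [set x | cut b i <= x < cut b i.+1]%N.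
exists F.
  have [r Er] := (finite_seqP _).1 (parts_fin b).
  pose N := (\max_(i <- r) i).+1.
  have pN i : (N <= i)%N -> parts b i = 0%N.
    move=> Ni; apply/eqP; apply: contraTT Ni => hi; rewrite -ltnNge ltnS.
    have : [set` r] i by rewrite -Er.
    move=> /= ir; exact: (@leq_bigmax_seq _ _ predT (fun i => i)).
  have cN j : (cut b j <= cut b (maxn 2 N))%N.
    rewrite /cut; have [jN|Nj] := leqP j (maxn 2 N).
      have [j2|j2] := leqP j 2; first by rewrite big_geq.
      by rewrite (@big_cat_nat _ _ _ j 2 (maxn 2 N)) ?leq_addr // ltnW.
    rewrite (@big_cat_nat _ _ _ (maxn 2 N) 2 j) ?leq_maxl //=; last exact: ltnW.
    rewrite [X in (_ + X)%N]big_nat_cond [X in (_ + X)%N]big1 ?addn0 //.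
    move=> i /andP[/andP[Ni _] _]; apply: pN.
    exact: leq_trans (leq_maxr _ _) Ni.
  apply: sub_finite_set (finite_II (cut b (maxn 2 N))) => x [i _ /= /andP[_ h]].
  exact: leq_trans h (cN _).
move=> s hs.
have sF x : F x -> s x = x by exact: hs.
have sVF x : F x -> (s^-1)%g x = x by move=> Fx; rewrite -{1}(sF _ Fx) SinfKV.
move=> j /andP[j0 _]; rewrite /block; case: eqP => [_|j1].
  apply/seteqP; split=> [_ [x nF <-] Fs|x nF].
    by apply: nF; rewrite -(SinfKV s x) (sVF _ Fs).
  exists ((s^-1)%g x); last exact: SinfVK.
  by move=> Fs; apply: nF; rewrite -(SinfVK s x) (sF _ Fs).
have jF x : (cut b j <= x < cut b j.+1)%N -> F x.
  by exists j => //=; rewrite ltn_neqAle j0 andbT eq_sym; apply/eqP.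
apply/seteqP; split=> [_ [x /= hx <-]|x /= hx]; first by rewrite sF //; exact: jF.
by exists x => //; rewrite sF //; exact: jF.
Qed.

Lemma coset_act_subproof b (s : Sinf) (A : young_coset b) :
  exists u, lcoset s (sval A) = lcoset u (young b).
Proof. by have [u ->] := svalP A; exists (s * u)%g; rewrite lcosetM. Qed.

Definition coset_act b (s : Sinf) (A : young_coset b) : young_coset b :=
  exist _ (lcoset s (sval A)) (coset_act_subproof s A).

Lemma coset_eq b (A B : young_coset b) : sval A = sval B -> A = B.
Proof. by apply: eq_sig_hprop => C p q; exact: Prop_irrelevance. Qed.

Lemma coset_act1 b (A : young_coset b) : coset_act 1%g A = A.
Proof. by apply: coset_eq; exact: lcoset1. Qed.

Lemma coset_actM b s u (A : young_coset b) :
  coset_act (s * u)%g A = coset_act s (coset_act u A).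
Proof. by apply: coset_eq; exact: lcosetM. Qed.

Lemma coset_smooth b (A : young_coset b) : open [set s | coset_act s A = A].
Proof.
rewrite Sinf_openE => u /= uA.
have [F fF hF] := young_open b.
case: (svalP A) => s As.
exists (s @` F); first exact: finite_image.
move=> _ [v hv <-] /=; rewrite coset_actM.
suff -> : coset_act v A = A by [].
apply: coset_eq => /=; rewrite As -lcosetM.
have -> : (v * s = s * (s^-1 * v * s))%g by rewrite !mulgA mulgV mul1g.
rewrite lcosetM lcoset_young //; apply: hF => x Fx.
by rewrite !SinfM hv ?SinfKV //; exists x.
Qed.

Lemma coset_finitary b : finite_set
  (range (fun A : young_coset b => [set coset_act s A | s in setT])).
Proof.
apply: sub_finite_set (finite_set1 setT) => _ [A _ <-] /=.
apply/seteqP; split=> // B _.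
case: (svalP A) => u Au; case: (svalP B) => v Bv.
exists (v * u^-1)%g => //; apply: coset_eq.
by rewrite /= Au Bv -lcosetM -mulgA mulVg mulg1.
Qed.

Definition Xset (b : composition) : perm_set :=
  PermSet (@coset_act1 b) (@coset_actM b) (@coset_smooth b) (@coset_finitary b).

(* The component of index (b, d) is Hom(X^b, X^d). *)
Definition Schur_sort : lmodType k :=
  dsum (fun bd : composition * composition => Hom k (Xset bd.1) (Xset bd.2)).

Definition Schur_mul_val (g f : Schur_sort) (bd : composition * composition) :
    Hom k (Xset bd.1) (Xset bd.2) :=
  \sum_(c \in [set: composition])
    (perm_comp t (g (c, bd.2)) (f (bd.1, c)) : Hom k (Xset bd.1) (Xset bd.2)).

Lemma Schur_mul_subproof (g f : Schur_sort) :
  finite_set [set bd | Schur_mul_val g f bd != 0].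
Proof.
pose J (h : Schur_sort) := [set bd | h bd != 0].
apply: sub_finite_set (_ : finite_set ((fst @` J f) `*` (snd @` J g))).
  move=> [b d] /= h; split=> /=; apply: contrapT => nh; move/eqP: h; apply;
  rewrite /Schur_mul_val fsbig1 // => c _ /=.
    have [->|fc] := eqVneq (f (b, c)) 0; first exact: perm_comp0.
    by case: nh; exists (b, c).
  have [->|gc] := eqVneq (g (c, d)) 0; first exact: perm_0comp.
  by case: nh; exists (c, d).
by apply: finite_setX; apply: finite_image; exact: dsum_fin.
Qed.

Definition Schur_mul (g f : Schur_sort) : Schur_sort := DSum (Schur_mul_subproof g f).

Definition Schur_one (b : composition) : Schur_sort :=
  @dsum_inj k _ (fun bd => Hom k (Xset bd.1) (Xset bd.2)) (b, b)
    (perm_id k (Xset b)).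

Definition Schur : lu_algebra k :=
  @LUAlgebra k Schur_sort Schur_mul composition Schur_one.

End Schur.

(* Main.v *)
(* A point of X^beta is a coloring of Omega by [1, n] with color 1 off a finite set
   and color j >= 2 used beta_j times.  On colorings that are 1 beyond p, sums of
   functions invariant under a fixed S(q) are polynomials in p, and the integral is
   the value of that polynomial at t; identities between kernels are therefore
   checked on finite sets of colorings for all large p.  There e_i and f_i act as
   the operators E_(i,i+1) and E_(i+1,i), where E_(i,j) recolors one point from j
   to i, and all the relations follow from the commutators
   [E_ij, E_kl] = delta_jk E_il - delta_il E_kj.  For surjectivity, let (z, x)
   represent an orbit in X^delta x X^beta with z(a) = i <> j = x(a).  Recoloring a
   in z gives y, and the product of E_(i,j) with the indicator of the orbit of
   (y, x) is a nonzero multiple of the indicator of the orbit of (z, x), up to pairs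
   of colorings that differ at fewer points.  By induction on the number of points
   where the colorings differ, the E_(i,j) and the idempotents generate. *)
From HB Require Import structures.
From mathcomp Require Import finmap perm ring zify.
Require Import Defs.
Set Implicit Arguments.
Unset Strict Implicit.
Unset Printing Implicit Defensive.
Import Order.TTheory GRing.Theory Num.Theory.
Local Open Scope classical_set_scope.
Local Open Scope card_scope.
Local Open Scope ring_scope.

(** * Finitary permutations of Omega *)

(** [integral] sums over the values of a function, each weighted by the counting polynomial of its
    level set, so neither linearity nor Fubini is visible from the definition. Both come from one
    formula: a sum of an S(q)-invariant function over the colorings that are 1 beyond p equals a sum
    over a fixed finite list, with binomial polynomials in p as weights. Putting t for p in the
    weights gives the integral. Color 1 fills p - s points of [0, p), where s is the number of
    points of other colors. The value at t is t - s, the first coordinate of the weight, so [U7]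
    reads the same for color 1 as for the other colors. A weight that comes from no composition has
    no colorings. Operators through it are set to 0, which is consistent because recoloring a point
    of an existing coloring always gives a coloring of some composition. In the surjectivity
    argument the leading coefficient is a finite count and not a value of a polynomial at t, so no t
    is exceptional. *)

Lemma perm_eq_count_off (T : eqType) (v : T) (r s : seq T) :
  size r = size s -> (forall x, x != v -> count_mem x r = count_mem x s) ->
  perm_eq r s.
Proof.
move=> szE cE.
have pF : perm_eq (seq.filter (predC1 v) r) (seq.filter (predC1 v) s).
  apply/allP => x _ /=; rewrite !count_filter; apply/eqP.
  have [->|xv] := eqVneq x v.
    by rewrite !(@eq_count _ _ pred0) ?count_pred0 // => z /=; case: eqP.
  rewrite !(@eq_count _ _ (pred1 x)) ?cE // => z /=;
  by case: eqP => [->|] //=; rewrite xv.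
have szF := perm_size pF; rewrite !size_filter in szF.
apply/allP => x _ /=; have [->|/cE -> //] := eqVneq x v.
have := count_predC (pred1 v) r; have := count_predC (pred1 v) s.
rewrite -szE -[X in (_ + X)%N](_ : count (predC1 v) r = _); last first.
  by rewrite szF; apply: eq_count.
rewrite -[X in _ -> (_ + X)%N = _ -> _](_ : count (predC1 v) r = _) //.
by move=> <- /addIn ->.
Qed.

(** Two words of length p with the same letters differ by a permutation of [0, p), which the
    identity extends to Omega. [col_surj], [Sinf_move] and [move_small] obtain their permutations
    this way, each from suitable words. *)
Lemma Sinf_of_perm_eq (T : eqType) (f g : nat -> T) (p : nat) :
  perm_eq (map f (iota 0 p)) (map g (iota 0 p)) ->
  exists2 u : Sinf, (forall x, (p <= x)%N -> u x = x) &
    forall x, (x < p)%N -> f x = g (u x).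
Proof.
have mapE h : map h (iota 0 p) = [tuple h i | i < p] :> seq T.
  by rewrite -val_enum_ord -map_comp; apply: eq_map.
rewrite !mapE => /tuple_permP[s /val_inj sE].
pose ex (r : {perm 'I_p}) x := if insub x is Some i then val (r i) else x.
have exE r (i : 'I_p) : ex r i = r i by rewrite /ex valK.
have exN r x : (p <= x)%N -> ex r x = x by move=> px; rewrite /ex insubN // -leqNgt.
have exK (r r' : {perm 'I_p}) : cancel r r' -> cancel (ex r) (ex r').
  move=> rK x; case: (ltnP x p) => xp; last by rewrite !exN.
  by rewrite -[x]/(nat_of_ord (Ordinal xp)) !exE rK.
exists (SInf (exK _ _ (permK s)) (exK _ _ (permKV s))); first exact: exN.
move=> x xp; have /= -> := exE s (Ordinal xp).
by have := congr1 (fun r => tnth r (Ordinal xp)) sE; rewrite !tnth_mktuple.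
Qed.

(** * Interpolation of sequences by polynomials *)

Section CharZero.
Variables (k : fieldType) (char0 : [pchar k] =i pred0).

Lemma natr_neq0 (m : nat) : (0 < m)%N -> (m%:R : k) != 0.
Proof. by move=> m0; rewrite (proj1 (pcharf0P k) char0) -lt0n. Qed.

Lemma natr_injk : injective (fun m : nat => m%:R : k).
Proof.
move=> a b; wlog ab : a b / (a <= b)%N => [h|].
  by case: (leqP a b) => [/h//|/ltnW /h h' /esym/h'].
move=> /= e; apply/eqP; rewrite eqn_leq ab /= leqNgt; apply/negP => lab.
have := natr_neq0 (m := b - a); rewrite subn_gt0 => /(_ lab).
by rewrite natrB // e subrr eqxx.
Qed.

Lemma intr_neq0 (m : int) : m != 0 -> (m%:~R : k) != 0.
Proof.
case: m => m m0; first by apply: natr_neq0; rewrite lt0n.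
by rewrite NegzE mulrNz oppr_eq0 natr_neq0.
Qed.

(** [ratr] is defined through the reduced fraction. Nonzero integers stay invertible in k, so any
    other fraction gives the same value, and sums and products can be computed on unreduced ones. *)
Lemma ratr_frac (a b : int) : b != 0 ->
  ratr (a%:~R / b%:~R) = a%:~R / b%:~R :> k.
Proof.
move=> b0; rewrite /ratr; set x : rat := a%:~R / _.
have bQ : (b%:~R : rat) != 0 by rewrite intr_eq0.
have dQ : ((denq x)%:~R : rat) != 0 by rewrite intr_eq0 denq_eq0.
apply/eqP; rewrite eqr_div ?intr_neq0 ?denq_eq0 // -!rmorphM /=.
suff -> : numq x * b = a * denq x by [].
apply/eqP; rewrite -(eqr_int rat) !rmorphM /= -eqr_div // divq_num_den.
exact/eqP.
Qed.

Lemma ratr_zmod_char0 : zmod_morphism (ratr : rat -> k).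
Proof.
move=> x y; rewrite -[x]divq_num_den -[y]divq_num_den.
have [dx dy] : denq x != 0 /\ denq y != 0 by rewrite !denq_eq0.
have [dxQ dyQ] : ((denq x)%:~R != 0 :> rat) /\ ((denq y)%:~R != 0 :> rat).
  by rewrite !intr_eq0.
rewrite -mulNr addf_div // mulNr -!rmorphM -rmorphB /= !ratr_frac ?mulf_neq0 //.
by rewrite -[in RHS]mulNr addf_div ?intr_neq0 // [in RHS]mulNr -!rmorphM -rmorphB.
Qed.

Lemma ratr_monoid_char0 : monoid_morphism (ratr : rat -> k).
Proof.
split=> [|x y]; first by rewrite /ratr divr1.
rewrite -[x]divq_num_den -[y]divq_num_den mulf_div -!rmorphM /=.
rewrite !ratr_frac ?mulf_neq0 ?denq_eq0 //.
by rewrite mulf_div -!rmorphM.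
Qed.

(** An alias of [ratr] carrying the hypothesis on the characteristic, to which the structure of ring
    morphism can then be attached. *)
Definition ratr_char0 & [pchar k] =i pred0 : rat -> k := ratr.
Local Notation rk := (ratr_char0 char0).
HB.instance Definition _ := GRing.isZmodMorphism.Build rat k rk ratr_zmod_char0.
HB.instance Definition _ := GRing.isMonoidMorphism.Build rat k rk ratr_monoid_char0.

End CharZero.

(** The binomial coefficient of X - q over i. At an integer p >= q it counts the i-element subsets
    of [q, p). *)
Definition binp (F : fieldType) (q i : nat) : {poly F} :=
  (i`!%:R)^-1 *: \prod_(j < i) ('X - (q + j)%:R%:P).

Lemma binpE (F : fieldType) (q i p : nat) : [pchar F] =i pred0 -> (q <= p)%N ->
  (binp F q i).[p%:R] = 'C(p - q, i)%:R.
Proof.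
move=> ch qp; rewrite /binp hornerZ horner_prod.
have -> : \prod_(j < i) ('X - (q + j)%:R%:P).[p%:R : F] = ((p - q) ^_ i)%:R.
  elim: i => [|i IH]; first by rewrite big_ord0.
  rewrite big_ord_recr IH /= ffactnSr natrM hornerXsubC.
  have [h|h] := leqP (q + i) p; first by rewrite -subnDA natrB.
  (* Here the truncated difference p - q - i is not the value of the last factor, but the falling
     factorial before it already vanishes. *)
  by rewrite ffact_small ?mul0r // ltn_subLR.
by rewrite -bin_ffact natrM mulrC mulfK // natr_neq0 // fact_gt0.
Qed.

Lemma map_binp (F G : fieldType) (f : {rmorphism F -> G}) q i :
  map_poly f (binp F q i) = binp G q i.
Proof.
rewrite map_polyZ fmorphV rmorph_nat rmorph_prod; congr (_ *: _).
by apply: eq_bigr => j _; rewrite rmorphB /= map_polyX map_polyC /= rmorph_nat.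
Qed.

Lemma poly_eq_large (F : fieldType) (P Q : {poly F}) (N : nat) :
  [pchar F] =i pred0 ->
  (forall p, (N <= p)%N -> P.[p%:R] = Q.[p%:R]) -> P = Q.
Proof.
move=> ch PQ; apply/eqP; rewrite -subr_eq0; apply/negPn/negP => nz.
pose rs := [seq (i%:R : F) | i <- iota N (size (P - Q))].
have := @max_poly_roots _ (P - Q) rs nz; rewrite size_map size_iota ltnn.
have ur : uniq rs by rewrite map_inj_uniq ?iota_uniq //; exact: natr_injk.
have ar : all (root (P - Q)) rs.
  apply/allP => _ /mapP[i + ->]; rewrite mem_iota => /andP[Ni _].
  by rewrite rootE hornerD hornerN PQ // subrr.
by move=> /(_ ar ur).
Qed.

(* [v] is the value at [t] of the polynomial interpolating [S] on large integers. *)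
Definition interp (k : fieldType) (t : k) (S : nat -> k) (v : k) : Prop :=
  exists Q : {poly k}, Q.[t] = v /\
    exists q : nat, forall p, (q <= p)%N -> Q.[p%:R] = S p.

Section Interp.
Variables (k : fieldType) (char0 : [pchar k] =i pred0) (t : k).

Lemma interp_uniq S S' v v' (N : nat) : interp t S v -> interp t S' v' ->
  (forall p, (N <= p)%N -> S p = S' p) -> v = v'.
Proof.
move=> [Q [<- [q hQ]]] [Q' [<- [q' hQ']]] SS'; congr (_.[_]).
apply: (@poly_eq_large _ _ _ (maxn N (maxn q q'))) => // p.
by rewrite !geq_max => /and3P[Np qp qp']; rewrite hQ // hQ' // SS'.
Qed.

Lemma interp_ext S S' v (N : nat) : interp t S v ->
  (forall p, (N <= p)%N -> S p = S' p) -> interp t S' v.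
Proof.
move=> [Q [<- [q hQ]]] SS'; exists Q; split=> //; exists (maxn N q) => p.
by rewrite geq_max => /andP[Np qp]; rewrite hQ // SS'.
Qed.

Lemma interp_lin a S S' v v' : interp t S v -> interp t S' v' ->
  interp t (fun p => a * S p + S' p) (a * v + v').
Proof.
move=> [Q [<- [q hQ]]] [Q' [<- [q' hQ']]].
exists (a *: Q + Q'); split; first by rewrite hornerD hornerZ.
exists (maxn q q') => p; rewrite geq_max => /andP[qp qp'].
by rewrite hornerD hornerZ hQ // hQ'.
Qed.

Lemma interpZ a S v : interp t S v -> interp t (fun p => a * S p) (a * v).
Proof.
move=> [Q [<- [q hQ]]]; exists (a *: Q); split; first by rewrite hornerZ.
by exists q => p qp; rewrite hornerZ hQ.
Qed.

Lemma interp_cst c : interp t (fun=> c) c.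
Proof. by exists c%:P; split; [|exists 0%N => p _]; rewrite hornerC. Qed.

Lemma interp_id : interp t (fun p => p%:R) t.
Proof. by exists 'X; split; [|exists 0%N => p _]; rewrite hornerX. Qed.

End Interp.

(** * Points of Xset as colorings of Omega *)

(** A finitely supported sum rather than a count over a segment: it involves no bound, and every
    bijection of Omega reindexes it. It is meaningful for predicates that hold at finitely many
    points. *)
Definition npts (P : pred nat) : nat := \big[addn/0%N]_(a \in [set: nat]) P a.

Lemma npts_count (P : pred nat) (N : nat) :
  (forall a, (N <= a)%N -> P a = false) -> npts P = count P (iota 0 N).
Proof.
move=> PN; rewrite /npts (fsbigE (iota 0 N)) ?iota_uniq //.
  rewrite -sum1_count [RHS]big_mkcond /=; apply: eq_big => a; first by rewrite in_setT.
  by case: (P a).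
by move=> a _; rewrite mem_iota /= add0n -leqNgt => /PN ->.
Qed.

Lemma npts_perm (P : pred nat) (s : Sinf) : npts (fun a => P (s a)) = npts P.
Proof.
rewrite /npts [RHS](@reindex_fsbigT _ _ _ _ _ s) //.
by exists (s^-1)%g; [exact: SinfKV | exact: SinfVK].
Qed.

Definition colors_off (c : nat -> nat) (p : nat) := forall x, (p <= x)%N -> c x = 1%N.

Lemma colors_offW c p q : (p <= q)%N -> colors_off c p -> colors_off c q.
Proof. by move=> pq h x qx; apply: h; exact: leq_trans qx. Qed.

Definition upd (c : nat -> nat) (a j : nat) : nat -> nat :=
  fun x => if x == a then j else c x.

Lemma colors_off_upd c a j p : (a < p)%N -> colors_off c p -> colors_off (upd c a j) p.
Proof. by move=> ap h x px; rewrite /upd gtn_eqF ?h //; exact: leq_trans px. Qed.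

Lemma upd_perm c a j (s : Sinf) :
  upd c a j \o s = upd (c \o s) (s^-1 a)%g j.
Proof.
apply/funext => x; rewrite /upd /=.
by rewrite (can2_eq (SinfKV s) (SinfVK s)).
Qed.

Lemma npts_off (P P' : pred nat) (N a : nat) :
  (forall x, (N <= x)%N -> P x = false) -> (forall x, (N <= x)%N -> P' x = false) ->
  (forall x, x != a -> P x = P' x) ->
  (npts P + P' a = npts P' + P a)%N.
Proof.
move=> PN PN' PP'; pose M := maxn N a.+1.
have aM : (a < M)%N by rewrite leq_max ltnSn orbT.
have NM x : (M <= x)%N -> (N <= x)%N by exact: leq_trans (leq_maxl _ _).
rewrite (@npts_count P M) => [|x /NM /PN //].
rewrite (@npts_count P' M) => [|x /NM /PN' //].
have -> : iota 0 M = iota 0 a ++ a :: iota a.+1 (M - a.+1).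
  by rewrite -[a :: _]/(iota a (M - a.+1).+1) -iotaD; congr iota; lia.
rewrite !count_cat /=.
have -> : count P (iota 0 a) = count P' (iota 0 a).
  by apply: eq_in_count => x; rewrite mem_iota => /andP[_ h]; rewrite PP' // ltn_eqF.
have -> : count P (iota a.+1 (M - a.+1)) = count P' (iota a.+1 (M - a.+1)).
  by apply: eq_in_count => x; rewrite mem_iota => /andP[h _]; rewrite PP' // gtn_eqF.
lia.
Qed.

(** [Q] has to exclude color 1, which is used infinitely often. The additive form avoids truncated
    subtraction. *)
Lemma npts_upd (Q : pred nat) c p a j : colors_off c p -> ~~ Q 1%N ->
  (npts (fun x => Q (upd c a j x)) + Q (c a) = npts (fun x => Q (c x)) + Q j)%N.
Proof.
move=> cp /negPf Q1.
have := @npts_off (fun x => Q (upd c a j x)) (fun x => Q (c x)) (maxn p a.+1) a.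
rewrite {4}/upd eqxx; apply=> x; first 2 last.
- by rewrite /upd => /negPf ->.
- by rewrite geq_max => /andP[px ax]; rewrite /upd gtn_eqF ?cp.
- by rewrite geq_max => /andP[px _]; rewrite cp.
Qed.

Section Coloring.
Variables (k : fieldType) (n : option nat) (n_gt0 : n != Some 0%N) (t : k).
Implicit Type b : composition n t.

Lemma in_range1 : in_range n 1.
Proof. by case: n n_gt0 => [[|m]|]. Qed.

Lemma parts_bound b : exists K, forall i, (K <= i)%N -> parts b i = 0%N.
Proof.
have [r Er] := (finite_seqP _).1 (parts_fin b).
exists (\max_(i <- r) i).+1 => i Ki; apply/eqP; apply: contraTT Ki => hi.
have : [set` r] i by rewrite -Er.
by move=> /= ir; rewrite -ltnNge ltnS (@leq_bigmax_seq _ _ predT (fun i => i)).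
Qed.

Lemma cutS b j : (2 <= j)%N -> cut b j.+1 = (cut b j + parts b j)%N.
Proof. by move=> j2; rewrite /cut big_nat_recr. Qed.

Lemma leq_cut b i j : (i <= j)%N -> (cut b i <= cut b j)%N.
Proof.
move=> ij; rewrite /cut; have [j2|j2] := leqP i 2; first by rewrite big_geq.
by rewrite (@big_cat_nat _ _ _ i 2 j) ?leq_addr // ltnW.
Qed.

Definition in_cut b j x : bool := (2 <= j)%N && (cut b j <= x < cut b j.+1)%N.

Lemma in_cut_uniq b i j x : in_cut b i x -> in_cut b j x -> i = j.
Proof.
wlog ij : i j / (i <= j)%N => [h|].
  by case: (leqP i j) => [/h//|/ltnW /h h' a c]; rewrite (h' c a).
move: ij; rewrite leq_eqVlt => /predU1P[->//|ij].
move=> /andP[_ /andP[_ h]] /andP[_ /andP[h' _]].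
by have := leq_trans (leq_trans h (leq_cut b ij)) h'; rewrite ltnn.
Qed.

(** The coloring whose color classes are the blocks of b; the default 1 of [xget] is the color of
    the cofinite block. *)
Definition col0 b (x : nat) : nat := xget 1%N [set j | in_cut b j x].

Lemma col0_in_cut b j x : in_cut b j x -> col0 b x = j.
Proof.
move=> h; apply: (in_cut_uniq _ h); rewrite /col0.
by have := @xgetPex _ 1%N [set i | in_cut b i x]; apply; exists j.
Qed.

Lemma col0P b x : col0 b x = 1%N \/ in_cut b (col0 b x) x.
Proof.
have [[j hj]|h] := pselect (exists j, in_cut b j x).
  by right; rewrite (col0_in_cut hj).
by left; apply: xgetPN => j hj; apply: h; exists j.
Qed.

Lemma col0E b j x : (2 <= j)%N -> (col0 b x == j) = in_cut b j x.
Proof.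
move=> j2; apply/eqP/idP => [e|]; last exact: col0_in_cut.
by case: (col0P b x); rewrite e // => e1; rewrite e1 in j2.
Qed.

Lemma col0_range b x : in_range n (col0 b x).
Proof.
case: (col0P b x) => [->|]; first exact: in_range1.
(* A color out of range has no parts, so its interval of points is empty. *)
set j := col0 b x => /andP[j2 /andP[h1 h2]]; apply/negPn/negP => nr.
by move: (leq_ltn_trans h1 h2); rewrite cutS // parts_range ?addn0 ?ltnn // (negPf nr) andbF.
Qed.

Lemma blockE b j : (0 < j)%N -> block b j = [set x | col0 b x = j].
Proof.
move=> j0; rewrite /block; case: eqP => [->|/eqP j1]; apply/seteqP; split=> x /=.
- move=> h; case: (col0P b x) => // /andP[j2 hx].
  by case: h; exists (col0 b x).
- by move=> e [i /= i2 hi]; move: (@col0_in_cut b i x); rewrite /in_cut i2 e => /(_ hi) e1; rewrite -e1 in i2.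
- by move=> h; apply: col0_in_cut; rewrite /in_cut h andbT; lia.
- by move/eqP; rewrite col0E => [/andP[]|]; last lia.
Qed.

Lemma youngE b (s : Sinf) : young b s <-> forall x, col0 b (s x) = col0 b x.
Proof.
have pos x : (0 < col0 b x)%N by case/andP: (col0_range b x).
split=> [h x|h j /andP[j0 _]].
  have := h _ (col0_range b x); rewrite !blockE // => e.
  have : (s @` [set y | col0 b y = col0 b x]) (s x) by exists x.
  by rewrite e.
rewrite !blockE //; apply/seteqP; split=> [_ [x /= hx <-]|x /= hx]; first by rewrite h.
by exists ((s^-1)%g x); rewrite /= ?SinfVK // -h SinfVK.
Qed.

Lemma col0_off b : exists p, colors_off (col0 b) p.
Proof.
have [K hK] := parts_bound b; exists (cut b (maxn K 2)) => x hx.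
case: (col0P b x) => //; set j := col0 b x => /andP[j2 /andP[_ h]].
have : (cut b j.+1 <= cut b (maxn K 2))%N.
  have [jK|Kj] := ltnP j (maxn K 2); first exact: leq_cut.
  elim: j Kj {j2 h} => [|j IH]; first by lia.
  rewrite leq_eqVlt => /predU1P[<-|Kj].
    by rewrite cutS ?leq_maxr // hK ?addn0 // leq_maxl.
  by rewrite cutS; [rewrite hK ?addn0 ?IH //|]; lia.
by move=> h'; have := leq_trans h (leq_trans h' hx); rewrite ltnn.
Qed.

Lemma npts_col0 b j : (2 <= j)%N -> npts (fun x => col0 b x == j) = parts b j.
Proof.
move=> j2; rewrite (@npts_count _ (cut b j.+1)); last first.
  by move=> x hx; rewrite col0E // /in_cut j2 /= [(x < _)%N]ltnNge hx andbF.
rewrite cutS // iotaD count_cat add0n.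
rewrite (@eq_in_count _ _ pred0) ?count_pred0; last first.
  by move=> x; rewrite mem_iota => /= hx; rewrite col0E // /in_cut [(cut b j <= x)%N]leqNgt hx andbF.
rewrite (@eq_in_count _ _ predT) ?count_predT ?size_iota //.
by move=> x; rewrite mem_iota col0E // /in_cut j2 cutS.
Qed.

(** The standard coloring transported by a representative of the coset. The representative is chosen
    by [cid]; [col_lcoset] shows that any other gives the same coloring. *)
Definition col b (y : Xset b) (x : nat) : nat :=
  col0 b ((sval (cid (svalP y)))^-1 x)%g.

Lemma col_lcoset b (y : Xset b) (s : Sinf) : sval y = lcoset s (young b) ->
  col y = col0 b \o (s^-1)%g.
Proof.
move=> ys; apply/funext => x; rewrite /col; case: cid => u /= yu.
have : (lcoset s (young b)) u.
  by rewrite -ys yu; exists 1%g; rewrite ?mulg1 //; apply/youngE.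
by move=> [v /youngE hv <-]; rewrite -hv /= sinvK.
Qed.

Lemma col_act b (s : Sinf) (y : Xset b) : col (act s y) = col y \o (s^-1)%g.
Proof.
case: (svalP y) => u yu.
by rewrite (@col_lcoset _ (act s y) (s * u)%g) /= ?yu ?lcosetM // (@col_lcoset _ y u).
Qed.

(** By [youngE], the Young subgroup is the full stabilizer of the standard coloring. *)
Lemma col_inj b : injective (@col b).
Proof.
move=> y y'; case: (svalP y) => s ys; case: (svalP y') => s' ys'.
rewrite (col_lcoset ys) (col_lcoset ys') => e; apply: coset_eq.
rewrite ys ys'.
have -> : s' = (s * (s^-1 * s'))%g by rewrite mulgA mulgV mul1g.
rewrite lcosetM; congr lcoset; rewrite lcoset_young //; apply/youngE => x.
by have /= := congr1 (fun f => f (s' x)) e; rewrite sfunK.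
Qed.

Lemma col_range b (y : Xset b) x : in_range n (col y x).
Proof. exact: col0_range. Qed.

Lemma npts_col b (y : Xset b) (Q : pred nat) :
  npts (fun x => Q (col y x)) = npts (fun x => Q (col0 b x)).
Proof.
by case: (svalP y) => s /col_lcoset ->; rewrite (npts_perm (fun x => Q (col0 b x))).
Qed.

Lemma npts_col_parts b (y : Xset b) j : (2 <= j)%N ->
  npts (fun x => col y x == j) = parts b j.
Proof. by move=> j2; rewrite (npts_col y (fun i => i == j)) npts_col0. Qed.

Lemma Sinf_bound (s : Sinf) q : exists r, forall x, (x < q)%N -> (s x < r)%N.
Proof.
elim: q => [|q [r hr]]; first by exists 0%N.
exists (maxn r (s q).+1) => x; rewrite ltnS leq_eqVlt leq_max.
by case/orP => [/eqP ->|/hr ->]; rewrite ?leqnn ?orbT.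
Qed.

Lemma col_off b (y : Xset b) : exists p, colors_off (col y) p.
Proof.
case: (svalP y) => s /col_lcoset ->; have [q hq] := col0_off b.
have [r hr] := Sinf_bound s q; exists r => x rx /=; apply: hq.
by rewrite leqNgt; apply/negP => /hr; rewrite SinfVK ltnNge rx.
Qed.

(** Beyond some N both c and the standard coloring are 1. Before N they are words of the same length
    in which all letters but 1 have equal multiplicities, hence so has 1, and a permutation carries
    one to the other. Color 0 is excluded separately because multiplicities are compared only from 2
    on. *)
Lemma col_surj b (c : nat -> nat) p : colors_off c p ->
  (forall j, (2 <= j)%N -> npts (fun x => c x == j) = parts b j) ->
  (forall x, c x != 0%N) ->
  exists y : Xset b, col y = c.
Proof.
move=> cp cE c0; have [q hq] := col0_off b; pose N := maxn p q.
have cN := colors_offW (leq_maxl p q) cp; have bN := colors_offW (leq_maxr p q) hq.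
have pe : perm_eq (map c (iota 0 N)) (map (col0 b) (iota 0 N)).
  apply: (@perm_eq_count_off _ 1%N); first by rewrite !size_map.
  move=> j j1; rewrite !count_map.
  have [j2|] := leqP 2 j.
    have cC f : colors_off f N -> count (preim f (pred1 j)) (iota 0 N) = npts (fun x => f x == j).
      by move=> fN; rewrite (@npts_count _ N) // => a /fN ->; rewrite eq_sym (negPf j1).
    by rewrite !cC // cE // npts_col0.
  case: j j1 => [|[|]] // _ _; rewrite !(@eq_count _ _ pred0) ?count_pred0 //.
    by move=> x /=; case/andP: (col0_range b x); case: (col0 b x).
  by move=> x /=; exact: negPf.
have [u uN ux] := Sinf_of_perm_eq pe.
have uc x : col0 b (u x) = c x.
  by have [Nx|xN] := leqP N x; [rewrite uN // bN // cN | rewrite -ux].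
pose y : Xset b := exist _ (lcoset (u^-1)%g (young b)) (ex_intro _ (u^-1)%g erefl).
by exists y; rewrite (@col_lcoset _ y (u^-1)%g) // invgK; apply/funext => x /=.
Qed.

End Coloring.

(** * A quadrature formula for sums over colorings *)

HB.instance Definition _ (Y : perm_set) := gen_eqMixin (pset Y).
HB.instance Definition _ (Y : perm_set) := gen_choiceMixin (pset Y).
(* Simplification would turn [pset (Xset b)] into [young_coset b], which has no
   eqType structure. *)
Arguments Xset : simpl never.
Arguments pset : simpl never.

Section Quadrature.
Variables (k : fieldType) (n : option nat) (n_gt0 : n != Some 0%N) (t : k).
Implicit Type b : composition n t.

Lemma fixed_col b (y : Xset b) p :
  (forall s, pstab `I_p s -> act s y = y) <-> colors_off (col y) p.
Proof.
split=> [h x px|h s hs].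
  (* The transposition of x with a point z that is at least p and far enough to have color 1 fixes
     y, so x has color 1 too. *)
  have [N hN] := col_off n_gt0 y; pose z := maxn N p.
  pose T := SInf (@transpK x z) (@transpK x z).
  have yT : act T y = y.
    by apply: h => i /= ip; rewrite /transp !ltn_eqF // (leq_trans ip) // leq_maxr.
  rewrite -yT col_act //= /transp eqxx.
  by rewrite hN ?leq_maxl.
apply: (col_inj n_gt0); rewrite col_act //; apply/funext => x /=.
have [xp|px] := ltnP x p; first by rewrite -{1}(hs x xp) sfunK.
rewrite !h // leqNgt; apply/negP => h'; have := hs _ h'.
by rewrite sinvK => e; move: h'; rewrite -e ltnNge px.
Qed.

Lemma col_bound b : exists K, forall (y : Xset b) x, (col y x < K)%N.
Proof.
have [q hq] := col0_off n_gt0 b.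
exists (maxn 2 (\max_(x < q) col0 b x).+1) => y x.
rewrite /col; set z := (_ x); have [qz|zq] := leqP q z; first by rewrite hq // leq_maxl.
rewrite (leq_trans _ (leq_maxr _ _)) // ltnS.
exact: (@leq_bigmax_cond _ predT (fun i : 'I_q => col0 b i) (Ordinal zq)).
Qed.

Lemma finite_colors_off b p : finite_set [set y : Xset b | colors_off (col y) p].
Proof.
have [[|K] hK] := col_bound b.
  apply: sub_finite_set (finite_set0 _) => y _; exact: (notF (hK y 0%N)).
pose f (y : Xset b) : {ffun 'I_p -> 'I_K.+1} := [ffun i : 'I_p => inord (col y i)].
rewrite -(eq_finite_set (inj_card_eq (f := f) _)); first exact: finite_finset.
move=> y y'; rewrite !inE /= => hy hy' /ffunP e; apply: (col_inj n_gt0).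
apply/funext => x; have [xp|px] := ltnP x p; last by rewrite hy // hy'.
have := e (Ordinal xp); rewrite !ffunE => /(congr1 val) /=.
by rewrite !inordK.
Qed.

(** By [fixed_col] these are the S(p)-fixed points of X^b, listed so that they can be summed
    over. *)
Definition fixed_seq b p : seq (Xset b) := fset_set [set y : Xset b | colors_off (col y) p].

Lemma fixed_seq_uniq b p : uniq (fixed_seq b p).
Proof. exact: fset_uniq. Qed.

Lemma mem_fixed_seq b p (y : Xset b) : y \in fixed_seq b p <-> colors_off (col y) p.
Proof.
rewrite /fixed_seq in_fset_set; last exact: finite_colors_off.
by rewrite inE.
Qed.

Lemma mem_fixed_seqW b p q (y : Xset b) : (p <= q)%N -> y \in fixed_seq b p -> y \in fixed_seq b q.
Proof. by move=> pq /mem_fixed_seq h; apply/mem_fixed_seq; exact: colors_offW h. Qed.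

Lemma exists_mem_fixed_seq b (y : Xset b) : exists p, y \in fixed_seq b p.
Proof. by have [p hp] := col_off n_gt0 y; exists p; apply/mem_fixed_seq. Qed.

Lemma act_mem_fixed_seq b p (u : Sinf) (y : Xset b) : (forall x, (p <= x)%N -> u x = x) ->
  y \in fixed_seq b p -> act u y \in fixed_seq b p.
Proof.
move=> hu /mem_fixed_seq h; apply/mem_fixed_seq => x px; rewrite col_act //=.
by rewrite -{1}(hu _ px) sfunK h.
Qed.

Lemma Sinf_offV (u : Sinf) p : (forall x, (p <= x)%N -> u x = x) ->
  forall x, (p <= x)%N -> (u^-1)%g x = x.
Proof. by move=> h x px; rewrite -{1}(h _ px) SinfKV. Qed.

Lemma sum_fixed_seq_act (R : nmodType) b p (u : Sinf) (F : Xset b -> R) :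
  (forall x, (p <= x)%N -> u x = x) ->
  \sum_(y <- fixed_seq b p) F (act u y) = \sum_(y <- fixed_seq b p) F y.
Proof.
move=> hu; rewrite -(big_map (act u) predT F); apply: perm_big.
apply: uniq_perm; rewrite ?fixed_seq_uniq //.
  rewrite map_inj_uniq ?fixed_seq_uniq //; exact: can_inj (actK u).
move=> y; apply/mapP/idP => [[z hz ->]|hy]; first exact: act_mem_fixed_seq.
exists (act (u^-1)%g y); last by rewrite actVK.
exact: act_mem_fixed_seq (Sinf_offV hu) hy.
Qed.

Definition supp_size b : nat := npts (fun x => col0 b x != 1%N).

Lemma npts_col_supp_size b (y : Xset b) : npts (fun x => col y x != 1%N) = supp_size b.
Proof. by rewrite (npts_col n_gt0 y (fun i => i != 1%N)). Qed.

(** A normal form for moving points beyond q: those of color other than 1 fill exactly [q, q +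
    i). *)
Definition packed q i b (y : Xset b) : bool :=
  `[< forall a, (q <= a)%N -> (col y a != 1%N) = (a < q + i)%N >].

Lemma packed_supp_size q i b (y : Xset b) : packed q i y -> (i <= supp_size b)%N.
Proof.
move=> /asboolP h; rewrite -(npts_col_supp_size y) (@npts_count _ (q + i)).
  rewrite iotaD count_cat add0n (leq_trans _ (leq_addl _ _)) //.
  rewrite (@eq_in_count _ _ predT) ?count_predT ?size_iota //.
  by move=> a; rewrite mem_iota => /andP[qa ai]; rewrite h.
by move=> a qa; rewrite h; lia.
Qed.

Lemma packed_mem q i b (y : Xset b) p : (q + i <= p)%N -> packed q i y -> y \in fixed_seq b p.
Proof.
move=> qp /asboolP h; apply/mem_fixed_seq => a pa; apply/eqP/negPn; rewrite h; lia.
Qed.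

Lemma eq_big_packed (R : nmodType) q i b p p' (F : Xset b -> R) :
  (q + i <= p)%N -> (q + i <= p')%N ->
  \sum_(y <- fixed_seq b p | packed q i y) F y = \sum_(y <- fixed_seq b p' | packed q i y) F y.
Proof.
move=> h h'; rewrite -big_filter -[RHS]big_filter; apply: perm_big.
apply: uniq_perm; rewrite ?filter_uniq ?fixed_seq_uniq // => y.
by rewrite !mem_filter; case: (boolP (packed q i y)) => //= hy; rewrite !(packed_mem _ hy).
Qed.

Lemma Sinf_move q p (s : {set 'I_p}) : s \subset [set a : 'I_p | (q <= a)%N]%SET ->
  (q + #|s| <= p)%N ->
  exists u : Sinf, [/\ forall x, (p <= x)%N -> u x = x,
    forall x, (x < q)%N -> u x = x &
    forall a : 'I_p, (q <= a)%N -> (a \in s) = (u a < q + #|s|)%N].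
Proof.
move=> /fintype.subsetP sq sp; pose sb x := x \in [seq val a | a in s].
have sbE (a : 'I_p) : sb a = (a \in s) by rewrite /sb mem_map ?mem_enum //; exact: val_inj.
(* Points below q must be fixed individually only as a set here labelled 1 or not: they keep their
   own name as label, and beyond q the label is membership alone. *)
pose lab (P : pred nat) x : nat + bool := if (x < q)%N then inl x else inr (P x).
pose f := lab sb; pose g := lab (fun x => (x < q + #|s|)%N).
have pe : perm_eq (map f (iota 0 p)) (map g (iota 0 p)).
  have -> : iota 0 p = iota 0 q ++ iota q (p - q) by rewrite -iotaD; congr iota; lia.
  have lE P : map (lab P) (iota 0 q) = map inl (iota 0 q).
    by apply/eq_in_map => x; rewrite mem_iota /lab => /andP[_ ->].
  have lE' P : map (lab P) (iota q (p - q)) = map inr (map P (iota q (p - q))).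
    rewrite -map_comp; apply/eq_in_map => x; rewrite mem_iota /lab => /andP[h _].
    by rewrite ltnNge h.
  rewrite !map_cat !lE !lE' perm_cat2l; apply: perm_map.
  apply: (@perm_eq_count_off _ false); first by rewrite !size_map.
  case=> // _; rewrite !count_map.
  have sb0 : count sb (iota 0 q) = 0%N.
    apply/eqP; rewrite -leqn0 leqNgt -has_count; apply/hasPn => x.
    rewrite mem_iota add0n => /andP[_ xq]; apply/mapP => -[a]; rewrite mem_enum => /sq.
    by rewrite inE => qa e; rewrite -e leqNgt xq in qa.
  have cs : count sb (iota 0 p) = #|s|.
    rewrite -sum1_count big_mkcond /= -sum1_card [RHS]big_mkcond /=.
    rewrite (_ : iota 0 p = index_iota 0 p) ?big_mkord; last by rewrite /index_iota subn0.
    by apply: eq_bigr => a _; rewrite sbE.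
  transitivity #|s|.
    rewrite -cs (_ : iota 0 p = iota 0 q ++ iota q (p - q)); last first.
      by rewrite -iotaD; congr iota; lia.
    by rewrite count_cat sb0; apply: eq_count => x /=; case: (sb x).
  rewrite (_ : (p - q)%N = #|s| + (p - q - #|s|))%N; last lia.
  rewrite iotaD count_cat (@eq_in_count _ _ predT) ?count_predT ?size_iota; last first.
    by move=> x; rewrite mem_iota /= => /andP[_ ->].
  rewrite (@eq_in_count _ _ pred0) ?count_pred0 ?addn0 //.
  by move=> x; rewrite mem_iota /= => /andP[h _]; rewrite ltnNge h.
have [u up ux] := Sinf_of_perm_eq pe; exists u; split=> //.
  move=> x xq; have xp : (x < p)%N by lia.
  by have := ux x xp; rewrite /f /g /lab xq; case: ifP => // _ [].
move=> a qa; have := ux a (ltn_ord a); rewrite /f /g /lab ltnNge qa /= sbE.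
by case: ifP => // _ [].
Qed.

(** A coloring is packed for at most one i, and then i <= [supp_size b]. Its weight is the
    polynomial counting the i-subsets of [q, p), which are the possible positions of its points
    beyond q of color other than 1. Unpacked colorings get weight 0. *)
Definition quad_weight (F : fieldType) q b (y : Xset b) : {poly F} :=
  \sum_(i < (supp_size b).+1) (packed q i y)%:R *: binp F q i.

(* Sort the colorings by the set of points of [q, p) of color <> 1: by invariance
   only the size i of this set matters, and there are 'C(p - q, i) such sets. *)
Lemma quadrature (R : fieldType) (charR : [pchar R] =i pred0) b q p (F : Xset b -> R) :
  (q <= p)%N ->
  (forall (u : Sinf) y, (forall x, (x < q)%N -> u x = x) ->
     (forall x, (p <= x)%N -> u x = x) -> F (act u y) = F y) ->
  \sum_(y <- fixed_seq b p) F y =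
  \sum_(y <- fixed_seq b (q + supp_size b)) (quad_weight R q y).[p%:R] * F y.
Proof.
move=> qp Finv; set m := supp_size b.
pose T i := \sum_(y <- fixed_seq b (q + m) | packed q i y) F y.
transitivity (\sum_(i < m.+1) 'C(p - q, i)%:R * T i); last first.
  rewrite [RHS](eq_bigr (fun y => \sum_(i < m.+1) 'C(p - q, i)%:R * ((packed q i y)%:R * F y))).
    rewrite exchange_big /=; apply: eq_bigr => i _; rewrite -mulr_sumr; congr (_ * _).
    by rewrite /T big_mkcond; apply: eq_bigr => y _; case: ifP => _; rewrite ?mul1r ?mul0r.
  move=> y _; rewrite horner_sum mulr_suml; apply: eq_bigr => i _.
  by rewrite hornerZ binpE // mulrCA mulrA.
pose Sq := [set a : 'I_p | (q <= a)%N]%SET.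
have cSq : #|Sq| = (p - q)%N.
  rewrite -sum1_card big_mkcond /= (eq_bigr (fun a : 'I_p => (q <= a)%N : nat)); last first.
    by move=> a _; rewrite inE; case: leqP.
  rewrite -(big_mkord predT (fun a => (q <= a)%N : nat)) (@big_cat_nat _ _ _ q) //=.
  rewrite big_nat_cond big1 => [|i /andP[/andP[_ h] _]]; last by rewrite leqNgt h.
  rewrite add0n big_nat_cond (eq_bigr (fun=> 1%N)) => [|i /andP[/andP[-> _] _]] //.
  by rewrite -big_nat_cond sum_nat_const_nat muln1.
pose S (y : Xset b) := [set a : 'I_p | (q <= a)%N && (col y a != 1%N)]%SET.
have T_seg (s : {set 'I_p}) : s \subset Sq -> \sum_(y <- fixed_seq b p | S y == s) F y = T #|s|.
  move=> sq; have sp : (q + #|s| <= p)%N.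
    by have := subset_leq_card sq; rewrite cSq; lia.
  have [u [up uq us]] := Sinf_move sq sp.
  have upV := Sinf_offV up.
  have uqV x : (x < q)%N -> (u^-1)%g x = x by move=> h; rewrite -{1}(uq _ h) SinfKV.
  (* The permutation u carries the colorings with [S y = s] to the packed ones, and F is invariant
     under it because u moves only points of [q, p). *)
  transitivity (\sum_(y <- fixed_seq b p | packed q #|s| y) F y).
    rewrite big_mkcond -(sum_fixed_seq_act _ upV) [RHS]big_mkcond.
    rewrite big_seq [RHS]big_seq; apply: eq_bigr => y /mem_fixed_seq hy.
    rewrite Finv //; congr (if _ then _ else _).
    have colE a : col (act (u^-1)%g y) a = col y (u a) by rewrite col_act //= .
    apply/eqP/asboolP => [e a qa|h].
      have [ap|pa] := ltnP a p; last by rewrite hy // eqxx; lia.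
      pose a' := (u^-1)%g a.
      have ua : u a' = a by exact: SinfVK.
      have a'p : (a' < p)%N.
        by rewrite ltnNge; apply/negP => h; move: ap; rewrite -ua up // ltnNge h.
      have qa' : (q <= a')%N.
        by rewrite leqNgt; apply/negP => h; move: qa; rewrite -ua uq // leqNgt h.
      have := us (Ordinal a'p) qa'; rewrite -e inE /= qa' /= colE ua //.
    apply/setP => a; rewrite inE colE; have [qa|aq] := leqP q a.
      rewrite us //= h // leqNgt; apply/negP => h'.
      by move: qa; rewrite -(SinfKV u a) uqV // leqNgt h'.
    by apply/esym/negP => /(fintype.subsetP sq); rewrite inE leqNgt aq.
  (* A coloring has only m points of color other than 1, so for larger s both sums are empty. *)
  have [im|mi] := leqP #|s| m; first by apply: eq_big_packed; rewrite // leq_add2l.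
  rewrite /T !big1_seq // => y /andP[/packed_supp_size h _]; move: (leq_trans mi h); by rewrite ltnn.
rewrite (partition_big S (fun s => s \subset Sq)) /=; last first.
  by move=> y _; apply/fintype.subsetP => a; rewrite !inE => /andP[].
rewrite (eq_bigr (fun s : {set 'I_p} => \sum_(i < m.+1) (#|s| == i)%:R * T i)).
  rewrite exchange_big /=; apply: eq_bigr => i _; rewrite -mulr_suml; congr (_ * _).
  rewrite -natr_sum -cSq -cards_draws -sum1_card; congr _%:R.
  by rewrite -big_mkcondr /=; apply: eq_bigl => s; rewrite inE.
move=> s sq; rewrite T_seg //; have [im|mi] := ltnP #|s| m.+1.
  rewrite (bigD1 (Ordinal im)) //= eqxx mul1r big1 ?addr0 // => i.
  by rewrite -val_eqE eq_sym /= => /negPf ->; rewrite mul0r.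
rewrite /T big1_seq => [|y /andP[/packed_supp_size h _]]; last by have := leq_trans mi h; rewrite ltnn.
by rewrite big1 // => i _; rewrite gtn_eqF ?mul0r // (leq_trans _ mi).
Qed.

End Quadrature.

(** * Integration *)

Lemma card_filter_seq (T : choiceType) (s : seq T) (P : pred T) : uniq s ->
  [set y | P y /\ y \in s] #= `I_(count P s).
Proof.
move=> us; rewrite (_ : [set _ | _] = [set` [fset y in seq.filter P s]%fset]).
  apply/card_eq_fsetP; rewrite card_fseq undup_id ?size_filter //.
  exact: filter_uniq.
apply/seteqP; split=> y /=; rewrite in_fset mem_filter; first by move=> [-> ->].
by move/andP.
Qed.

Lemma sum_seq_supp (R : nmodType) (T : eqType) (s s' : seq T) (h : T -> R) :
  uniq s -> uniq s' -> {subset s <= s'} -> (forall y, y \notin s -> h y = 0) ->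
  \sum_(y <- s') h y = \sum_(y <- s) h y.
Proof.
move=> us us' ss' h0; rewrite (bigID (fun y => y \in s)) /= [X in _ + X]big1 ?addr0 //.
rewrite -big_filter; apply: perm_big; apply: uniq_perm; rewrite ?filter_uniq //.
by move=> y; rewrite mem_filter; apply: andb_idr; exact: ss'.
Qed.

Lemma sum_fibers (R : nmodType) (T T' : eqType) (s : seq T) (h : T -> T') (w : T -> R) :
  \sum_(c <- undup (map h s)) \sum_(y <- s) (if h y == c then w y else 0) =
  \sum_(y <- s) w y.
Proof.
rewrite exchange_big big_seq [RHS]big_seq; apply: eq_bigr => y hy.
rewrite (bigD1_seq (h y)) ?undup_uniq ?mem_undup ?map_f //= eqxx big1 ?addr0 // => c.
by rewrite eq_sym => /negPf ->.
Qed.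

Section Integral.
Variables (k : fieldType) (char0 : [pchar k] =i pred0).
Variables (n : option nat) (n_gt0 : n != Some 0%N) (t : k).
Implicit Type b : composition n t.

Definition inv_from b q (T : Type) (h : Xset b -> T) :=
  forall (u : Sinf) y, (forall x, (x < q)%N -> u x = x) -> h (act u y) = h y.

Lemma quadrature_inv (R : fieldType) (charR : [pchar R] =i pred0) b q p (F : Xset b -> R) :
  (q <= p)%N -> inv_from q F ->
  \sum_(y <- fixed_seq b p) F y =
  \sum_(y <- fixed_seq b (q + supp_size b)) (quad_weight R q y).[p%:R] * F y.
Proof. by move=> qp Finv; apply: quadrature => // u y hu _; exact: Finv. Qed.

Lemma card_fixed_points b p (P : pred (Xset b)) (A : set (Xset b)) :
  (forall y, A y <-> P y) -> fixed_points A p #= `I_(count P (fixed_seq b p)).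
Proof.
move=> AP; rewrite (_ : fixed_points A p = [set y | P y /\ y \in fixed_seq b p]).
  exact: card_filter_seq (fixed_seq_uniq _ _).
apply/seteqP; split=> y [hy].
  by move=> /(fixed_col n_gt0 y p)/(mem_fixed_seq n_gt0) yp; split=> //; exact/AP.
by move=> /(mem_fixed_seq n_gt0)/(fixed_col n_gt0 y p) fy; split=> //; exact/AP.
Qed.

(** Quadrature is applied over the rationals, where counting polynomials live; it provides a
    counting polynomial, and uniqueness identifies it with the one chosen by [xget]. Its weights are
    binomial polynomials, which [ratr] sends to the same polynomials over k. *)
Lemma mu_quad b q (P : pred (Xset b)) (A : set (Xset b)) :
  (forall y, A y <-> P y) -> inv_from q P ->
  mu t A = \sum_(y <- fixed_seq b (q + supp_size b) | P y) (quad_weight k q y).[t].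
Proof.
move=> AP Pinv; pose Q : {poly rat} := \sum_(y <- fixed_seq b (q + supp_size b) | P y) quad_weight rat q y.
have chQ : [pchar rat] =i pred0 by exact: Num.Theory.pchar_num.
have QE p : (q <= p)%N -> Q.[p%:R] = (count P (fixed_seq b p))%:R.
  move=> qp; rewrite -sum1_count natr_sum big_mkcond /=.
  rewrite (@quadrature_inv rat chQ b q p (fun y => if P y then 1 else 0)) //; last first.
    by move=> u y hu; rewrite Pinv.
  rewrite horner_sum big_mkcond; apply: eq_bigr => y _.
  by case: (P y); rewrite ?mulr1 ?mulr0.
have cQ : is_counting_poly A Q.
  exists q => p qp; exists (count P (fixed_seq b p)); split; last exact: QE.
  exact: card_fixed_points.
have -> : mu t A = (map_poly (ratr_char0 char0) Q).[t].
  rewrite /mu; congr (map_poly _ _).[_]; apply: xget_unique => // Q' [N hN].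
  apply: (@poly_eq_large _ _ _ (maxn q N)) => // p; rewrite geq_max => /andP[qp Np].
  have [m [Am ->]] := hN p Np; rewrite QE //; congr _%:R.
  apply/card_eq_II; rewrite -(card_eql Am); exact: card_fixed_points.
rewrite raddf_sum horner_sum; apply: eq_bigr => y _; congr _.[_].
rewrite /quad_weight raddf_sum; apply: eq_bigr => i _ /=.
by rewrite map_polyZ rmorph_nat map_binp.
Qed.

(** Quadrature applied to the indicator of the fiber through y would give 0 if the list missed that
    fiber, while the sum it computes is a positive count. The indicator takes rational values so
    that a positive count is nonzero. *)
Lemma inv_from_range b q (T : Type) (h : Xset b -> T) y : inv_from q h ->
  exists2 y', y' \in fixed_seq b (q + supp_size b) & h y' = h y.
Proof.
move=> hinv; have [p0 hp0] := exists_mem_fixed_seq n_gt0 y.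
pose p := maxn p0 q.
have yp : y \in fixed_seq b p by apply: mem_fixed_seqW hp0; rewrite ?leq_maxl.
pose P (z : Xset b) := `[< h z = h y >].
have Pinv : inv_from q (fun z => (P z)%:R : rat).
  by move=> u z hu; rewrite /P hinv.
have := quadrature_inv (Num.Theory.pchar_num _) (leq_maxr p0 q) Pinv.
have [/hasP[z hz /asboolP e] _|/hasPn hn] := boolP (has P (fixed_seq b (q + supp_size b))).
  by exists z.
rewrite [RHS]big1_seq; last by move=> z /= /hn /negPf ->; rewrite mulr0.
rewrite -natr_sum => /eqP; rewrite pnatr_eq0 sum_nat_seq_eq0 => /allP /(_ y yp) /=.
by rewrite /P; case: asboolP.
Qed.

(** The list and the weights do not depend on h, so the right-hand side is linear in h, which the
    sum over the values of h is not visibly. *)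
Lemma integral_quad b q (h : Xset b -> k) : inv_from q h ->
  integral t h = \sum_(y <- fixed_seq b (q + supp_size b)) (quad_weight k q y).[t] * h y.
Proof.
move=> hinv; rewrite /integral; set ys := fixed_seq b _.
have rinv c : inv_from q (fun y => h y == c) by move=> u y hu; rewrite hinv.
rewrite (fsbigE (undup (map h ys))) ?undup_uniq //; first last.
- move=> c [y _ <-]; rewrite mem_undup => /mapP nh; case: nh.
  by have [y' hy' e] := inv_from_range y hinv; exists y'; rewrite // e.
- move=> c hc; have /mapP[y _ ->] : c \in map h ys by rewrite -mem_undup.
  by exists y.
rewrite big_mkcond /= (eq_bigr (fun c => \sum_(y <- ys)
  if h y == c then (quad_weight k q y).[t] * h y else 0)).
  exact: sum_fibers.
move=> c _; case: ifPn => [_|].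
  rewrite (@mu_quad b q (fun y => h y == c)) //; last first.
    by move=> y; split=> [->|/eqP].
  rewrite mulr_sumr big_mkcond; apply: eq_bigr => y _.
  by case: eqP => [->|]; rewrite // mulrC.
rewrite notin_setE => nc; rewrite big1 // => y _; case: eqP => // e.
by case: nc; exists y.
Qed.

Lemma interp_integral b q (h : Xset b -> k) : inv_from q h ->
  interp t (fun p => \sum_(y <- fixed_seq b p) h y) (integral t h).
Proof.
move=> hinv; exists (\sum_(y <- fixed_seq b (q + supp_size b)) h y *: quad_weight k q y); split.
  by rewrite (integral_quad hinv) horner_sum; apply: eq_bigr => y _; rewrite hornerZ mulrC.
exists q => p qp; rewrite (quadrature_inv char0 qp hinv) horner_sum.
by apply: eq_bigr => y _; rewrite hornerZ mulrC.
Qed.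

Lemma integral_lin b q a (h h' : Xset b -> k) : inv_from q h -> inv_from q h' ->
  integral t (fun y => a * h y + h' y) = a * integral t h + integral t h'.
Proof.
move=> hi hi'; rewrite (integral_quad hi) (integral_quad hi') (@integral_quad _ q).
  rewrite mulr_sumr -big_split; apply: eq_bigr => y _ /=.
  by rewrite mulrDr mulrCA.
by move=> u y hu; rewrite hi // hi'.
Qed.

(** The sums over larger and larger sets of colorings are constant, so the interpolating polynomial
    is constant and its value does not depend on t. *)
Lemma integral_finsupp b q (h : Xset b -> k) : inv_from q h ->
  (forall y, h y != 0 -> y \in fixed_seq b q) ->
  integral t h = \sum_(y <- fixed_seq b q) h y.
Proof.
move=> hi hs; apply: (interp_uniq char0 (interp_integral hi) (interp_cst _ _) (N := q)).
move=> p qp; apply: sum_seq_supp; rewrite ?fixed_seq_uniq //.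
  by move=> y; exact: mem_fixed_seqW.
by move=> y; apply: contraNeq => /hs.
Qed.

(** Fubini, in the form that an iterated integral interpolates the finite double sums, in which the
    order can be exchanged. The outer quadrature keeps finitely many z, all fixed by S(q'), so a
    single bound q' serves the inner quadrature for all of them. *)
Lemma interp_integral2 (b c : composition n t) q (h : Xset b -> Xset c -> k) :
  (forall (u : Sinf) z y, (forall x, (x < q)%N -> u x = x) ->
     h (act u z) (act u y) = h z y) ->
  interp t (fun p => \sum_(z <- fixed_seq b p) \sum_(y <- fixed_seq c p) h z y)
    (integral t (fun z => integral t (h z))).
Proof.
move=> hinv; pose q' := (q + supp_size b)%N.
have actE z (u : Sinf) : z \in fixed_seq b q' -> (forall x, (x < q')%N -> u x = x) -> act u z = z.
  by move=> /(mem_fixed_seq n_gt0)/(fixed_col n_gt0) hz hu; exact: hz.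
have hinv1 z : z \in fixed_seq b q' -> inv_from q' (h z).
  move=> zq u y hu; rewrite -{1}(actE z u) // hinv // => x xq.
  by apply: hu; rewrite (leq_trans xq) // leq_addr.
have intinv : inv_from q (fun z => integral t (h z)).
  (* Here z is arbitrary, and the bound r from which [h z] is invariant depends on it;
     [integral_act] only needs some bound. *)
  move=> u z hu; have [p hp] := exists_mem_fixed_seq n_gt0 z.
  pose r := maxn q p.
  have hz : inv_from r (h z).
    move=> v y hv; rewrite -{1}(_ : act v z = z) ?hinv // => [x xq|].
      by apply: hv; rewrite (leq_trans xq) // leq_maxl.
    move/(mem_fixed_seq n_gt0)/(fixed_col n_gt0): hp; apply=> x /= xp.
    by apply: hv; rewrite (leq_trans xp) // leq_maxr.
  rewrite -(@integral_act _ k t u r (h z) hz).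
  congr (integral t _); apply/funext => y /=; by rewrite -[RHS](hinv u) // actVK.

exists (\sum_(z <- fixed_seq b q') \sum_(y <- fixed_seq c (q' + supp_size c))
  h z y *: (quad_weight k q z * quad_weight k q' y)).
split.
  rewrite (integral_quad intinv) horner_sum big_seq [RHS]big_seq; apply: eq_bigr => z hz.
  rewrite (integral_quad (hinv1 z hz)) horner_sum mulr_sumr; apply: eq_bigr => y _.
  by rewrite hornerZ hornerM mulrC -mulrA; congr (_ * _); rewrite mulrC.
exists q' => p qp; rewrite (@quadrature _ _ n_gt0 _ _ char0 _ q); last 2 first.
- by rewrite (leq_trans _ qp) // leq_addr.
- move=> u z uq up; rewrite -(sum_fixed_seq_act n_gt0 _ up).
  by apply: eq_bigr => y _; rewrite hinv.
rewrite horner_sum big_seq [RHS]big_seq; apply: eq_bigr => z hz.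
rewrite (quadrature_inv char0 qp (hinv1 z hz)) horner_sum mulr_sumr; apply: eq_bigr => y _.
by rewrite hornerZ hornerM mulrC -mulrA; congr (_ * _); rewrite mulrC.
Qed.

End Integral.

(** * The Schur algebra is locally unital *)

Section DirectSumTheory.
Variables (k : fieldType) (I : choiceType) (M : I -> lmodType k).

Lemma dsum_injE (i : I) (m : M i) : dsum_inj m i = m.
Proof. by rewrite /= /inj_val; case: eqP => // e; rewrite (eq_axiomK e). Qed.

Lemma dsum_injN (i j : I) (m : M i) : i != j -> dsum_inj m j = 0.
Proof. by rewrite /= /inj_val; case: eqP. Qed.

Lemma dval_linear a (x y : dsum M) j : (a *: x + y) j = a *: x j + y j.
Proof. by []. Qed.

Lemma dsum_inj_linear (i : I) : linear (@dsum_inj k I M i).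
Proof.
move=> a x y; apply: dsum_eq => j; rewrite dval_linear.
have [<-|ij] := eqVneq i j; first by rewrite !dsum_injE.
by rewrite !dsum_injN // scaler0 addr0.
Qed.

Lemma dsum_inj0 (i : I) : dsum_inj (0 : M i) = 0 :> dsum M.
Proof.
apply: dsum_eq => j; have [<-|ij] := eqVneq i j; first by rewrite dsum_injE.
by rewrite dsum_injN.
Qed.

Lemma dsum_sumE (T : Type) (s : seq T) (F : T -> dsum M) j :
  (\sum_(x <- s) F x) j = \sum_(x <- s) F x j.
Proof. exact: (big_morph (fun x : dsum M => x j)). Qed.

Lemma dsum_support (x : dsum M) :
  exists2 s : seq I, uniq s & forall i, x i != 0 -> i \in s.
Proof.
exists (fset_set [set i | x i != 0]); first exact: fset_uniq.
by move=> i xi; rewrite in_fset_set ?inE //; exact: dsum_fin.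
Qed.

Lemma dsum_decomp (x : dsum M) : exists s : seq I, x = \sum_(i <- s) dsum_inj (x i).
Proof.
have [s us hs] := dsum_support x; exists s; apply: dsum_eq => j; rewrite dsum_sumE.
have [js|njs] := boolP (j \in s).
  rewrite (bigD1_seq j) // dsum_injE big1 => [|i ij]; first exact/esym/addr0.
  exact: dsum_injN.
rewrite big1_seq => [|i /andP[_ hi]]; last first.
  by apply: dsum_injN; apply: contraNneq njs => <-.
by apply/eqP; apply: contraNT njs; exact: hs.
Qed.

End DirectSumTheory.

Section SchurAlgebra.
Variables (k : fieldType) (char0 : [pchar k] =i pred0).
Variables (n : option nat) (n_gt0 : n != Some 0%N) (t : k).
Local Notation comp := (composition n t).
Local Notation HomX b d := (Hom k (Xset (b : comp)) (Xset (d : comp))).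

Lemma homE (b d : comp) (f : HomX b d) s z x : f (act s z, act s x) = f (z, x).
Proof. by have /asboolP := hom_inv f; apply. Qed.

Lemma act_fixed_seq (b : comp) q (z : Xset b) (u : Sinf) : z \in fixed_seq b q ->
  (forall x, (x < q)%N -> u x = x) -> act u z = z.
Proof. by move=> /(mem_fixed_seq n_gt0)/(fixed_col n_gt0) hz hu; exact: hz. Qed.

Lemma exists_mem_fixed_seq2 (b c : comp) (z : Xset b) (x : Xset c) :
  exists q, z \in fixed_seq b q /\ x \in fixed_seq c q.
Proof.
have [q hq] := exists_mem_fixed_seq n_gt0 z; have [r hr] := exists_mem_fixed_seq n_gt0 x.
by exists (maxn q r); split; [apply: mem_fixed_seqW hq|apply: mem_fixed_seqW hr];
  rewrite ?leq_maxl ?leq_maxr.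
Qed.

Lemma hom_inv_from (b c d : comp) (g : HomX c d) (f : HomX b c) q z x :
  z \in fixed_seq d q -> x \in fixed_seq b q -> inv_from q (fun y => g (z, y) * f (y, x) : k).
Proof.
move=> hz hx u y hu; rewrite -{1}(act_fixed_seq hz hu) -{1}(act_fixed_seq hx hu).
by rewrite !homE.
Qed.

Lemma interp_comp (b c d : comp) (g : HomX c d) (f : HomX b c) z x :
  interp t (fun p => \sum_(y <- fixed_seq c p) g (z, y) * f (y, x)) (perm_comp t g f (z, x)).
Proof.
have [q [hz hx]] := exists_mem_fixed_seq2 z x.
exact: interp_integral (hom_inv_from g f hz hx).
Qed.

Lemma hom_eq (b d : comp) (f g : HomX b d) : (forall z x, f (z, x) = g (z, x)) -> f = g.
Proof. by move=> h; apply: val_inj; apply/funext => -[z x]; exact: h. Qed.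

Lemma hom_linE (b d : comp) a (f g : HomX b d) p :
  (a *: f + g) p = a * (f p : k) + g p :> k.
Proof. by []. Qed.

Lemma perm_compE (b c d : comp) (g : HomX c d) (f : HomX b c) z x :
  perm_comp t g f (z, x) = integral t (fun y => g (z, y) * f (y, x) : k).
Proof. by []. Qed.

Lemma perm_comp_linearr (b c d : comp) (g : HomX c d) :
  linear (perm_comp t g : HomX b c -> HomX b d).
Proof.
move=> a f f'; apply: hom_eq => z x.
have [q [hz hx]] := exists_mem_fixed_seq2 z x.
rewrite hom_linE !perm_compE.
rewrite -(integral_lin char0 n_gt0 a (hom_inv_from g f hz hx) (hom_inv_from g f' hz hx)).
by congr (integral t _); apply/funext => y; rewrite hom_linE mulrDr mulrCA.
Qed.

Lemma perm_comp_linearl (b c d : comp) (f : HomX b c) :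
  linear (fun g : HomX c d => perm_comp t g f : HomX b d).
Proof.
move=> a g g'; apply: hom_eq => z x.
have [q [hz hx]] := exists_mem_fixed_seq2 z x.
rewrite hom_linE !perm_compE.
rewrite -(integral_lin char0 n_gt0 a (hom_inv_from g f hz hx) (hom_inv_from g' f hz hx)).
by congr (integral t _); apply/funext => y; rewrite hom_linE mulrDl mulrA.
Qed.

(** Both sides are iterated integrals of one function of z and y, in the two orders. It is invariant
    under the permutations fixing the points below q, since these fix w and x. *)
Lemma perm_compA (a b c d : comp) (h : HomX c d) (g : HomX b c) (f : HomX a b) :
  perm_comp t h (perm_comp t g f) = perm_comp t (perm_comp t h g) f.
Proof.
apply: hom_eq => w x.
have [q [hw hx]] := exists_mem_fixed_seq2 w x.
have mulc e (c' : comp) (r : nat) (phi : Xset c' -> k) : inv_from r phi ->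
    integral t (fun y => e * phi y) = e * integral t phi.
  move=> hphi; have := integral_lin char0 n_gt0 e hphi (fun u y _ => erefl : (fun=> 0 : k) _ = 0).
  rewrite integral0 addr0 => <-; congr integral.
  by apply/funext => y; rewrite addr0.
have -> : perm_comp t h (perm_comp t g f) (w, x) =
    integral t (fun z => integral t (fun y => h (w, z) * (g (z, y) * f (y, x)))).
  congr (integral t _); apply/funext => z; rewrite perm_compE.
  have [r [hz hx']] := exists_mem_fixed_seq2 z x.
  by rewrite (mulc _ _ r) //; exact: hom_inv_from.
have -> : perm_comp t (perm_comp t h g) f (w, x) =
    integral t (fun y => integral t (fun z => h (w, z) * (g (z, y) * f (y, x)))).
  congr (integral t _); apply/funext => y; rewrite perm_compE.
  have [r [hw' hy]] := exists_mem_fixed_seq2 w y.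
  rewrite mulrC -(mulc _ _ r); last exact: hom_inv_from.
  by congr (integral t _); apply/funext => z; rewrite mulrC mulrA.
have inv (u : Sinf) z y : (forall i, (i < q)%N -> u i = i) ->
    h (w, act u z) * (g (act u z, act u y) * f (act u y, x)) =
    h (w, z) * (g (z, y) * f (y, x)).
  by move=> hu; rewrite -{1}(act_fixed_seq hw hu) -{1}(act_fixed_seq hx hu) !homE.
have i1 := interp_integral2 char0 n_gt0 inv.
have i2 := interp_integral2 char0 n_gt0 (fun u y z => inv u z y).
apply: (interp_uniq char0 i1 i2 (N := 0%N)) => p _.
exact: exchange_big.
Qed.

Lemma perm_idl (b d : comp) (f : HomX b d) : perm_comp t (perm_id k (Xset d)) f = f.
Proof.
apply: hom_eq => z x.
have [q [hz hx]] := exists_mem_fixed_seq2 z x.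
have hinv := hom_inv_from (perm_id k (Xset d)) f hz hx.
rewrite perm_compE (integral_finsupp char0 n_gt0 hinv).
  rewrite (bigD1_seq z) ?fixed_seq_uniq //= asboolT // mul1r big1 ?addr0 // => y yz.
  by rewrite asboolF ?mul0r // => e; rewrite e eqxx in yz.
by move=> y /=; case: asboolP => [<- //|_]; rewrite mul0r eqxx.
Qed.

Lemma perm_idr (b d : comp) (f : HomX b d) : perm_comp t f (perm_id k (Xset b)) = f.
Proof.
apply: hom_eq => z x.
have [q [hz hx]] := exists_mem_fixed_seq2 z x.
have hinv := hom_inv_from f (perm_id k (Xset b)) hz hx.
rewrite perm_compE (integral_finsupp char0 n_gt0 hinv).
  rewrite (bigD1_seq x) ?fixed_seq_uniq //= asboolT // mulr1 big1 ?addr0 // => y yx.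
  by rewrite asboolF ?mulr0 // => e; rewrite e eqxx in yx.
by move=> y /=; case: asboolP => [-> //|_]; rewrite mulr0 eqxx.
Qed.

Local Notation SM := (fun bd : comp * comp => HomX bd.1 bd.2).
Definition sinj (b d : comp) (f : HomX b d) : Schur n t := dsum_inj (M := SM) (i := (b, d)) f.

Lemma sinj_linear (b d : comp) : linear (@sinj b d).
Proof. exact: (@dsum_inj_linear _ _ SM (b, d)). Qed.

Lemma sinj0 (b d : comp) : sinj (0 : HomX b d) = 0.
Proof. exact: (@dsum_inj0 _ _ SM (b, d)). Qed.

Lemma sinjE (b d : comp) (f : HomX b d) : sinj f (b, d) = f.
Proof. exact: (@dsum_injE _ _ SM (b, d)). Qed.

Lemma sinjN (b d b' d' : comp) (f : HomX b d) : (b, d) != (b', d') ->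
  sinj f (b', d') = 0.
Proof. exact: (@dsum_injN _ _ SM (b, d) (b', d')). Qed.

Lemma Schur_mulE (g f : Schur n t) (b d : comp) (r : seq comp) : uniq r ->
  (forall c, c \notin r -> g (c, d) = 0 \/ f (b, c) = 0) ->
  Schur_mul g f (b, d) = \sum_(c <- r) (perm_comp t (g (c, d)) (f (b, c)) : HomX b d).
Proof.
move=> ur hr; rewrite /= /Schur_mul_val (fsbigE r) //.
  by apply: eq_bigl => c; rewrite in_setT.
by move=> c _ /hr[|] /= ->; [exact: perm_0comp|exact: perm_comp0].
Qed.

Lemma Schur_supportr (f : Schur n t) b :
  exists2 r : seq comp, uniq r & forall c, c \notin r -> f (b, c) = 0.
Proof.
have [s us hs] := dsum_support f; exists (undup (map snd s)); first exact: undup_uniq.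
move=> c; rewrite mem_undup => hc; apply/eqP; apply: contraNT hc => /hs h.
by apply/mapP; exists (b, c).
Qed.

Lemma Schur_supportl (f : Schur n t) d :
  exists2 r : seq comp, uniq r & forall c, c \notin r -> f (c, d) = 0.
Proof.
have [s us hs] := dsum_support f; exists (undup (map fst s)); first exact: undup_uniq.
move=> c; rewrite mem_undup => hc; apply/eqP; apply: contraNT hc => /hs h.
by apply/mapP; exists (c, d).
Qed.

Lemma Schur_mul_linearr (g : Schur n t) : linear (Schur_mul g : Schur n t -> Schur n t).
Proof.
move=> a f f'; apply: dsum_eq => -[b d].
have [r ur hr] := Schur_supportl g d.
have h e : Schur_mul g e (b, d) = \sum_(c <- r) (perm_comp t (g (c, d)) (e (b, c)) : HomX b d).
  by rewrite (@Schur_mulE g e b d r) // => c /hr; left.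
rewrite dval_linear !h.
rewrite scaler_sumr -big_split; apply: eq_bigr => c _ /=.
by rewrite perm_comp_linearr.
Qed.

Lemma Schur_mul_linearl (f : Schur n t) : linear (fun g : Schur n t => Schur_mul g f : Schur n t).
Proof.
move=> a g g'; apply: dsum_eq => -[b d].
have [r ur hr] := Schur_supportr f b.
have h e : Schur_mul e f (b, d) = \sum_(c <- r) (perm_comp t (e (c, d)) (f (b, c)) : HomX b d).
  by rewrite (@Schur_mulE e f b d r) // => c /hr; right.
rewrite dval_linear !h.
rewrite scaler_sumr -big_split; apply: eq_bigr => c _ /=.
by rewrite perm_comp_linearl.
Qed.

Lemma Schur_mulA : associative (@Schur_mul k n t).
Proof.
move=> h g f; apply: dsum_eq => -[b d].
have [r ur hr] := Schur_supportl h d; have [s us hs] := Schur_supportr f b.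
rewrite (@Schur_mulE _ _ b d r) //; last by move=> c /hr; left.
rewrite (@Schur_mulE _ _ b d s) //; last by move=> c /hs; right.
rewrite (eq_bigr (fun c => \sum_(c' <- s) (perm_comp t (h (c, d))
    (perm_comp t (g (c', c)) (f (b, c'))) : HomX b d))); last first.
  move=> c _; rewrite (@Schur_mulE _ _ b c s) //; last by move=> c' /hs; right.
  by apply: (big_morph (perm_comp t (h (c, d)))) => [x y|]; rewrite ?perm_comp0 //
    -[x]scale1r perm_comp_linearr !scale1r.
rewrite [RHS](eq_bigr (fun c' => \sum_(c <- r) (perm_comp t (h (c, d))
    (perm_comp t (g (c', c)) (f (b, c'))) : HomX b d))); last first.
  move=> c' _; rewrite (@Schur_mulE _ _ c' d r) //; last by move=> c /hr; left.
  rewrite (big_morph (fun g : HomX c' d => perm_comp t g (f (b, c')) : HomX b d) (id1 := 0) (op1 := +%R)).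
  - by apply: eq_bigr => c _; rewrite perm_compA.
  - by move=> x y; rewrite -[x]scale1r perm_comp_linearl !scale1r.
  - exact: perm_0comp.
exact: exchange_big.
Qed.

Lemma sinj_mul (b c d : comp) (g : HomX c d) (f : HomX b c) :
  Schur_mul (sinj g) (sinj f) = sinj (perm_comp t g f).
Proof.
apply: dsum_eq => -[b' d']; rewrite (@Schur_mulE _ _ b' d' [:: c]) //.
  rewrite big_seq1.
  have [e|nb] := eqVneq b b'; last first.
    rewrite [sinj f _]sinjN ?perm_comp0 ?sinjN //; by apply: contraNneq nb => /(congr1 fst) /= ->.
  have [e'|nd] := eqVneq d d'; last first.
    rewrite [sinj g _]sinjN ?perm_0comp ?sinjN //; by apply: contraNneq nd => /(congr1 snd) /= ->.
  by case: b' / e; case: d' / e'; rewrite !sinjE.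
by move=> e; rewrite inE => ec; left; apply: sinjN; apply: contraNneq ec => /(congr1 fst) /= ->.
Qed.

Lemma sinj_mul0 (b c c' d : comp) (g : HomX c' d) (f : HomX b c) : c' != c ->
  Schur_mul (sinj g) (sinj f) = 0.
Proof.
move=> cc; apply: dsum_eq => -[b' d']; rewrite (@Schur_mulE _ _ b' d' [:: c]) //.
  rewrite big_seq1 [sinj g _]sinjN ?perm_0comp //.
  by apply: contraNneq cc => /(congr1 fst) /= ->.
move=> e; rewrite inE => ec; right; apply: sinjN.
by apply: contraNneq ec => /(congr1 snd) /= ->.
Qed.

Lemma Schur_oneE (b : comp) : Schur_one b = sinj (perm_id k (Xset b)).
Proof. by []. Qed.

Lemma Schur_decomp (x : Schur n t) :
  exists s : seq (comp * comp), x = \sum_(i <- s) sinj (x i : HomX i.1 i.2).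
Proof.
have [s {1}->] := dsum_decomp x; exists s.
by apply: eq_bigr => -[b d] _.
Qed.

Lemma Schur_locally_unital : locally_unital (Schur n t).
Proof.
split.
- exact: Schur_mul_linearr.
- exact: Schur_mul_linearl.
- exact: Schur_mulA.
- move=> i j; case: asboolP => [<-|ij]; rewrite /= !Schur_oneE.
    by rewrite sinj_mul perm_idl.
  by rewrite sinj_mul0 //; apply/eqP.
- move=> x; have [s hs] := Schur_decomp x.
  (* The component of index (b, d) maps X^b to X^d, so the second index is the idempotent on the
     left. *)
  exists [seq (i.2, sinj (x i : HomX i.1 i.2), i.1) | i <- s].
  rewrite big_map [LHS]hs; apply: eq_bigr => i _ /=.
  by rewrite !Schur_oneE !sinj_mul perm_idl perm_idr.
Qed.

End SchurAlgebra.

(** * Weights and recolorings *)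

Lemma sum_npts (c : nat -> nat) p K : colors_off c p -> (forall x, 0 < c x < K)%N ->
  (\sum_(j < K) (if (2 <= j)%N then npts (fun x => c x == j) else 0) =
   npts (fun x => c x != 1))%N.
Proof.
move=> cp cK.
have cE j : (if (2 <= j)%N then npts (fun x => c x == j) else 0%N) =
    (\sum_(x <- iota 0 p) ((2 <= j) && (c x == j)))%N.
  case: ifP => j2 /=; last by rewrite big1.
  rewrite (@npts_count _ p) => [|a /cp ->]; last by case: eqP j2 => // <-.
  by rewrite -sum1_count big_mkcond /=; apply: eq_bigr => x _; case: eqP.
transitivity (\sum_(j < K) \sum_(x <- iota 0 p) ((2 <= j) && (c x == j)))%N.
  by apply: eq_bigr => j _; exact: cE.
rewrite exchange_big /=.
rewrite (@npts_count _ p) => [|a /cp -> //].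
rewrite -sum1_count [RHS]big_mkcond /=; apply: eq_bigr => x _.
have /andP[c0 cxK] := cK x.
rewrite (bigD1 (Ordinal cxK)) //= eqxx andbT big1 ?addn0; last first.
  by move=> j; rewrite -val_eqE /= eq_sym => /negPf ->; rewrite andbF.
by case: (c x) c0 => [|[|]].
Qed.

Lemma colors_bounded (c : nat -> nat) p : colors_off c p -> exists K, forall x, (c x < K)%N.
Proof.
move=> cp; exists (maxn 2 (\max_(x < p) c x).+1) => x.
have [px|xp] := leqP p x; first by rewrite cp // leq_maxl.
rewrite (leq_trans _ (leq_maxr _ _)) // ltnS.
exact: (@leq_bigmax_cond _ predT (fun i : 'I_p => c i) (Ordinal xp)).
Qed.

Section Weights.
Variables (k : fieldType) (char0 : [pchar k] =i pred0).
Variables (n : option nat) (n_gt0 : n != Some 0%N) (t : k).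
Local Notation comp := (composition n t).

Lemma fsum_nat (P : nat -> nat) K : (forall i, (K <= i)%N -> P i = 0%N) ->
  \sum_(i \in [set: nat]) ((P i)%:R : k) = (\sum_(i < K) P i)%:R.
Proof.
move=> hK; rewrite (fsbigE (iota 0 K)) ?iota_uniq //; last first.
  by move=> i _; rewrite mem_iota /= -leqNgt => /hK ->.
rewrite natr_sum -(big_mkord predT (fun i => (P i)%:R)) /index_iota subn0.
by apply: eq_bigl => i; rewrite in_setT.
Qed.

Lemma exists_comp (c : nat -> nat) p : colors_off c p ->
  (forall x, in_range n (c x)) ->
  exists b : comp, forall j, (2 <= j)%N -> parts b j = npts (fun x => c x == j).
Proof.
move=> cp cr; have [K hK] := colors_bounded cp.
pose P j := if (2 <= j)%N then npts (fun x => c x == j) else 0%N.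
have npts0 j : (forall x, c x != j) -> npts (fun x => c x == j) = 0%N.
  by move=> h; rewrite (@npts_count _ 0) // => a _; exact: negbTE.
have P0 j : (K <= j)%N -> P j = 0%N.
  move=> Kj; rewrite /P; case: ifP => // _; apply: npts0 => x.
  by rewrite neq_ltn (leq_trans (hK x) Kj).
have Pf : finite_set [set i | P i != 0%N].
  apply: sub_finite_set (finite_II K) => i /=; apply: contraNT.
  by rewrite -leqNgt => /P0 ->.
have Pr i : ~~ ((2 <= i)%N && in_range n i) -> P i = 0%N.
  rewrite /P; case: ifP => //= _ ni; apply: npts0 => x.
  by apply: contraNneq ni => <-.
have Pz : exists z : int, t - \sum_(i \in [set: nat]) ((P i)%:R : k) = t - z%:~R.
  by exists (\sum_(i < K) P i)%N%:Z; rewrite (fsum_nat P0).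
exists (Composition Pf Pr Pz (subrK _ _)) => j j2 /=.
by rewrite /P j2.
Qed.

Lemma exists_Xset (c : nat -> nat) p : colors_off c p ->
  (forall x, in_range n (c x)) ->
  exists b : comp, exists y : Xset b, col y = c.
Proof.
move=> cp cr; have [b hb] := exists_comp cp cr; exists b.
apply: (col_surj n_gt0 cp) => [j j2|x]; first by rewrite hb.
by case/andP: (cr x); rewrite lt0n.
Qed.

Lemma exists_upd (d : comp) (z : Xset d) a j : in_range n j ->
  exists b : comp, exists y : Xset b, col y = upd (col z) a j.
Proof.
move=> jr; have [p hp] := col_off n_gt0 z.
have hq := colors_offW (leq_maxl p a.+1) hp.
apply: (@exists_Xset _ (maxn p a.+1)).
  by apply: colors_off_upd; rewrite // leq_max ltnSn orbT.
by move=> x; rewrite /upd; case: ifP => // _; exact: col_range.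
Qed.

Definition wt (b : comp) (j : nat) : k :=
  if j == 1%N then comp1 b else (parts b j)%:R.

(** Formally the number of points of color 1 in a set with t points in all, which is why color 1
    follows the same rule as the others in [wt_upd] and [interp_count]. *)
Lemma comp1E (b : comp) : comp1 b = t - (supp_size b)%:R.
Proof.
suff <- : \sum_(i \in [set: nat]) ((parts b i)%:R : k) = (supp_size b)%:R.
  by rewrite -[X in X - _](comp_sum b) addrK.
have [p hp] := col0_off n_gt0 b; have [K hK] := colors_bounded hp.
have cK x : (0 < col0 b x < K)%N by rewrite hK andbT; case/andP: (col0_range n_gt0 b x).
rewrite /supp_size -(sum_npts hp cK) (@fsum_nat _ K).
  congr _%:R; apply: eq_bigr => j _; case: ifPn => [j2|]; first by rewrite npts_col0.
  by rewrite -ltnNge => j2; rewrite parts_range //; lia.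
move=> i Ki; have [i2|i2] := leqP 2 i; last by rewrite parts_range //; lia.
rewrite -npts_col0 // (@npts_count _ 0) // => a _.
by apply/negbTE; rewrite neq_ltn (leq_trans (hK a) Ki).
Qed.

Lemma composition_eq (b b' : comp) : comp1 b = comp1 b' -> parts b = parts b' -> b = b'.
Proof.
case: b b' => c P h1 h2 h3 h4 [c' P' h1' h2' h3' h4'] /= e1 e2.
by subst c' P'; congr Composition; exact: Prop_irrelevance.
Qed.

Lemma wt_inj : injective wt.
Proof.
move=> b b' e; have eP j := congr1 (fun f => f j) e.
apply: composition_eq; first by have := eP 1%N; rewrite /wt eqxx.
apply/funext => j; have [->|j1] := eqVneq j 1%N; first by rewrite !parts_range.
by have := eP j; rewrite /wt (negPf j1) => /(natr_injk char0).
Qed.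

Lemma wt_col (d : comp) (z : Xset d) j : wt d j =
  if j == 1%N then t - (npts (fun x => col z x != 1%N))%:R
  else if j == 0%N then 0 else (npts (fun x => col z x == j))%:R.
Proof.
rewrite /wt; case: eqP => [_|/eqP j1]; first by rewrite comp1E npts_col_supp_size.
case: eqP => [->|/eqP j0]; first by rewrite parts_range.
by rewrite npts_col_parts //; lia.
Qed.

Lemma wt_eq (b d : comp) (y : Xset b) (z : Xset d) : col y = col z -> b = d.
Proof. by move=> e; apply: wt_inj; apply/funext => j; rewrite (wt_col y) (wt_col z) e. Qed.

(* The weight after recoloring one point from j to i. *)
Definition wt_move (i j : nat) (l : nat -> k) : nat -> k :=
  fun x => l x + (x == i)%:R - (x == j)%:R.

Lemma wt_moveK i j l : wt_move i j (wt_move j i l) = l.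
Proof. by apply/funext => x; rewrite /wt_move; ring. Qed.

Lemma wt_moveC i j i' j' l : wt_move i j (wt_move i' j' l) = wt_move i' j' (wt_move i j l).
Proof. by apply/funext => x; rewrite /wt_move; ring. Qed.

Lemma wt_moveM i j j' l : wt_move i j (wt_move j j' l) = wt_move i j' l.
Proof. by apply/funext => x; rewrite /wt_move; ring. Qed.

Lemma wt_upd (d b : comp) (z : Xset d) (y : Xset b) a j : (0 < j)%N ->
  col y = upd (col z) a j -> wt b = wt_move j (col z a) (wt d).
Proof.
move=> j0 e; apply/funext => x; rewrite /wt_move (wt_col y) (wt_col z) e.
have [p hp] := col_off n_gt0 z; set i := col z a.
have i0 : (0 < i)%N by case/andP: (col_range n_gt0 z a).
case: ifPn => [/eqP ->|x1].
  have := @npts_upd (fun i => i != 1%N) _ _ a j hp isT; rewrite -/i.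
  set A := npts _; set B := npts _ => eAB.
  have {eAB} : (A%:R + (i != 1%N)%:R : k) = B%:R + (j != 1%N)%:R by rewrite -!natrD eAB.
  rewrite ![(1%N == _)]eq_sym; case: (i =P 1%N); case: (j =P 1%N) => /= _ _ eAB.
  - by move: eAB; rewrite !addr0 => ->; ring.
  - by move: eAB; rewrite addr0 => ->; ring.
  - have -> : B%:R = A%:R + 1 :> k by rewrite -[LHS]addr0 eAB. ring.
  - by move: eAB => /addIr ->; ring.
case: ifPn => [/eqP ->|x0].
  by rewrite !(ltn_eqF) // addr0 subr0.
have := @npts_upd (fun i => i == x) _ _ a j hp; rewrite eq_sym x1 => /(_ isT); rewrite -/i.
set A := npts _; set B := npts _ => eAB.
rewrite ![(x == _)]eq_sym; apply/eqP; rewrite eq_sym subr_eq eq_sym; apply/eqP.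
by rewrite -!natrD eAB.
Qed.

End Weights.

(** * Commutators of the recoloring operators *)

(** The kernel of E_(i,j) at (c, d). The output c comes first, so the recoloring from j to i shows
    up as the reverse step from c to d. *)
Definition recolor (i j : nat) (c d : nat -> nat) : bool :=
  `[< exists a, c a = i /\ d = upd c a j >].

(** For i <> j the recolored point is the only one where c and d differ, so the truth value is a
    count; and it lies below p because c and d agree from p on. *)
Lemma recolor_sum i j c d p : i != j -> colors_off c p -> colors_off d p ->
  (recolor i j c d : nat) = (\sum_(a < p) ((c a == i) && (d == upd c a j)))%N.
Proof.
move=> ij cp dp; rewrite /recolor; case: asboolP => [[a [ca da]]|h]; last first.
  rewrite big1 // => a _; apply/eqP; rewrite eqb0; apply/negP => /andP[/eqP ca /eqP da].
  by apply: h; exists a.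
have daj : d a = j by rewrite da /upd eqxx.
have ap : (a < p)%N.
  by rewrite ltnNge; apply/negP => pa; rewrite -ca -daj cp // dp // eqxx in ij.
rewrite (bigD1 (Ordinal ap)) //= ca da !eqxx big1 // => a' a'a.
apply/eqP; rewrite eqb0; apply/negP => /andP[/eqP ca' /eqP e].
have /negPf naa : a != a' by apply: contraNneq a'a => aa; apply/eqP/val_inj.
have := congr1 (fun f => f a) e; rewrite -da daj /upd naa ca => ji.
by rewrite ji eqxx in ij.
Qed.

Lemma recolor_perm i j c d (s : Sinf) : recolor i j (c \o s) (d \o s) = recolor i j c d.
Proof.
have h (u : Sinf) c' d' : recolor i j c' d' -> recolor i j (c' \o u) (d' \o u).
  move=> /asboolP[a [ca ->]]; apply/asboolP; exists ((u^-1)%g a).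
  by rewrite upd_perm /= sinvK.
have sK (f : nat -> nat) : (f \o s) \o (s^-1)%g = f.
  by apply/funext => x /=; rewrite sinvK.
by apply/idP/idP => [/(h (s^-1)%g)|/h //]; rewrite !sK.
Qed.

Lemma upd_id c a : upd c a (c a) = c.
Proof. by apply/funext => x; rewrite /upd; case: eqP => // ->. Qed.

Lemma upd_upd c a i j : upd (upd c a i) a j = upd c a j.
Proof. by apply/funext => x; rewrite /upd; case: eqP. Qed.

Lemma updC c a a' i j : a != a' -> upd (upd c a i) a' j = upd (upd c a' j) a i.
Proof.
move=> aa; apply/funext => x; rewrite /upd; case: eqP => // ->.
by rewrite eq_sym (negPf aa).
Qed.

(* The coefficient at (c, d) of E_(i,j) E_(i',j') on the colorings of [0, p). *)
Definition recolor2_count (i j i' j' : nat) (c d : nat -> nat) (p : nat) : nat :=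
  (\sum_(a < p) \sum_(a' < p)
    [&& c a == i, upd c a j a' == i' & d == upd (upd c a j) a' j'])%N.

Definition recolor1_count (i j : nat) (c d : nat -> nat) (p : nat) : nat :=
  (\sum_(a < p) ((c a == i) && (d == upd c a j)))%N.

(** Recolorings at two distinct points commute, so the pairs a <> a' contribute equally to both
    products. The pairs a = a' give the two correction terms, written additively to stay in nat. *)
Lemma recolor2_comm i j i' j' c d p :
  (recolor2_count i j i' j' c d p + (i == j') * recolor1_count i' j c d p =
   recolor2_count i' j' i j c d p + (j == i') * recolor1_count i j' c d p)%N.
Proof.
pose O i j i' j' := (\sum_(a < p) \sum_(a' < p | a' != a)
  [&& c a == i, c a' == i' & d == upd (upd c a j) a' j'])%N.
have split1 i0 j0 i1 j1 : recolor2_count i0 j0 i1 j1 c d p =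
    ((j0 == i1) * recolor1_count i0 j1 c d p + O i0 j0 i1 j1)%N.
  rewrite /recolor2_count /recolor1_count big_distrr -big_split; apply: eq_bigr => a _ /=.
  rewrite (bigD1 a) //=; congr (_ + _)%N.
    by rewrite upd_upd /upd eqxx andbA -mulnb -mulnb -mulnb mulnCA mulnA.
  apply: eq_bigr => a' a'a; congr (nat_of_bool [&& _, _ & _]).
  by rewrite /upd -val_eqE /= in a'a *; rewrite (negPf a'a).
rewrite !split1.
have -> : O i' j' i j = O i j i' j'.
  rewrite /O; rewrite (exchange_big_dep predT) //=; apply: eq_bigr => a _.
  apply: eq_big => a'; first by rewrite eq_sym.
  by move=> a'a; rewrite andbCA (@updC c a' a) // val_eqE eq_sym.
rewrite (eq_sym j' i); set A := ((i == j') * _)%N; set B := (_ * recolor1_count i j' _ _ _)%N.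
lia.
Qed.

Lemma linear_0 (k : fieldType) (U V : lmodType k) (f : U -> V) : linear f -> f 0 = 0.
Proof. by move=> hf; have := hf (-1) 0 0; rewrite scaler0 addr0 scaleN1r addNr. Qed.

Lemma addr_swap (V : zmodType) (a b x y : V) : a + x = b + y -> - b + a = - x + y.
Proof. by move=> e; rewrite -[a](addrK x) e -addrA addKr addrC. Qed.

(** * The operators E_(i,j) as elements of the Schur algebra *)

Section Generators.
Variables (k : fieldType) (char0 : [pchar k] =i pred0).
Variables (n : option nat) (n_gt0 : n != Some 0%N) (t : k).
Local Notation comp := (composition n t).
Local Notation HomX b d := (Hom k (Xset (b : comp)) (Xset (d : comp))).
Local Notation wt_move := (@wt_move k).

Lemma in_range_gt0 j : in_range n j -> (0 < j)%N.
Proof. by case/andP. Qed.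

Lemma recolor_hom_inv (b d : comp) i j :
  (fun p => (recolor i j (col p.1) (col p.2))%:R : k^o) \in @diag_inv k (Xset b) (Xset d).
Proof.
by apply/asboolP => s y x; rewrite /= !col_act // recolor_perm.
Qed.

Definition recolor_hom (i j : nat) (b d : comp) : HomX b d := MkHom (recolor_hom_inv b d i j).

Lemma recolor_homE i j (b d : comp) z x : recolor_hom i j b d (z, x) = (recolor i j (col z) (col x))%:R.
Proof. by []. Qed.

Lemma upd_mem_fixed_seq (b d : comp) (z : Xset d) a i j p : z \in fixed_seq d p -> (a < p)%N ->
  in_range n j -> col z a = i -> wt b = wt_move j i (wt d) ->
  exists2 y : Xset b, y \in fixed_seq b p & col y = upd (col z) a j.
Proof.
move=> hz ap jr za wb; have [b' [y hy]] := exists_upd n_gt0 z a jr.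
have e : b = b'.
  by apply: (wt_inj char0); rewrite (wt_upd n_gt0 (in_range_gt0 jr) hy) za.
subst b'; exists y => //; apply/mem_fixed_seq => //; rewrite hy.
by apply: colors_off_upd => //; apply/mem_fixed_seq.
Qed.

(** A change of variables from the coloring y to the recolored point a: each a of color i gives
    exactly one y, which belongs to X^b because the weights match. *)
Lemma sum_recolor_hom (b d : comp) (z : Xset d) i j p (H : (nat -> nat) -> k) :
  z \in fixed_seq d p -> i != j -> in_range n j -> wt b = wt_move j i (wt d) ->
  \sum_(y <- fixed_seq b p) recolor_hom i j b d (z, y) * H (col y) =
  \sum_(a < p) (col z a == i)%:R * H (upd (col z) a j).
Proof.
move=> hz ij jr wb; have zp := (mem_fixed_seq n_gt0 p z).1 hz.
transitivity (\sum_(y <- fixed_seq b p) \sum_(a < p)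
    ((col z a == i) && (col y == upd (col z) a j))%:R * H (col y)).
  rewrite big_seq [RHS]big_seq; apply: eq_bigr => y /(mem_fixed_seq n_gt0) yp.
  by rewrite recolor_homE (recolor_sum ij zp yp) natr_sum mulr_suml.
rewrite exchange_big; apply: eq_bigr => a _.
have [za|za] := eqVneq (col z a) i; last first.
  by rewrite mul0r big1 // => y _; rewrite mul0r.
have [y hy ye] := upd_mem_fixed_seq hz (ltn_ord a) jr za wb.
rewrite (bigD1_seq y) ?fixed_seq_uniq // -ye eqxx big1 => [|y' y'y]; first exact: addr0.
rewrite (_ : (col y' == col y) = false) ?mul0r //; apply/negbTE.
by apply: contraNneq y'y => /(col_inj n_gt0) ->.
Qed.

(* The component from weight l to weight m of E_(i,j); it is 0 unless both weights
   come from compositions. *)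
Definition gl_elt (i j : nat) (l m : nat -> k) : Schur n t :=
  if pselect (exists bd : comp * comp, wt bd.1 = l /\ wt bd.2 = m) is left e
  then let bd := sval (cid e) in sinj (recolor_hom i j bd.1 bd.2) else 0.

Lemma gl_elt_wt i j (b d : comp) : gl_elt i j (wt b) (wt d) = sinj (recolor_hom i j b d).
Proof.
rewrite /gl_elt; case: pselect => [e|[]]; last by exists (b, d).
case: cid => -[b' d'] /= [/(wt_inj char0) eb /(wt_inj char0) ed].
by subst b' d'.
Qed.

Lemma gl_elt_nonel i j l m : (forall b : comp, wt b <> l) -> gl_elt i j l m = 0.
Proof. by move=> h; rewrite /gl_elt; case: pselect => // e; exfalso; case: e => -[b d] [/h]. Qed.

Lemma gl_elt_noner i j l m : (forall b : comp, wt b <> m) -> gl_elt i j l m = 0.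
Proof. by move=> h; rewrite /gl_elt; case: pselect => // e; exfalso; case: e => -[b d] [_ /h]. Qed.

Definition gl_op i j l := gl_elt i j l (wt_move i j l).

Definition wt_one (l : nat -> k) : Schur n t :=
  if pselect (exists b : comp, wt b = l) is left e
  then Schur_one (sval (cid e)) else 0.

Lemma one_wt (b : comp) : wt_one (wt b) = Schur_one b.
Proof.
rewrite /wt_one; case: pselect => [e|[]]; last by exists b.
by case: cid => b' /= /(wt_inj char0) ->.
Qed.

Lemma one_none l : (forall b : comp, wt b <> l) -> wt_one l = 0.
Proof. by move=> h; rewrite /wt_one; case: pselect => // -[b hb]; case: (h b). Qed.

(** If no composition has the intermediate weight m, the product is 0 by convention; the count is 0
    as well, since recoloring a point of color i in z would produce a composition of weight m. *)
Lemma gl_elt_mul_interp (b d : comp) i j i' j' m : i != j -> i' != j' ->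
  in_range n j -> in_range n j' -> m = wt_move j i (wt d) ->
  exists2 H : HomX b d, Schur_mul (gl_elt i j m (wt d)) (gl_elt i' j' (wt b) m) = sinj H &
    forall z x, interp t (fun p => (recolor2_count i j i' j' (col z) (col x) p)%:R) (H (z, x)).
Proof.
move=> ij ij' jr jr' me.
have [[c ce]|nc] := pselect (exists c : comp, wt c = m); last first.
  exists 0; first by rewrite gl_elt_nonel ?sinj0 => [|c hc];
    [exact: (linear_0 (Schur_mul_linearl char0 n_gt0 _))|by apply: nc; exists c].
  move=> z x; apply: (interp_ext (interp_cst t 0) (N := 0%N)) => p _.
  rewrite /recolor2_count big1 // => a _; rewrite big1 // => a' _; case: eqP => //= za.
  have [c [y hy]] := exists_upd n_gt0 z a jr; case: nc; exists c.
  by rewrite (wt_upd n_gt0 (in_range_gt0 jr) hy) za me.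
exists (perm_comp t (recolor_hom i j c d) (recolor_hom i' j' b c)).
  by rewrite -ce !gl_elt_wt sinj_mul.
move=> z x; have [q [hz hx]] := exists_mem_fixed_seq2 n_gt0 z x.
apply: (interp_ext (interp_comp char0 n_gt0 _ _ z x) (N := q)) => p qp.
have zp := mem_fixed_seqW n_gt0 qp hz; have xp := mem_fixed_seqW n_gt0 qp hx.
have wc : wt c = wt_move j i (wt d) by rewrite ce.
rewrite (sum_recolor_hom (fun c' => (recolor i' j' c' (col x))%:R) zp ij jr wc).
rewrite /recolor2_count natr_sum; apply: eq_bigr => a _.
rewrite (@recolor_sum _ _ _ _ p) //; last 2 first.
- by apply: colors_off_upd => //; apply/mem_fixed_seq.
- by apply/mem_fixed_seq.
rewrite -natrM big_distrr; congr _%:R; apply: eq_bigr => a' _ /=.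
by rewrite mulnb.
Qed.

Lemma interp_recolor1 (b d : comp) i j (z : Xset d) (x : Xset b) : i != j ->
  interp t (fun p => (recolor1_count i j (col z) (col x) p)%:R) (recolor_hom i j b d (z, x)).
Proof.
move=> ij; have [q [hz hx]] := exists_mem_fixed_seq2 n_gt0 z x.
apply: (interp_ext (interp_cst t _) (N := q)) => p qp; rewrite recolor_homE.
by rewrite (@recolor_sum _ _ _ _ p) //; apply/mem_fixed_seq => //; exact: mem_fixed_seqW qp _.
Qed.

(** For i >= 2 the count is eventually constant. For i = 1 it is p minus the support size, whose
    value at t is the first coordinate of the weight; this is how t enters [U7]. *)
Lemma interp_count (d : comp) (z : Xset d) i : (0 < i)%N ->
  interp t (fun p => (\sum_(a < p) (col z a == i))%N%:R) (wt d i).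
Proof.
move=> i0; have [q hq] := col_off n_gt0 z.
have cntE (P : pred nat) p : (\sum_(a < p) P (col z a))%N = count (fun a => P (col z a)) (iota 0 p).
  rewrite -(big_mkord predT (fun a => P (col z a) : nat)) /index_iota subn0.
  by rewrite -sum1_count [RHS]big_mkcond; apply: eq_bigr => a _ /=; case: (P _).
rewrite (wt_col n_gt0 z) [(i == 0)%N]gtn_eqF //; case: eqP => [->|/eqP i1].
  rewrite addrC -mulN1r.
  apply: (interp_ext (interp_lin (-1) (interp_cst t _) (interp_id t)) (N := q)) => p qp.
  rewrite mulN1r (cntE (fun i => i == 1%N)) (@npts_count _ p).
    rewrite addrC -[X in X%:R - _](size_iota 0 p) -(count_predC (fun a => col z a == 1%N)).
    by rewrite natrD addrK.
  by move=> a pa; rewrite hq //; exact: leq_trans qp pa.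
apply: (interp_ext (interp_cst t _) (N := q)) => p qp.
rewrite (cntE (fun j => j == i)) (@npts_count _ p) // => a pa.
by rewrite hq ?(leq_trans qp pa) // eq_sym (negPf i1).
Qed.

Lemma Schur_mul0r (x : Schur n t) : Schur_mul x 0 = 0.
Proof. exact: (linear_0 (Schur_mul_linearr char0 n_gt0 x)). Qed.

Lemma Schur_mul0l (x : Schur n t) : Schur_mul 0 x = 0.
Proof. exact: (linear_0 (Schur_mul_linearl char0 n_gt0 x)). Qed.

Lemma sinjB (b d : comp) (f g : HomX b d) : sinj (f - g) = sinj f - sinj g.
Proof. by have := sinj_linear (-1) g f; rewrite !scaleN1r ![- _ + _]addrC. Qed.

Lemma sinjZ (b d : comp) a (f : HomX b d) : sinj (a *: f) = a *: sinj f.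
Proof. by rewrite -[a *: f]addr0 sinj_linear sinj0 addr0. Qed.

(** The excluded case would involve E_(i,i), which counts the points of color i, whereas
    [recolor_hom] with equal colors has a kernel with values 0 and 1. That case is
    [gl_op_comm_diag]. *)
Lemma gl_op_comm i j i' j' l : i != j -> i' != j' ->
  in_range n i -> in_range n j -> in_range n i' -> in_range n j' ->
  ~~ ((j == i') && (i == j')) ->
  Schur_mul (gl_op i j (wt_move i' j' l)) (gl_op i' j' l) -
  Schur_mul (gl_op i' j' (wt_move i j l)) (gl_op i j l) =
  (j == i')%:R *: gl_op i j' l - (i == j')%:R *: gl_op i' j l.
Proof.
move=> ij ij' ir jr ir' jr' nn; rewrite /gl_op; pose m := wt_move i j (wt_move i' j' l).
rewrite [wt_move i' j' (wt_move i j l)]wt_moveC -/m.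
(* The targets of the right-hand terms agree with m only when the corresponding delta is 1;
   otherwise the term is 0 whatever its target. *)
have e1 : (j == i')%:R *: gl_elt i j' l (wt_move i j' l) = (j == i')%:R *: gl_elt i j' l m.
  by rewrite /m; case: eqP => [<-|_]; rewrite ?scale0r // wt_moveM.
have e2 : (i == j')%:R *: gl_elt i' j l (wt_move i' j l) = (i == j')%:R *: gl_elt i' j l m.
  by case: eqP => [e|_]; rewrite ?scale0r // /m wt_moveC -e wt_moveM.
rewrite e1 e2.
have [[b be]|nb] := pselect (exists b : comp, wt b = l); last first.
  have h u v w : gl_elt u v l w = 0 by apply: gl_elt_nonel => b hb; apply: nb; exists b.
  by rewrite !h !Schur_mul0r !scaler0.
have [[d de]|nd] := pselect (exists d : comp, wt d = m); last first.
  have h u v w : gl_elt u v w m = 0 by apply: gl_elt_noner => d hd; apply: nd; exists d.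
  by rewrite !h !Schur_mul0l !scaler0.
have m1 : wt_move i' j' l = wt_move j i (wt d) by rewrite de /m wt_moveK.
have m2 : wt_move i j l = wt_move j' i' (wt d) by rewrite de /m wt_moveC wt_moveK.
rewrite -be -de in m1 m2 *.
have [H1 -> h1] := gl_elt_mul_interp b ij ij' jr jr' m1.
have [H2 -> h2] := gl_elt_mul_interp b ij' ij jr' jr m2.
rewrite !gl_elt_wt -sinjB -!sinjZ -sinjB; congr sinj; apply: hom_eq => z x.
rewrite addrC -scaleN1r hom_linE [in RHS]addrC -[in RHS]scaleN1r hom_linE.
rewrite -[(j == i')%:R *: _]addr0 -[(i == j')%:R *: _]addr0 !hom_linE !addr0.
have L := interp_lin (-1) (h2 z x) (h1 z x).
have R : interp t (fun p => -1 * ((i == j')%:R * (recolor1_count i' j (col z) (col x) p)%:R) +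
    (j == i')%:R * (recolor1_count i j' (col z) (col x) p)%:R)
    (-1 * ((i == j')%:R * recolor_hom i' j b d (z, x)) + (j == i')%:R * recolor_hom i j' b d (z, x)).
  have I0 (u v : nat) (c : bool) : (c -> u != v) ->
      interp t (fun p => c%:R * (recolor1_count u v (col z) (col x) p)%:R) (c%:R * recolor_hom u v b d (z, x)).
    move=> h; case: c h => h; first by apply: interpZ; apply: interp_recolor1; exact: h.
    rewrite mul0r; apply: (interp_ext (interp_cst t 0) (N := 0%N)) => p _.
    by rewrite mul0r.
  apply: interp_lin; apply: I0 => /eqP e; apply: contraNneq nn => e'.
    by rewrite e e' !eqxx.
  by rewrite e e' !eqxx.
apply: (interp_uniq char0 L R (N := 0%N)) => p _.
rewrite !mulN1r; apply: addr_swap; rewrite -!natrM -!natrD; congr _%:R.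
exact: recolor2_comm.
Qed.

Lemma gl_op_comm_diag i j l : i != j -> in_range n i -> in_range n j ->
  Schur_mul (gl_op i j (wt_move j i l)) (gl_op j i l) -
  Schur_mul (gl_op j i (wt_move i j l)) (gl_op i j l) =
  (l i - l j) *: wt_one l.
Proof.
move=> ij ir jr; rewrite /gl_op !wt_moveK.
have [[b be]|nb] := pselect (exists b : comp, wt b = l); last first.
  have h u v w : gl_elt u v l w = 0 by apply: gl_elt_nonel => b hb; apply: nb; exists b.
  by rewrite one_none ?h ?Schur_mul0r ?scaler0 ?subr0 // => b hb; apply: nb; exists b.
rewrite -be one_wt Schur_oneE.
have ji : j != i by rewrite eq_sym.
have [H1 -> h1] := gl_elt_mul_interp b ij ji jr ir (erefl (wt_move j i (wt b))).
have [H2 -> h2] := gl_elt_mul_interp b ji ij ir jr (erefl (wt_move i j (wt b))).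
rewrite -sinjB -sinjZ; congr sinj; apply: hom_eq => z x.
rewrite addrC -scaleN1r hom_linE -[(wt b i - wt b j) *: _]addr0 hom_linE addr0.
have L := interp_lin (-1) (h2 z x) (h1 z x).
have D := interp_lin (-1) (interp_count z (in_range_gt0 jr)) (interp_count z (in_range_gt0 ir)).
have R := interpZ (if `[< z = x >] then 1 else 0 : k) D.
have e : (if `[< z = x >] then 1 else 0) * (-1 * wt b j + wt b i) =
    (wt b i - wt b j) * perm_id k (Xset b) (z, x) :> k.
  by rewrite mulrC mulN1r addrC /=; case: asboolP.
rewrite -e; apply: (interp_uniq char0 L R (N := 0%N)) => p _.
(* Recoloring from u to u changes nothing, so this term is diagonal and counts the points of color
   u. By [interp_count] the counts for i and j interpolate to the coordinates of the weight. *)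
have E1d u : recolor1_count u u (col z) (col x) p =
    (`[< z = x >] * \sum_(a < p) (col z a == u))%N.
  rewrite /recolor1_count big_distrr; apply: eq_bigr => a _ /=.
  have [za|za] := eqVneq (col z a) u; last by rewrite muln0.
  rewrite -za upd_id muln1 /=; congr nat_of_bool.
  by apply/eqP/asboolP => [/(col_inj n_gt0) ->|->].
have := recolor2_comm i j j i (col z) (col x) p; rewrite !eqxx !mul1n.
rewrite (E1d j) (E1d i) => /(congr1 (fun u => u%:R : k)); rewrite !natrD !natrM.
set A : k := (recolor2_count i j j i _ _ _)%:R; set B : k := (recolor2_count j i i j _ _ _)%:R.
case: asboolP => _ /=; rewrite ?mul1r ?mul0r !mulN1r => eAB.
  exact: addr_swap.
by rewrite (_ : A = B) ?addNr //; move: eAB; rewrite !addr0.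
Qed.

End Generators.

(** * The map psi *)

Section UdotAlgebra.
Variables (k : fieldType) (n : option nat) (t : k).
Local Notation U := (Udot n t).
Local Notation pi := (@Udot_pi k n t).

Lemma Udot_pi_linear a x y : a *: pi x + pi y = pi (tAdd (tScale a x) y).
Proof. by rewrite -Udot_pi_add -Udot_pi_scale. Qed.

Lemma Udot_mul_linearr (x : U) : linear (Udot_mul x : U -> U).
Proof.
move=> a; move: x; elim/Udot_ind=> x; elim/Udot_ind=> y; elim/Udot_ind=> z.
rewrite Udot_pi_linear !Udot_pi_mul Udot_pi_linear; apply/Udot_piP.
apply: teq_trans (teq_mulDr _ _ _) _; apply: teq_add; last exact: teq_refl.
exact: teq_scaleAr.
Qed.

Lemma Udot_mul_linearl (z : U) : linear (fun x : U => Udot_mul x z : U).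
Proof.
move=> a; move: z; elim/Udot_ind=> z; elim/Udot_ind=> x; elim/Udot_ind=> y.
rewrite Udot_pi_linear !Udot_pi_mul Udot_pi_linear; apply/Udot_piP.
apply: teq_trans (teq_mulDl _ _ _) _; apply: teq_add; last exact: teq_refl.
exact: teq_scaleAl.
Qed.

Lemma Udot_mulA : associative (@Udot_mul k n t).
Proof.
elim/Udot_ind=> x; elim/Udot_ind=> y; elim/Udot_ind=> z.
by rewrite !Udot_pi_mul; apply/Udot_piP/teq_mulA.
Qed.

Lemma Udot_delta (P : Prop) (x : U) :
  ((`[< P >] : bool)%:R : k) *: x = if `[< P >] then x else 0.
Proof. by case: asboolP => _; rewrite ?scale1r ?scale0r. Qed.

Local Notation one l := (pi (tOne l)).

Lemma Udot_rel_pi x y : Udot_rel x y -> pi x = pi y.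
Proof. by move=> h; apply/Udot_piP/teq_rel. Qed.

Definition has_decomp (x : U) := exists s : seq (weight n t * U * weight n t),
  x = \sum_(w <- s) Udot_mul (Udot_mul (one w.1.1) w.1.2) (one w.2).

Lemma has_decomp1 l x m : Udot_mul (one l) x = x -> Udot_mul x (one m) = x -> has_decomp x.
Proof. by move=> hl hm; exists [:: (l, x, m)]; rewrite big_seq1 /= hl hm. Qed.

Lemma Udot_mul_sumr (x : U) (I : Type) (s : seq I) (F : I -> U) :
  Udot_mul x (\sum_(i <- s) F i) = \sum_(i <- s) Udot_mul x (F i) :> U.
Proof.
apply: (big_morph (Udot_mul x : U -> U)) => [y z|].
  by have := Udot_mul_linearr x 1 y z; rewrite !scale1r.
exact: (linear_0 (Udot_mul_linearr x)).
Qed.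

Lemma Udot_mul_suml (x : U) (I : Type) (s : seq I) (F : I -> U) :
  Udot_mul (\sum_(i <- s) F i) x = \sum_(i <- s) Udot_mul (F i) x :> U.
Proof.
apply: (big_morph (fun y : U => Udot_mul y x : U)) => [y z|].
  by have := Udot_mul_linearl x 1 y z; rewrite !scale1r.
exact: (linear_0 (Udot_mul_linearl x)).
Qed.

Lemma Udot_has_decomp (x : U) : has_decomp x.
Proof.
elim/Udot_ind: x; elim.
- move=> i l; apply: (@has_decomp1 (l +^ i) _ l); rewrite Udot_pi_mul.
    by rewrite (Udot_rel_pi (U1l i l (l +^ i))) -Udot_pi_scale [LHS]Udot_delta asboolT.
  by rewrite (Udot_rel_pi (U1r i l l)) -Udot_pi_scale [LHS]Udot_delta asboolT.
- move=> i l; apply: (@has_decomp1 l _ (l +^ i)); rewrite Udot_pi_mul.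
    by rewrite (Udot_rel_pi (U2l i l l)) -Udot_pi_scale [LHS]Udot_delta asboolT.
  by rewrite (Udot_rel_pi (U2r i l (l +^ i))) -Udot_pi_scale [LHS]Udot_delta asboolT.
- move=> l; have h : Udot_mul (one l) (one l) = one l.
    by rewrite Udot_pi_mul (Udot_rel_pi (U0 l l)) -Udot_pi_scale [LHS]Udot_delta asboolT.
  exact: (@has_decomp1 l _ l).
- by exists [::]; rewrite big_nil.
- move=> x [r hr] y [s hs]; exists (r ++ s).
  by rewrite big_cat -hr -hs -Udot_pi_add.
- move=> a x [r hr]; exists [seq (w.1.1, a *: w.1.2, w.2) | w <- r].
  rewrite big_map -Udot_pi_scale -[Udot_scale _ _]/(a *: pi x) hr scaler_sumr.
  apply: eq_bigr => -[[l y] m] _ /=.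
  have := linear_0 (Udot_mul_linearr (one l)) => Z0.
  have := Udot_mul_linearr (one l) a y 0; rewrite Z0 !addr0 => ->.
  have := Udot_mul_linearl (one m) a (Udot_mul (one l) y) 0.
  by rewrite (linear_0 (Udot_mul_linearl (one m))) !addr0 => ->.
- move=> x [r hr] y [s hs].
  (* The two inner idempotents are absorbed into the middle factor. *)
  exists [seq (w.1.1.1, Udot_mul (Udot_mul w.1.1.2 (one w.1.2)) (Udot_mul (one w.2.1.1) w.2.1.2), w.2.2)
         | w <- [seq (v, w) | v <- r, w <- s]].
  rewrite big_map big_allpairs -Udot_pi_mul hr Udot_mul_suml.
  apply: eq_bigr => -[[l1 x1] m1] _; rewrite hs Udot_mul_sumr.
  by apply: eq_bigr => -[[l2 x2] m2] _ /=; rewrite !Udot_mulA.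
Qed.

Lemma Udot_locally_unital : locally_unital U.
Proof.
split.
- exact: Udot_mul_linearr.
- exact: Udot_mul_linearl.
- exact: Udot_mulA.
- move=> i j; rewrite /= Udot_pi_mul (Udot_rel_pi (U0 i j)) -Udot_pi_scale.
  exact: Udot_delta.
- exact: Udot_has_decomp.
Qed.

End UdotAlgebra.

(** * The images of the generators satisfy the relations *)

Section Psi.
Variables (k : fieldType) (char0 : [pchar k] =i pred0).
Variables (n : option nat) (n_gt0 : n != Some 0%N) (t : k).
Local Notation comp := (composition n t).
Local Notation HomX b d := (Hom k (Xset (b : comp)) (Xset (d : comp))).
Local Notation wt_move := (@wt_move k).
Local Notation gl_elt := (gl_elt n_gt0 t).
Local Notation gl_op := (gl_op n_gt0 t).
Local Notation wt_one := (@wt_one k n t).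

Lemma Schur_mulDr (x y z : Schur n t) : Schur_mul x (y + z) = Schur_mul x y + Schur_mul x z.
Proof. by have := Schur_mul_linearr char0 n_gt0 x 1 y z; rewrite !scale1r. Qed.

Lemma Schur_mulDl (x y z : Schur n t) : Schur_mul (x + y) z = Schur_mul x z + Schur_mul y z.
Proof. by have := Schur_mul_linearl char0 n_gt0 z 1 x y; rewrite !scale1r. Qed.

Lemma Schur_mulZr a (x y : Schur n t) : Schur_mul x (a *: y) = a *: Schur_mul x y.
Proof.
by have := Schur_mul_linearr char0 n_gt0 x a y 0; rewrite Schur_mul0r // !addr0.
Qed.

Lemma Schur_mulZl a (x y : Schur n t) : Schur_mul (a *: x) y = a *: Schur_mul x y.
Proof.
by have := Schur_mul_linearl char0 n_gt0 y a x 0; rewrite Schur_mul0l // !addr0.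
Qed.

Lemma Schur_mulNr (x y : Schur n t) : Schur_mul x (- y) = - Schur_mul x y.
Proof. by rewrite -scaleN1r Schur_mulZr scaleN1r. Qed.

Lemma Schur_mulNl (x y : Schur n t) : Schur_mul (- x) y = - Schur_mul x y.
Proof. by rewrite -scaleN1r Schur_mulZl scaleN1r. Qed.

Lemma one_mul l m : Schur_mul (wt_one l) (wt_one m) = if `[< l = m >] then wt_one l else 0.
Proof.
have [[b <-]|nb] := pselect (exists b : comp, wt b = l); last first.
  rewrite one_none ?Schur_mul0l ?if_same // => b hb; apply: nb; by exists b.
have [[c <-]|nc] := pselect (exists c : comp, wt c = m); last first.
  rewrite [wt_one m]one_none ?Schur_mul0r ?asboolF // => [e|c hc]; apply: nc; last by exists c.
  by exists b.
rewrite !one_wt // !Schur_oneE; case: asboolP => [/(wt_inj char0) <-|nbc].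
  by rewrite sinj_mul perm_idl.
by rewrite sinj_mul0 //; apply: contra_notN nbc => /eqP ->.
Qed.

Lemma gl_elt_one i j l m m' :
  Schur_mul (gl_elt i j l m) (wt_one m') = if `[< l = m' >] then gl_elt i j l m else 0.
Proof.
have [[b <-]|nb] := pselect (exists b : comp, wt b = l); last first.
  rewrite gl_elt_nonel ?Schur_mul0l ?if_same // => b hb; apply: nb; by exists b.
have [[d <-]|nd] := pselect (exists d : comp, wt d = m); last first.
  rewrite gl_elt_noner ?Schur_mul0l ?if_same // => d hd; apply: nd; by exists d.
have [[c <-]|nc] := pselect (exists c : comp, wt c = m'); last first.
  rewrite one_none ?Schur_mul0r ?asboolF // => [e|c hc]; apply: nc; last by exists c.
  by exists b.
rewrite one_wt // gl_elt_wt // Schur_oneE; case: asboolP => [/(wt_inj char0) <-|nbc].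
  by rewrite sinj_mul perm_idr.
by rewrite sinj_mul0 //; apply: contra_notN nbc => /eqP ->.
Qed.

Lemma one_gl_elt i j l m m' :
  Schur_mul (wt_one m') (gl_elt i j l m) = if `[< m = m' >] then gl_elt i j l m else 0.
Proof.
have [[b <-]|nb] := pselect (exists b : comp, wt b = l); last first.
  rewrite gl_elt_nonel ?Schur_mul0r ?if_same // => b hb; apply: nb; by exists b.
have [[d <-]|nd] := pselect (exists d : comp, wt d = m); last first.
  rewrite gl_elt_noner ?Schur_mul0r ?if_same // => d hd; apply: nd; by exists d.
have [[c <-]|nc] := pselect (exists c : comp, wt c = m'); last first.
  rewrite one_none ?Schur_mul0l ?asboolF // => [e|c hc]; apply: nc; last by exists c.
  by exists d.
rewrite one_wt // gl_elt_wt // Schur_oneE; case: asboolP => [/(wt_inj char0) <-|nbc].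
  by rewrite sinj_mul perm_idl.
by rewrite sinj_mul0 //; apply: contra_notN nbc => /eqP ->.
Qed.

Lemma gl_op_commute i j i' j' l : i != j -> i' != j' ->
  in_range n i -> in_range n j -> in_range n i' -> in_range n j' ->
  j != i' -> i != j' ->
  Schur_mul (gl_op i j (wt_move i' j' l)) (gl_op i' j' l) =
  Schur_mul (gl_op i' j' (wt_move i j l)) (gl_op i j l).
Proof.
move=> ij ij' ir jr ir' jr' h1 h2; apply/eqP; rewrite -subr_eq0; apply/eqP.
rewrite gl_op_comm ?(negPf h1) // (negPf h2) !scale0r subrr //.
Qed.

(** With E = E_(i,j) and F = E_(i',j') the expression is the double commutator [E, [E, F]]. Here
    [E, F] is s times E_(u,v), which commutes with E; the weights only record the components. *)
Lemma serre_of_comm i j i' j' u v (s : k) l :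
  (forall m, Schur_mul (gl_op i j (wt_move i' j' m)) (gl_op i' j' m) -
             Schur_mul (gl_op i' j' (wt_move i j m)) (gl_op i j m) = s *: gl_op u v m) ->
  (forall m, wt_move u v m = wt_move i' j' (wt_move i j m)) ->
  Schur_mul (gl_op i j (wt_move u v l)) (gl_op u v l) =
  Schur_mul (gl_op u v (wt_move i j l)) (gl_op i j l) ->
  Schur_mul (Schur_mul (gl_op i j (wt_move i j (wt_move i' j' l)))
    (gl_op i j (wt_move i' j' l))) (gl_op i' j' l)
  + (- 2%:R) *: Schur_mul (Schur_mul (gl_op i j (wt_move i' j' (wt_move i j l)))
    (gl_op i' j' (wt_move i j l))) (gl_op i j l)
  + Schur_mul (Schur_mul (gl_op i' j' (wt_move i j (wt_move i j l)))
    (gl_op i j (wt_move i j l))) (gl_op i j l) = 0.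
Proof.
move=> cE wE cX; rewrite [wt_move i j (wt_move i' j' l)]wt_moveC.
have A := @Schur_mulA k char0 n n_gt0 t.
have := congr1 (Schur_mul (gl_op i j (wt_move i' j' (wt_move i j l)))) (cE l).
have := congr1 (fun x => Schur_mul x (gl_op i j l)) (cE (wt_move i j l)).
rewrite !(Schur_mulDr, Schur_mulDl, Schur_mulNr, Schur_mulNl, Schur_mulZr, Schur_mulZl).
rewrite -wE cX => <-; rewrite !A wE => /eqP; rewrite subr_eq => /eqP ->.
rewrite scaleNr scaler_nat mulr2n; set x := Schur_mul _ _; set y := Schur_mul _ _.
by rewrite [x - y + x]addrAC [x + x - y - _]addrAC subrr sub0r addNr.
Qed.

(** The inner commutator is E_(i,j') if j = i', and -E_(i',j) if i = j'. *)
Lemma serre i j i' j' l : i != j -> i' != j' ->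
  in_range n i -> in_range n j -> in_range n i' -> in_range n j' ->
  (j == i') (+) (i == j') -> (i != i') -> (j != j') ->
  Schur_mul (Schur_mul (gl_op i j (wt_move i j (wt_move i' j' l)))
    (gl_op i j (wt_move i' j' l))) (gl_op i' j' l)
  + (- 2%:R) *: Schur_mul (Schur_mul (gl_op i j (wt_move i' j' (wt_move i j l)))
    (gl_op i' j' (wt_move i j l))) (gl_op i j l)
  + Schur_mul (Schur_mul (gl_op i' j' (wt_move i j (wt_move i j l)))
    (gl_op i j (wt_move i j l))) (gl_op i j l) = 0.
Proof.
move=> ij ij' ir jr ir' jr'; have [<-|ji'] := eqVneq j i'; rewrite /=.
  move=> ni _ jj'; apply: (@serre_of_comm _ _ _ _ i j' 1) => [m|m|].
  - by rewrite gl_op_comm // eqxx // (negPf ni) scale0r subr0.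
  - by rewrite wt_moveC wt_moveM.
  - by apply: gl_op_commute; rewrite // eq_sym.
move=> /eqP e ii' _; subst j'; apply: (@serre_of_comm _ _ _ _ i' j (-1)) => [m|m|].
- by rewrite gl_op_comm // eqxx // (negPf ji') // scale0r scale1r sub0r scaleN1r.
- by rewrite wt_moveM.
- by apply: gl_op_commute; rewrite // eq_sym.
Qed.

(** [gl_op] is indexed by its source and [tF i l] by its target, whence the shifted weight for
    [tF]. *)
Fixpoint term_eval (x : term n t) : Schur n t :=
  match x with
  | tE i l => gl_op (sval i) (sval i).+1 l
  | tF i l => gl_op (sval i).+1 (sval i) (l +^ i)
  | tOne l => wt_one l
  | tZero => 0
  | tAdd x y => term_eval x + term_eval y
  | tScale a x => a *: term_eval x
  | tMul x y => Schur_mul (term_eval x) (term_eval y)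
  end.

Lemma weight_eq (l m : weight n t) : weight_val l = weight_val m -> l = m.
Proof. by case: l m => l hl [m hm] /= e; subst m; congr Weight; exact: Prop_irrelevance. Qed.

Lemma shift1E (l : weight n t) (i : root_idx n) :
  weight_val (l +^ i) = wt_move (sval i) (sval i).+1 l.
Proof.
by apply/funext => x; rewrite /= /alpha /wt_move mul1r rmorphB /= !rmorph_nat addrA.
Qed.

Lemma shiftN1E (l : weight n t) (i : root_idx n) :
  weight_val (l -^ i) = wt_move (sval i).+1 (sval i) l.
Proof.
by apply/funext => x; rewrite /= /alpha /wt_move mulN1r opprB rmorphB /= !rmorph_nat addrA.
Qed.

Arguments weight_val : simpl never.

Lemma root_rangel (i : root_idx n) : in_range n (sval i).
Proof. by case/andP: (root_idx_range i). Qed.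

Lemma root_ranger (i : root_idx n) : in_range n (sval i).+1.
Proof. by case/andP: (root_idx_range i). Qed.

Lemma Schur_delta (P Q : Prop) (x : Schur n t) : (P <-> Q) ->
  (if `[< P >] then x else 0) = ((`[< Q >] : bool)%:R : k) *: x.
Proof. by move=> /asbool_equiv_eq ->; case: asboolP => _; rewrite ?scale1r ?scale0r. Qed.

Lemma weight_eqE (l m : weight n t) : (weight_val l = weight_val m) <-> (l = m).
Proof. by split=> [/weight_eq|->]. Qed.

Lemma term_eval_rel (x y : term n t) : Udot_rel x y -> term_eval x = term_eval y.
Proof.
have rl := root_rangel; have rr := root_ranger.
have nS m : m != m.+1 by rewrite neq_ltn ltnSn.
have nS' m : m.+1 != m by rewrite eq_sym.
case=> {x y}.
- move=> l m /=; rewrite one_mul; apply: Schur_delta; exact: weight_eqE.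
- move=> i l m /=; rewrite gl_elt_one; apply: Schur_delta; exact: weight_eqE.
- by move=> i l m /=; rewrite /gl_op one_gl_elt; apply: Schur_delta; rewrite -shift1E; exact: weight_eqE.
- by move=> i l m /=; rewrite gl_elt_one; apply: Schur_delta; exact: weight_eqE.
- move=> i l m /=; rewrite /gl_op one_gl_elt; apply: Schur_delta.
  by rewrite shift1E wt_moveK; exact: weight_eqE.
- move=> i j l ad; rewrite [LHS]/= [RHS]/= !shift1E; apply: serre => //.
  + by case: ad => <-; rewrite eqxx ?addbT; [rewrite /= neq_ltn; lia | apply/negP; lia].
  + by apply/negP => /eqP; case: ad; lia.
  + by apply/negP => /eqP; case: ad; lia.
- move=> i j l ad; rewrite [LHS]/= [RHS]/= !shift1E.
  have C := wt_moveC (sval i) (sval i).+1 (sval j) (sval j).+1; rewrite !C.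
  (* The relation [U4] is the Serre relation for E_(i+1,i) and E_(j+1,j) read from its source L, the
     weight l + 2 alpha_i + alpha_j. *)
  set L := wt_move (sval j) _ (wt_move (sval i) _ (wt_move (sval i) _ l)).
  have := @serre (sval i).+1 (sval i) (sval j).+1 (sval j) L.
  have e1 : wt_move (sval j).+1 (sval j) L = wt_move (sval i) (sval i).+1 (wt_move (sval i) (sval i).+1 l).
    by rewrite wt_moveK.
  have e2 : wt_move (sval i).+1 (sval i) L = wt_move (sval j) (sval j).+1 (wt_move (sval i) (sval i).+1 l).
    by rewrite /L wt_moveC wt_moveK.
  rewrite e1 e2 !wt_moveK [wt_move (sval i).+1 _ (wt_move (sval j) _ _)]wt_moveC wt_moveK.
  apply=> //.
  + by case: ad => e; rewrite -e eqxx ?addbT //=; lia.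
  + by apply/negP => /eqP; case: ad; lia.
  + by apply/negP => /eqP; case: ad; lia.
- move=> i j l ad; rewrite [LHS]/= [RHS]/= !shift1E; apply: gl_op_commute => //.
  + by apply/negP => /eqP e; apply: ad; left.
  + by apply/negP => /eqP e; apply: ad; right.
- move=> i j l ad; rewrite [LHS]/= [RHS]/= !shift1E.
  rewrite [wt_move (sval i) _ (wt_move (sval j) _ l)]wt_moveC; set L := wt_move (sval j) _ _.
  have := @gl_op_commute (sval i).+1 (sval i) (sval j).+1 (sval j) L.
  have -> : wt_move (sval j).+1 (sval j) L = wt_move (sval i) (sval i).+1 l by rewrite wt_moveK.
  have -> : wt_move (sval i).+1 (sval i) L = wt_move (sval j) (sval j).+1 l by rewrite /L wt_moveC wt_moveK.
  apply=> //.
  + by apply/negP => /eqP e; apply: ad; right.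
  + by apply/negP => /eqP e; apply: ad; left.
- move=> i j l; rewrite [LHS]/= [RHS]/= scaleN1r !(shift1E, shiftN1E) !wt_moveK.
  case: asboolP => [<-|ij].
    by rewrite mul1r -gl_op_comm_diag.
  (* For i <> j the operators E_(i,i+1) and E_(j+1,j) commute even when i and j are adjacent, as
     neither i + 1 = j + 1 nor i = j. *)
  have nij : sval i != sval j by apply: contra_notN ij => /eqP; exact: eq_sig_hprop.
  rewrite mul0r scale0r; apply/eqP; rewrite subr_eq0; apply/eqP.
  by apply: gl_op_commute; rewrite // eqSS.
Qed.

Lemma term_eval_eq (x y : term n t) : term_eq x y -> term_eval x = term_eval y.
Proof.
elim=> {x y} //=.
- exact: term_eval_rel.
- by move=> x y z _ -> _ ->.
- by move=> x x' y y' _ -> _ ->.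
- by move=> a x x' _ ->.
- by move=> x x' y y' _ -> _ ->.
- by move=> x y z; rewrite addrA.
- by move=> x y; rewrite addrC.
- by move=> x; rewrite add0r.
- by move=> x; rewrite scaleN1r addNr.
- by move=> a b x; rewrite scalerA.
- by move=> x; rewrite scale1r.
- by move=> a x y; rewrite scalerDr.
- by move=> a b x; rewrite scalerDl.
- by move=> x y z; rewrite Schur_mulA.
- by move=> x y z; rewrite Schur_mulDl.
- by move=> x y z; rewrite Schur_mulDr.
- by move=> a x y; rewrite Schur_mulZl.
- by move=> a x y; rewrite Schur_mulZr.
Qed.

Definition psi (x : Udot n t) : Schur n t := term_eval (Udot_repr x).

Lemma psi_pi x : psi (Udot_pi x) = term_eval x.
Proof. by apply: term_eval_eq; exact: Udot_repr_pi. Qed.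

Lemma psi_lu_map : lu_map psi.
Proof.
split.
- exact: Udot_locally_unital.
- exact: Schur_locally_unital.
- move=> a; elim/Udot_ind=> x; elim/Udot_ind=> y.
  by rewrite Udot_pi_linear !psi_pi.
- by elim/Udot_ind=> x; elim/Udot_ind=> y; rewrite /= Udot_pi_mul !psi_pi.
- move=> l; rewrite /= psi_pi /=.
  have [[b hb]|nb] := pselect (exists b : comp, wt b = weight_val l).
    by right; exists b; rewrite -hb one_wt.
  by left; apply: one_none => b hb; apply: nb; exists b.
Qed.

End Psi.

(** * Surjectivity *)

Section Surjectivity.
Variables (k : fieldType) (char0 : [pchar k] =i pred0).
Variables (n : option nat) (n_gt0 : n != Some 0%N) (t : k).
Local Notation comp := (composition n t).
Local Notation HomX b d := (Hom k (Xset (b : comp)) (Xset (d : comp))).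
Local Notation wt_move := (@wt_move k).
Local Notation gl_op := (gl_op n_gt0 t).
Local Notation term_eval := (@term_eval k n n_gt0 t).

Definition in_image (y : Schur n t) := exists x : term n t, term_eval x = y.

Lemma image0 : in_image 0.
Proof. by exists (tZero n t). Qed.

Lemma image_lin a x y : in_image x -> in_image y -> in_image (a *: x + y).
Proof. by move=> [u <-] [v <-]; exists (tAdd (tScale a u) v). Qed.

Lemma imageB x y : in_image x -> in_image y -> in_image (x - y).
Proof. by move=> hx hy; rewrite addrC -scaleN1r; exact: image_lin. Qed.

Lemma imageM x y : in_image x -> in_image y -> in_image (Schur_mul x y).
Proof. by move=> [u <-] [v <-]; exists (tMul u v). Qed.

Lemma wt_weight (b : comp) : is_weight n t (wt b).
Proof.
have [K hK] := parts_bound b; split.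
- apply: sub_finite_set (finite_II (maxn 2 K)) => i /=; apply: contraNT.
  rewrite -leqNgt geq_max => /andP[i2 Ki].
  by rewrite /wt gtn_eqF // hK.
- move=> i ni; rewrite /wt; case: eqP ni => [->|_ ni]; first by rewrite in_range1.
  by rewrite parts_range // (negPf ni) andbF.
- by rewrite /wt eqxx; exact: comp1_int.
- by move=> i i2; rewrite /wt gtn_eqF //; exists (parts b i)%:Z.
Qed.

Lemma image_one (b : comp) : in_image (Schur_one b).
Proof. by exists (tOne (Weight (wt_weight b))); exact: one_wt. Qed.

Lemma image_gl_op_succ i l : in_range n i -> in_range n i.+1 ->
  in_image (gl_op i i.+1 l) /\ in_image (gl_op i.+1 i l).
Proof.
move=> ir ir'.
have [[b <-]|nb] := pselect (exists b : comp, wt b = l); last first.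
  by rewrite /gl_op !gl_elt_nonel; [split; exact: image0|..] => b hb; apply: nb; exists b.
have ri : (0 < i)%N && (if n is Some m then (i < m)%N else true).
  by move: ir ir'; rewrite /in_range; case: n => [m|] /andP[-> _].
pose r : root_idx n := exist _ i ri; pose w := Weight (wt_weight b).
split; first by exists (tE r w).
exists (tF r (w -^ r)); rewrite -[LHS]/(gl_op i.+1 i (w -^ r +^ r)).
by rewrite shift1E shiftN1E wt_moveK.
Qed.

Lemma in_rangeW i j : (0 < i)%N -> (i <= j)%N -> in_range n j -> in_range n i.
Proof. by rewrite /in_range => -> ij /andP[_]; case: n => // m; exact: leq_trans. Qed.

(** E_(a,c) is the commutator of E_(a,m) and E_(m,c), so induction on the difference of the indices
    starts from the images of the generators. *)
Lemma image_gl_op i j l : i != j -> in_range n i -> in_range n j -> in_image (gl_op i j l).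
Proof.
have comm a m c l' : a != m -> m != c -> a != c -> in_range n a -> in_range n m -> in_range n c ->
    (forall l, in_image (gl_op a m l)) -> (forall l, in_image (gl_op m c l)) -> in_image (gl_op a c l').
  move=> am mc ac ar mr cr h1 h2.
  have := @gl_op_comm k char0 n n_gt0 t a m m c l' am mc ar mr mr cr.
  rewrite eqxx (negPf ac) scale1r scale0r subr0 => <- //.
  by apply: imageB; apply: imageM.
have far d : forall a l', in_range n a -> in_range n (a + d.+1) ->
    in_image (gl_op a (a + d.+1) l') /\ in_image (gl_op (a + d.+1) a l').
  elim: d => [|d IH] a l' ar cr; first by rewrite addn1 in cr *; exact: image_gl_op_succ.
  have mr : in_range n a.+1 by apply: in_rangeW cr; lia.
  rewrite -addSnnS in cr *.
  have ne : [/\ a != a.+1, a.+1 != (a.+1 + d.+1)%N & a != (a.+1 + d.+1)%N] by split; lia.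
  case: ne => n1 n2 n3; split; apply: (@comm _ a.+1) => //; rewrite 1?eq_sym // => l0.
  - exact: (image_gl_op_succ l0 ar mr).1.
  - exact: (IH a.+1 l0 mr cr).1.
  - exact: (IH a.+1 l0 mr cr).2.
  - exact: (image_gl_op_succ l0 ar mr).2.
move=> ij ir jr; case: (ltngtP i j) ij => // lt _.
  have -> : j = (i + (j - i).-1.+1)%N by lia.
  by apply: (far _ _ _ ir _).1; rewrite (_ : (i + _)%N = j) //; lia.
have -> : i = (j + (i - j).-1.+1)%N by lia.
by apply: (far _ _ _ jr _).2; rewrite (_ : (j + _)%N = i) //; lia.
Qed.

(** * Hamming distance between colorings, and orbits of pairs *)

Definition dist (c d : nat -> nat) : nat := npts (fun a => c a != d a).

Lemma dist_perm c d (s : Sinf) : dist (c \o s) (d \o s) = dist c d.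
Proof. exact: (npts_perm (fun a => c a != d a)). Qed.

Lemma dist_upd c d p a j : colors_off c p -> colors_off d p ->
  (dist (upd c a j) d + (c a != d a) = dist c d + (j != d a))%N.
Proof.
move=> cp dp; have := @npts_off (fun x => upd c a j x != d x) (fun x => c x != d x) (maxn p a.+1) a.
rewrite [upd c a j a]/upd eqxx; apply=> x; first 2 last.
- by rewrite /upd => /negPf ->.
- by rewrite geq_max => /andP[px ax]; rewrite /upd (gtn_eqF ax) cp // dp // eqxx.
- by rewrite geq_max => /andP[px _]; rewrite cp // dp // eqxx.
Qed.

Lemma dist0_eq c d p : colors_off c p -> colors_off d p -> dist c d = 0%N -> c = d.
Proof.
move=> cp dp; rewrite /dist (@npts_count _ p) => [|a pa]; last by rewrite cp // dp // eqxx.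
move=> /eqP; rewrite -leqn0 leqNgt -has_count => /hasPn h; apply/funext => a.
have [pa|ap] := leqP p a; first by rewrite cp // dp.
by have := h a; rewrite mem_iota ap => /(_ isT); rewrite negbK => /eqP.
Qed.

Lemma exists_off2 (b c : comp) (z : Xset b) (x : Xset c) :
  exists p, colors_off (col z) p /\ colors_off (col x) p.
Proof.
have [p [/(mem_fixed_seq n_gt0) hz /(mem_fixed_seq n_gt0) hx]] := exists_mem_fixed_seq2 n_gt0 z x.
by exists p.
Qed.

Lemma act_transitive (b : comp) (y z : Xset b) : exists s : Sinf, act s y = z.
Proof.
have : [set act s y | s in setT] z.
  case: (svalP y) => u yu; case: (svalP z) => v zv.
  exists (v * u^-1)%g => //; apply: coset_eq.
  by rewrite /= yu zv -lcosetM -mulgA mulVg mulg1.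
by move=> [s _ <-]; exists s.
Qed.

(** The points where z or x has a color other than 1 are at most [supp_size d + supp_size b] in
    number; s gathers them in an initial segment. So finitely many pairs represent all orbits. *)
Lemma move_small (b d : comp) (z : Xset d) (x : Xset b) :
  exists s : Sinf, act s z \in fixed_seq d (supp_size d + supp_size b) /\
    act s x \in fixed_seq b (supp_size d + supp_size b).
Proof.
have [p [zp xp]] := exists_off2 z x.
pose P a := (col z a != 1%N) || (col x a != 1%N).
have Pp a : (p <= a)%N -> P a = false by move=> pa; rewrite /P zp // xp.
pose r := npts P.
have rM : (r <= supp_size d + supp_size b)%N.
  rewrite -(npts_col_supp_size n_gt0 z) -(npts_col_supp_size n_gt0 x) /r.
  rewrite !(@npts_count _ p) => [|a /xp ->|a /zp ->|//] //.
  by rewrite -count_predUI (leq_trans _ (leq_addr _ _)) // sub_count.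
have rp : (r <= p)%N.
  by rewrite /r (@npts_count _ p) // -[X in (_ <= X)%N](size_iota 0) count_size.
have pe : perm_eq (map P (iota 0 p)) (map (fun a => (a < r)%N) (iota 0 p)).
  apply: (@perm_eq_count_off _ false); first by rewrite !size_map.
  case=> // _; rewrite !count_map.
  rewrite (@eq_count _ _ P) => [|a /=]; last by case: (P a).
  rewrite -(@npts_count P) // -/r (_ : iota 0 p = iota 0 r ++ iota r (p - r)); last first.
    by rewrite -iotaD; congr iota; lia.
  rewrite count_cat (@eq_in_count _ _ predT) ?count_predT ?size_iota; last first.
    by move=> a; rewrite mem_iota /= => ->.
  rewrite (@eq_in_count _ _ pred0) ?count_pred0 ?addn0 //.
  by move=> a; rewrite mem_iota /= => /andP[h _]; rewrite ltnNge h.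
have [u up uP] := Sinf_of_perm_eq pe.
have hP a : (supp_size d + supp_size b <= a)%N -> P ((u^-1)%g a) = false.
  move=> Ma; have [pa|ap] := leqP p ((u^-1)%g a); first exact: Pp.
  by rewrite uP // SinfVK ltnNge (leq_trans rM).
exists u; split; apply/(mem_fixed_seq n_gt0) => a /hP; rewrite col_act // /P /=.
  by case: eqP.
by case: (col x _ =P 1%N) => //; rewrite orbT.
Qed.

Lemma orbit_inv (X Y : perm_set) (y0 : Y) (x0 : X) :
  (fun p => (`[< exists s, p.1 = act s y0 /\ p.2 = act s x0 >] : bool)%:R : k^o)
    \in @diag_inv k X Y.
Proof.
apply/asboolP => s y x; congr (nat_of_bool _)%:R; apply/asbool_equiv_eq => /=.
split=> [[u [e1 e2]]|[u [-> ->]]]; last by exists (s * u)%g; rewrite !actM.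
by exists (s^-1 * u)%g; rewrite !actM -e1 -e2 !actK.
Qed.

Definition orbit_hom (X Y : perm_set) (y0 : Y) (x0 : X) : Hom k X Y :=
  MkHom (orbit_inv y0 x0).

Lemma orbit_homE (X Y : perm_set) (y0 : Y) (x0 : X) y x :
  orbit_hom y0 x0 (y, x) = (`[< exists s, y = act s y0 /\ x = act s x0 >] : bool)%:R.
Proof. by []. Qed.

Lemma image_recolor_hom i j (b d : comp) : i != j -> in_range n i -> in_range n j ->
  wt d = wt_move i j (wt b) -> in_image (sinj (recolor_hom n_gt0 i j b d)).
Proof.
move=> ij ir jr e; have := @image_gl_op i j (wt b) ij ir jr.
by rewrite /gl_op -e gl_elt_wt.
Qed.

(** * Peeling one point of disagreement off an orbit *)

Section Peel.
Variables (b c d : comp) (z0 : Xset d) (x0 : Xset b) (y0 : Xset c) (a0 : nat).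
Variables (ne0 : col z0 a0 != col x0 a0) (y0E : col y0 = upd (col z0) a0 (col x0 a0)).

Let i0 := col z0 a0.
Let j0 := col x0 a0.
Let g : HomX b d := perm_comp t (recolor_hom n_gt0 i0 j0 c d) (orbit_hom y0 x0).

Lemma peel_dist : dist (col z0) (col x0) = (dist (col y0) (col x0)).+1.
Proof.
have [p [zp xp]] := exists_off2 z0 x0.
have := dist_upd a0 (col x0 a0) zp xp.
by rewrite -y0E ne0 eqxx addn1 addn0.
Qed.

Lemma peel_neq0 z x : g (z, x) != 0 -> exists a s,
  [/\ col z a = i0, col (act s y0) = upd (col z) a j0 & x = act s x0].
Proof.
move=> gz; have [y] : exists y, recolor_hom n_gt0 i0 j0 c d (z, y) * orbit_hom y0 x0 (y, x) != 0 :> k.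
  apply: contrapT => h; move/eqP: gz; apply; rewrite /g perm_compE -[RHS](integral0 t (Xset c)).
  congr (integral t _); apply/funext => y; apply/eqP/negPn/negP => h'; apply: h.
  by exists y.
rewrite recolor_homE orbit_homE; case: asboolP => [[s [ys xs]]|_]; last by rewrite mulr0 eqxx.
rewrite mulr1; case: (boolP (recolor _ _ _ _)) => [/asboolP[a [za ya]] _|]; last by rewrite eqxx.
by exists a, s; rewrite -ys.
Qed.

Lemma peel_le z x : g (z, x) != 0 -> (dist (col z) (col x) <= (dist (col y0) (col x0)).+1)%N.
Proof.
move=> /peel_neq0[a [s [za ya ->]]].
have [p [zp xp]] := exists_off2 z (act s x0).
have := dist_upd a j0 zp xp; rewrite -ya !col_act // dist_perm => e.
apply: leq_trans (leq_addr (j0 != (col x0 \o s^-1%g) a) _) _.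
by rewrite -e -addn1 leq_add2l leq_b1.
Qed.

(** At maximal distance the recoloring must have destroyed an agreement, so x has color j0 at a.
    Then a1 = s^-1 a and a0 both have color j0 in y0 and in x0, and their transposition T fixes both
    colorings. Replacing s by s T sends a0 to a, and undoing the recolorings gives z = s T z0. *)
Lemma peel_orbit z x : g (z, x) != 0 -> dist (col z) (col x) = (dist (col y0) (col x0)).+1 ->
  exists s, z = act s z0 /\ x = act s x0.
Proof.
move=> /peel_neq0[a [s [za ya ->]]] e.
have [p [zp xp]] := exists_off2 z (act s x0).
have xa : col (act s x0) a = j0.
  have := dist_upd a j0 zp xp; rewrite -ya e !col_act // dist_perm.
  by case: eqP => _; case: eqP => //= _; lia.
pose a1 := (s^-1)%g a.
have y0a1 : col y0 a1 = j0.
  have := congr1 (fun f => f a) ya; by rewrite col_act // /upd eqxx.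
have x0a1 : col x0 a1 = j0 by rewrite col_act // in xa.
have y0a0 : col y0 a0 = j0 by rewrite y0E /upd eqxx.
pose T := SInf (@transpK a0 a1) (@transpK a0 a1).
have Tfix f : f a0 = f a1 -> f \o (T^-1)%g = f.
  move=> fe; apply/funext => x' /=; rewrite /transp.
  by case: eqP => [->|_] //; case: eqP => [->|].
exists (s * T)%g; split; apply: (col_inj n_gt0); last first.
  by rewrite !actM !col_act // (Tfix _ (col x0)) // x0a1.
rewrite actM !col_act //.
have -> : col z0 = upd (col y0) a0 i0 by rewrite y0E upd_upd upd_id.
rewrite upd_perm invgK Tfix ?y0a0 // upd_perm invgK.
rewrite -col_act // ya.
have -> : s (T a0) = a by rewrite /= /transp eqxx /a1 /= sinvK.
by rewrite upd_upd -za upd_id.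
Qed.

(** Every contributing y is closer to x0 than z0 is, so the recolored point is one where z0 and x0
    differ, and it lies below q. The integrand is therefore finitely supported and the integral is a
    positive integer, with y0 among the points counted. *)
Lemma peel_self : g (z0, x0) != 0.
Proof.
have [q [hz hx]] := exists_mem_fixed_seq2 n_gt0 z0 x0.
have zq := (mem_fixed_seq n_gt0 q z0).1 hz; have xq := (mem_fixed_seq n_gt0 q x0).1 hx.
have qlt a : col z0 a != col x0 a -> (a < q)%N.
  by move=> h; rewrite ltnNge; apply/negP => qa; rewrite zq // xq // eqxx in h.
have hinv := hom_inv_from n_gt0 (recolor_hom n_gt0 i0 j0 c d) (orbit_hom y0 x0) hz hx.
rewrite /g perm_compE (integral_finsupp char0 n_gt0 hinv); last first.
  move=> y; rewrite recolor_homE orbit_homE; case: asboolP => [[s [ys xs]]|_]; last by rewrite mulr0 eqxx.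
  case: (boolP (recolor _ _ _ _)) => [/asboolP[a [za ya]] _|]; last by rewrite mul0r eqxx.
  have dy : dist (col y) (col x0) = dist (col y0) (col x0).
    by rewrite -(dist_perm (col y0) (col x0) (s^-1)%g) -!col_act // -ys -xs.
  have := dist_upd a j0 zq xq; rewrite -ya dy peel_dist => e.
  apply/(mem_fixed_seq n_gt0); rewrite ya; apply: colors_off_upd => //; apply: qlt.
  by move: e; case: eqP => //=; lia.
rewrite (eq_bigr (fun y => (recolor i0 j0 (col z0) (col y) &&
    `[< exists s, y = act s y0 /\ x0 = act s x0 >] : nat)%:R)); last first.
  by move=> y _; rewrite recolor_homE orbit_homE -mulnb natrM.
rewrite -natr_sum; apply: natr_neq0 => //.
have hy0 : y0 \in fixed_seq c q.
  by apply/(mem_fixed_seq n_gt0); rewrite y0E; apply: colors_off_upd => //; exact: qlt.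
rewrite (bigD1_seq y0) ?fixed_seq_uniq // addn_gt0; apply/orP; left.
rewrite lt0b; apply/andP; split; first by apply/asboolP; exists a0.
by apply/asboolP; exists 1%g; rewrite !act1.
Qed.

Lemma peel_image : in_image (sinj (orbit_hom y0 x0)) -> in_image (sinj g).
Proof.
move=> h; rewrite /g -sinj_mul; apply: imageM => //.
apply: image_recolor_hom; rewrite ?col_range //.
rewrite (wt_upd n_gt0 _ y0E) ?wt_moveK //; exact: in_range_gt0 (col_range n_gt0 x0 a0).
Qed.

End Peel.

(** The action on X^b is transitive, so an invariant function is constant on the diagonal. *)
Lemma hom_diag (b : comp) (F : HomX b b) :
  (forall z x, F (z, x) != 0 -> z = x) -> exists a : k, F = a *: perm_id k (Xset b).
Proof.
move=> hF; have [z0 _] : exists z0 : Xset b, True.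
  by exists (exist _ (lcoset 1%g (young b)) (ex_intro _ 1%g erefl)).
exists (F (z0, z0)); apply: hom_eq => z x.
rewrite -[_ *: _]addr0 hom_linE addr0 /=; case: asboolP => [<-|zx].
  by have [s <-] := act_transitive z0 z; rewrite homE mulr1.
by rewrite mulr0; apply/eqP; apply: contra_notT zx => /hF.
Qed.

(* Induction on D, and then on the number of pairs at distance D + 1 in the support
   of F, among finitely many orbit representatives. *)
Lemma image_of_dist D (b d : comp) (F : HomX b d) :
  (forall z x, F (z, x) != 0 -> (dist (col z) (col x) <= D)%N) -> in_image (sinj F).
Proof.
elim: D b d F => [|D IHD] b d F hF.
  have [->|F0] := eqVneq F 0; first by rewrite sinj0; exact: image0.
  have eqc z x : F (z, x) != 0 -> col z = col x.
    have [p [zp xp]] := exists_off2 z x.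
    by move=> /hF; rewrite leqn0 => /eqP; exact: dist0_eq zp xp.
  have [[z [x Fzx]]|nF] := pselect (exists z x, F (z, x) != 0); last first.
    by case/eqP: F0; apply: hom_eq => z x; apply/eqP/negPn/negP => h; apply: nF; exists z, x.
  have e := wt_eq char0 n_gt0 (eqc _ _ Fzx); subst d.
  have [a ->] : exists a, F = a *: perm_id k (Xset b).
    by apply: hom_diag => z' x' /eqc; exact: col_inj.
  by rewrite sinjZ -[_ *: _]addr0; apply: image_lin; [exact: image_one|exact: image0].
(* By [move_small] every orbit of pairs meets the square of this size, so if no bad pair is found
   there, F has none at all. *)
pose M := (supp_size d + supp_size b)%N.
pose bad (F : HomX b d) z x := (F (z, x) != 0) && (dist (col z) (col x) == D.+1).
pose N F := (\sum_(z <- fixed_seq d M) \sum_(x <- fixed_seq b M) bad F z x)%N.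
have [m] := ubnP (N F); elim: m F hF => // m IHm F hF; rewrite ltnS => Nm.
have [[z0 [x0 [hz hx /andP[F0 /eqP d0]]]]|nobad] :=
    pselect (exists z x, [/\ z \in fixed_seq d M, x \in fixed_seq b M & bad F z x]); last first.
  apply: IHD => z x Fzx; have := hF z x Fzx; rewrite leq_eqVlt => /orP[|//].
  move=> dzx; exfalso; apply: nobad; have [s [sz sx]] := move_small z x.
  exists (act s z), (act s x); split=> //; rewrite /bad homE Fzx.
  by rewrite !col_act // dist_perm.
have [a0 ne0] : exists a, col z0 a != col x0 a.
  apply: contrapT => h; have : dist (col z0) (col x0) = 0%N; last by rewrite d0.
  rewrite /dist (@npts_count _ 0) // => a _; apply/negbTE/negP => ne; apply: h.
  by exists a.
have [c [y0 y0E]] := exists_upd n_gt0 z0 a0 (col_range n_gt0 x0 a0).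
have dy0 : (dist (col y0) (col x0)).+1 = D.+1 by rewrite -(peel_dist ne0 y0E).
have [dyD] := dy0.
pose g : HomX b d := perm_comp t (recolor_hom n_gt0 (col z0 a0) (col x0 a0) c d) (orbit_hom y0 x0).
have gIm : in_image (sinj g).
  apply: (peel_image ne0 y0E); apply: IHD => y x; rewrite orbit_homE.
  case: asboolP => [[s [-> ->]] _|]; last by rewrite eqxx.
  by rewrite !col_act // dist_perm dyD.
have g0 : g (z0, x0) != 0 := peel_self ne0 y0E.
pose r := F (z0, x0) / g (z0, x0) : k.
pose F' : HomX b d := (- r) *: g + F.
have F'E z x : F' (z, x) = - r * g (z, x) + F (z, x) :> k by exact: hom_linE.
have F'0 : F' (z0, x0) = 0 by rewrite F'E mulNr divfK // addNr.
(* At distance D + 1 the support of g is within the orbit of (z0, x0), where F does not vanish;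
   subtracting a multiple of g creates no new bad pair. *)
have F'sub z x : bad F' z x -> bad F z x.
  move=> /andP[h dzx]; rewrite /bad dzx andbT.
  apply: contraNneq h => Fzx; rewrite F'E Fzx addr0 mulf_eq0 orbC.
  apply/orP; left; apply/negPn/negP => gzx.
  have [s [zs xs]] := peel_orbit ne0 y0E gzx (etrans (eqP dzx) (esym dy0)).
  by move: F0; rewrite -(homE F s) -zs -xs Fzx eqxx.
have -> : F = r *: g + F' by rewrite /F' addrA scaleNr addrN add0r.
rewrite sinj_linear; apply: image_lin => //; apply: IHm.
  move=> z x; rewrite F'E; have [->|/hF //] := eqVneq (F (z, x)) 0.
  rewrite addr0 mulf_eq0 negb_or => /andP[_ gzx].
  by rewrite -dy0; exact: (peel_le gzx).
apply: leq_trans Nm; rewrite /N (bigD1_seq z0) ?fixed_seq_uniq //.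
rewrite [X in (_ < X)%N](bigD1_seq z0) ?fixed_seq_uniq //.
rewrite -addSn; apply: leq_add; last by apply: leq_sum => z _; apply: leq_sum => x _;
  case: (bad F' z x) (F'sub z x) => // ->.
rewrite (bigD1_seq x0) ?fixed_seq_uniq // [X in (_ < X)%N](bigD1_seq x0) ?fixed_seq_uniq //.
have -> : bad F' z0 x0 = false by rewrite /bad F'0 eqxx.
have -> : bad F z0 x0 = true by rewrite /bad F0 d0 eqxx.
rewrite /= add0n add1n ltnS; apply: leq_sum => x _.
by case: (bad F' z0 x) (F'sub z0 x) => // ->.
Qed.

Lemma image_sinj (b d : comp) (F : HomX b d) : in_image (sinj F).
Proof.
apply: (@image_of_dist (supp_size d + supp_size b)) => z x _.
have [p [zp xp]] := exists_off2 z x.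
rewrite -(npts_col_supp_size n_gt0 z) -(npts_col_supp_size n_gt0 x) /dist.
rewrite !(@npts_count _ p) => [|a /xp ->|a /zp ->|a pa] //; last by rewrite zp // xp.
rewrite -count_predUI (leq_trans _ (leq_addr _ _)) // sub_count // => a /=.
by apply: contraNT; rewrite negb_or !negbK => /andP[/eqP -> /eqP ->].
Qed.

Lemma psi_surj (y : Schur n t) : exists x : Udot n t, psi n_gt0 x = y.
Proof.
suff [x <-] : in_image y by exists (Udot_pi x); exact: psi_pi.
have [s ->] := Schur_decomp y; elim/big_rec: _ => [|i x _ hx]; first exact: image0.
by rewrite -[sinj _]scale1r; apply: image_lin => //; exact: image_sinj.
Qed.

End Surjectivity.

Theorem corollary8p6p3 (k : fieldType) (char0 : [pchar k] =i pred0)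
    (n : option nat) (n_gt0 : n != Some 0%N) (t : k) :
  exists psi : Udot n t -> Schur n t,
    lu_map psi /\ (forall y : Schur n t, exists x : Udot n t, psi x = y).
Proof.
exists (psi n_gt0 (t := t)); split; first exact: psi_lu_map.
exact: psi_surj.
Qed.
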